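(* Let $d\in\mathbb{N}$, $d\ge1$, let $N\subseteq\mathbb{R}^d$ be measurable, and let $\alpha,\lambda>0$ satisfy $2\pi\sqrt{d}\,\alpha\lambda<j_{d/2}(1)$. Then for all $G\in\mathcal{B}_1([-\lambda,\lambda]^d)$, $$\|G\chi_N\|_1\le\frac{(\sqrt{d}\,\lambda)^{d/2}}{\alpha^{d/2}J_{d/2}(2\pi\sqrt{d}\,\alpha\lambda)}\;\sup_{x\in\mathbb{R}^d}\bigl|N\cap B(x,\alpha)\bigr|\;\|G\|_1 .$$
   Context: The Fourier transform on $\mathbb{R}^d$ is normalized by $\widehat{\varphi}(t)=\int\varphi(x)e^{-2\pi i x\cdot t}\,dx$. For a convex body $M\subseteq\mathbb{R}^d$, $\mathcal{B}_1(M)$ is the Paley-Wiener space of all $G\in L^1(\mathbb{R}^d)$ whose (distributional) Fourier transform is supported in $M$. $J_\nu$ is the Bessel function of the first kind of order $\nu$ and $j_\nu(k)$ is its $k$th positive zero. $B(x,\alpha)$ is the Euclidean ball with center $x$ and radius $\alpha$, $|\cdot|$ is Lebesgue measure, $\chi_N$ is the characteristic function of $N$, and $\|\cdot\|_1$ is the $L^1(\mathbb{R}^d)$ norm. *)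

(* Defs.v *)
From HB Require Import structures.
From mathcomp Require Import all_boot all_order all_algebra.
From mathcomp Require Import all_classical all_reals all_analysis.
From mathcomp Require Import complex.

Set Implicit Arguments.
Unset Strict Implicit.
Unset Printing Implicit Defensive.
Import Order.TTheory GRing.Theory Num.Theory.
Import numFieldNormedType.Exports.

Local Open Scope classical_set_scope.
Local Open Scope ring_scope.

(* The Borel sigma-algebra of R^d, generated by the coordinate functions. *)
Section borel_rV.
Context {R : realType} (d : nat).

Definition rVcoor (i : 'I_d) (x : 'rV[R]_d) : measurableTypeR R := x ord0 i.

Let rV_set0 : g_sigma_preimage rVcoor set0.
Proof. exact: sigma_algebra0. Qed.

Let rV_setC A : g_sigma_preimage rVcoor A -> g_sigma_preimage rVcoor (~` A).
Proof. exact: sigma_algebraC. Qed.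

Let rV_bigcup (F : _^nat) : (forall i, g_sigma_preimage rVcoor (F i)) ->
  g_sigma_preimage rVcoor (\bigcup_i (F i)).
Proof. exact: sigma_algebra_bigcup. Qed.

HB.instance Definition _ := @isMeasurable.Build default_measure_display
  'rV[R]_d (g_sigma_preimage rVcoor) rV_set0 rV_setC rV_bigcup.

End borel_rV.

Section borel_rV_lemmas.
Context {R : realType}.

Lemma measurable_rVcoor d (i : 'I_d) :
  measurable_fun [set: 'rV[R]_d] (rVcoor i).
Proof.
move=> _ Y mY; rewrite setTI; apply: sub_sigma_algebra => /=.
rewrite -bigcup_seq/=; exists i => /=; first by rewrite mem_index_enum.
by exists Y => //; rewrite setTI.
Qed.

Lemma measurable_fun_rV d0 (T : measurableType d0) d (f : T -> 'rV[R]_d) :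
  (forall i, measurable_fun setT (rVcoor i \o f)) -> measurable_fun setT f.
Proof.
move=> mf.
suff : g_sigma_preimage (fun i => rVcoor i \o f) `<=` measurable.
  rewrite g_sigma_preimage_comp => prefS _ A mA.
  by apply: prefS; exists A.
apply: smallest_sub; first exact: sigma_algebra_measurable.
rewrite -bigcup_seq; apply: bigcup_sub => i _ A [B mB <-].
exact: mf.
Qed.

(* R x R^d -> R^(1 + d), where 1 + d and d.+1 are convertible *)
Definition rVcons d (p : measurableTypeR R * 'rV[R]_d) : 'rV[R]_d.+1 :=
  row_mx (p.1)%:M p.2.

Lemma rVcons0 d (p : measurableTypeR R * 'rV[R]_d) :
  rVcons p ord0 ord0 = p.1.
Proof.
rewrite /rVcons (_ : ord0 = lshift d (ord0 : 'I_1)); last exact/val_inj.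
by rewrite (@row_mxEl _ 1 1 d) mxE eqxx mulr1n.
Qed.

Lemma rVconsS d (p : measurableTypeR R * 'rV[R]_d) (i : 'I_d) :
  rVcons p ord0 (lift ord0 i) = p.2 ord0 i.
Proof.
rewrite /rVcons (_ : lift ord0 i = rshift 1 i); last exact/val_inj.
by rewrite (@row_mxEr _ 1 1 d).
Qed.

Lemma measurable_rVcons d : measurable_fun setT (@rVcons d).
Proof.
apply: measurable_fun_rV => i.
case: (unliftP ord0 i) => [j ->|->].
- rewrite (_ : _ \o _ = rVcoor j \o snd).
    by apply: measurableT_comp => //; exact: measurable_rVcoor.
  by apply/funext => p; exact: rVconsS.
- rewrite (_ : _ \o _ = fst) //.
  by apply/funext => p; exact: rVcons0.
Qed.

Definition rVuncons d (x : 'rV[R]_d.+1) : measurableTypeR R * 'rV[R]_d :=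
  (x ord0 ord0, \row_i x ord0 (lift ord0 i)).

Lemma rVconsK d : cancel (@rVcons d) (@rVuncons d).
Proof.
move=> -[a v]; rewrite /rVuncons rVcons0; congr pair.
by apply/rowP => i; rewrite mxE rVconsS.
Qed.

Lemma measurable_rVuncons d : measurable_fun setT (@rVuncons d).
Proof.
apply/measurable_fun_pairP; split.
  rewrite (_ : _ \o _ = rVcoor ord0) //; exact: measurable_rVcoor.
apply: measurable_fun_rV => i.
rewrite (_ : _ \o _ = rVcoor (lift ord0 i)); first exact: measurable_rVcoor.
by apply/funext => x; rewrite /rVcoor/= mxE.
Qed.

End borel_rV_lemmas.

(* The d-fold product of the Lebesgue measure of R, as a Borel measure. *)
Section product_lebesgue.
Context {R : realType}.

Section step.
Variables (d : nat) (m : {sigma_finite_measure set 'rV[R]_d -> \bar R}).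

Definition lebesgue_rVS : set 'rV[R]_d.+1 -> \bar R :=
  pushforward (@lebesgue_measure R \x m)%E (@rVcons R d).

Let lebesgue_rVS0 : lebesgue_rVS set0 = 0%E.
Proof. by rewrite /lebesgue_rVS /pushforward preimage_set0 measure0. Qed.

Let lebesgue_rVS_ge0 A : (0 <= lebesgue_rVS A)%E.
Proof. by rewrite /lebesgue_rVS /pushforward measure_ge0. Qed.

Let lebesgue_rVS_sigma_additive : semi_sigma_additive lebesgue_rVS.
Proof.
have mf : measurable_fun setT (@rVcons R d) by exact: measurable_rVcons.
move=> F mF tF mUF; rewrite /lebesgue_rVS /pushforward preimage_bigcup.
apply: measure_semi_sigma_additive.
- by move=> n; rewrite -[X in measurable X]setTI; exact: mf.
- apply/trivIsetP => /= i j _ _ ij; rewrite -preimage_setI.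
  by move/trivIsetP : tF => /(_ _ _ _ _ ij) ->//; rewrite preimage_set0.
- by rewrite -preimage_bigcup -[X in measurable X]setTI; exact: mf.
Qed.

HB.instance Definition _ := isMeasure.Build _ _ _ lebesgue_rVS
  lebesgue_rVS0 lebesgue_rVS_ge0 lebesgue_rVS_sigma_additive.

Let lebesgue_rVS_sigma_finite : sigma_finite setT lebesgue_rVS.
Proof.
have [F TF Foo] : sigma_finite setT (@lebesgue_measure R \x m)%E.
  have /sigma_finiteP[F [TF ndF Foo]] := sigma_finiteT (@lebesgue_measure R).
  have /sigma_finiteP[G [TG ndG Goo]] := sigma_finiteT m.
  exists (fun n => F n `*` G n).
    rewrite -setXTT TF TG predeqE => -[x y]; split.
      move=> [/= [n _ Fnx] [k _ Gky]]; exists (maxn n k) => //; split.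
      - by move: x Fnx; exact/subsetPset/ndF/leq_maxl.
      - by move: y Gky; exact/subsetPset/ndG/leq_maxr.
    by move=> [n _ []/= ? ?]; split; exists n.
  move=> k; have [? ?] := Foo k; have [? ?] := Goo k.
  split; first exact: measurableX.
  by rewrite product_measure1E// lte_mul_pinfty// ge0_fin_numE.
exists (fun n => @rVuncons R d @^-1` F n).
  by rewrite -preimage_bigcup -TF preimage_setT.
move=> n; have [mF Fn] := Foo n; split.
  by rewrite -[X in measurable X]setTI; exact: measurable_rVuncons.
rewrite /lebesgue_rVS /pushforward -comp_preimage.
by rewrite (_ : _ \o _ = idfun) //; apply/funext => p; exact: rVconsK.
Qed.

HB.instance Definition _ :=
  Measure_isSigmaFinite.Build _ _ _ lebesgue_rVS lebesgue_rVS_sigma_finite.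

End step.

Fixpoint borel_lebesgue (d : nat) :
    {sigma_finite_measure set 'rV[R]_d -> \bar R} :=
  match d with
  | 0 => dirac (0 : 'rV[R]_0)
  | d'.+1 => lebesgue_rVS (borel_lebesgue d')
  end.

End product_lebesgue.

(* Lebesgue measure on R^d, on the sigma-algebra of all Lebesgue measurable
   sets: the completion of the Borel one. *)
Section lebesgue.
Context (R : realType) (d : nat).

Definition Rd := caratheodory_type ((@borel_lebesgue R d)^*)%mu.

Definition lebesgue_Rd : set Rd -> \bar R :=
  @completed_measure_extension _ _ _ (@borel_lebesgue R d).

HB.instance Definition _ := Measure.on lebesgue_Rd.

Let lebesgue_Rd_sigma_finite : sigma_finite setT lebesgue_Rd.
Proof.
apply: completed_measure_extension_sigma_finite; exact: sigma_finiteT.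
Qed.

HB.instance Definition _ :=
  Measure_isSigmaFinite.Build _ _ _ lebesgue_Rd lebesgue_Rd_sigma_finite.

End lebesgue.

Section paley_wiener.
Context {R : realType} {d : nat}.
Implicit Types (x t : 'rV[R]_d) (f : 'rV[R]_d -> R[i]).

Definition dotp x t : R := \sum_(i < d) x ord0 i * t ord0 i.

(* the norm `|x| of 'rV[R]_d in the library is the sup norm *)
Definition eball x (a : R) : set (Rd R d) :=
  [set y : 'rV[R]_d | Num.sqrt (dotp (y - x) (y - x)) < a].

Definition cube (a : R) : set 'rV[R]_d := [set t | forall i, `|t ord0 i| <= a].

(* `|z| is an element of R[i] with zero imaginary part. *)
Definition cmod (z : R[i]) : R := complex.Re `|z|.

Definition L1 f := (@lebesgue_Rd R d).-integrable setT (EFin \o (@complex.Re R \o f))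
  /\ (@lebesgue_Rd R d).-integrable setT (EFin \o (@complex.Im R \o f)).

Definition norm1 f : \bar R := (\int[@lebesgue_Rd R d]_x (cmod (f x))%:E)%E.

Definition integralC f : R[i] :=
  ((\int[@lebesgue_Rd R d]_x complex.Re (f x))
   +i* (\int[@lebesgue_Rd R d]_x complex.Im (f x)))%C.

Definition cis (u : R) : R[i] := (cos u +i* sin u)%C.

Definition fourier f t : R[i] :=
  integralC (fun x => f x * cis (- (2 * pi * dotp x t))).

(* For f in L^1, the distributional Fourier transform is the continuous
   function [fourier f], so that its support is the closure of the set where
   this function does not vanish. *)
Definition supp f : set 'rV[R]_d := closure [set t | f t != 0].

Definition paley_wiener1 (M : set 'rV[R]_d) : set ('rV[R]_d -> R[i]) :=
  [set G | L1 G /\ supp (fourier G) `<=` M].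

End paley_wiener.

Section bessel.
Context {R : realType}.

(* Euler's Gamma function, for s > 0 *)
Definition Gamma (s : R) : R :=
  \int[@lebesgue_measure R]_(x in `]0, +oo[) (x `^ (s - 1) * expR (- x)).

(* The power series of J_nu(z), meaningful for nu >= 0 and z > 0: powR is 1 at
   negative arguments. *)
Definition besselJ (nu z : R) : R :=
  limn (series (fun k : nat =>
    (- 1) ^+ k / (k`!%:R * Gamma (k%:R + nu + 1)) *
    (z / 2) `^ (2 * k%:R + nu))).

(* bessel_zero nu k is the k-th positive zero j_nu(k) for k >= 1: the least
   zero greater than the previous one.  The infimum is attained because the zeros
   of J_nu in ]0, +oo[ are isolated and do not accumulate at 0. *)
Fixpoint bessel_zero (nu : R) (k : nat) : R :=
  if k is k'.+1 then inf [set z | bessel_zero nu k' < z /\ besselJ nu z = 0]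
  else 0.

End bessel.

(* Main.v *)
(* Let nu = d/2 and let K be the indicator function of B(0, alpha). Its Fourier
   transform is Psi(|t|^2) for the entire function
     Psi(s) = (alpha / sqrt s)^nu J_nu(2 pi alpha sqrt s),
   which is positive on [0, d lambda^2]. Since Psi satisfies a Bessel equation,
   - Psi' / Psi satisfies a Riccati equation which forces its Taylor coefficients
   to be nonnegative; so are then those of 1 / Psi = sum_n a_n s^n, and this
   series converges at s = d lambda^2.
   On [- lambda, lambda], t^2 = sum_m c_m cos(pi m t / lambda) with
   sum_m |c_m| = lambda^2, so that t_i^2 acts on the functions with spectrum in the
   cube as a Fourier multiplier of L^1 norm at most lambda^2, and 1 / Psi(|t|^2) as
   one of norm at most sum_n a_n (d lambda^2)^n = 1 / Psi(d lambda^2).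
   Therefore G = K * H with |H|_1 <= |G|_1 / Psi(d lambda^2), and by Tonelli the
   integral of |K * H| over N is at most sup_x |N \cap B(x, alpha)| |H|_1. *)
Require Import Defs.
From HB Require Import structures.
From mathcomp Require Import all_boot all_order all_algebra.
From mathcomp Require Import all_classical all_reals all_analysis.
From mathcomp Require Import complex.
From mathcomp Require Import measurable_realfun.
From mathcomp Require Import ring lra.

Set Implicit Arguments.
Unset Strict Implicit.
Unset Printing Implicit Defensive.
Import Order.TTheory GRing.Theory Num.Theory.
Import numFieldNormedType.Exports.

Local Open Scope classical_set_scope.
Local Open Scope ring_scope.

(** * Positivity of the reciprocal power series *)

(** The coefficients a_n come from a formal computation, so the convergence of the series of 1 / Psi
    at d lambda^2 needs its own argument, found here without complex analysis: as all terms are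
    nonnegative, the truncations of the solution of the Riccati equation are subsolutions, and a
    maximum principle on a real segment compares them with - Psi' / Psi. The norm lambda^2 of t_i^2
    comes from signs: at t_i = lambda every term of the cosine series is nonnegative, so that the
    sum of the |c_m| is the value of the series there. The transform of the ball is expanded through
    the even moments of the ball. They come from computing Gaussian moments in two ways, which
    replaces polar coordinates and also shows that Gamma is finite and positive at the arguments k +
    d/2 + 1. The equality G = K * H is first known on the Fourier side only. The injectivity that it
    requires is obtained without an inversion formula: the functions with zero transform are stable
    under multiplication by Borel indicators. All of this is done for Borel representatives; G and
    N, which are only Lebesgue measurable, are replaced by such representatives off a null set. *)

Section recursion.
Context {T : Type}.
Variables (F : nat -> (nat -> T) -> T) (x0 : T).
Hypothesis F_local : forall n u v, (forall k, (k < n)%N -> u k = v k) -> F n u = F n v.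

Let Fixpoint tbl n : nat -> T :=
  if n is m.+1 then fun k => if k == m then F m (tbl m) else tbl m k
  else fun=> x0.

(** Course-of-values recursion: the recursions for [q] and [a] below involve all earlier terms.
    [tbl n] stores the values of index below [n] and the default [x0] elsewhere; by [F_local], [F n]
    does not depend on the defaults. *)
Lemma strong_recursion : exists u : nat -> T, forall n, u n = F n u.
Proof.
exists (fun n => tbl n.+1 n) => n.
have tblE m k : (k < m)%N -> tbl m k = tbl k.+1 k.
  elim: m => // m ih; rewrite ltnS leq_eqVlt => /predU1P[->//|km].
  by rewrite [LHS]/= ltn_eqF// ih.
by rewrite [LHS]/= eqxx; apply: F_local => k kn; exact: tblE.
Qed.
End recursion.

Section formal_inverse.
Context {R : realType}.
Implicit Types (p q : {poly R}).

Definition cauchy_prod (a b : nat -> R) n := \sum_(i < n.+1) a i * b (n - i)%N.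

(** Congruence to 0 modulo X^K. Identities between formal power series are checked on truncations,
    as polynomial identities modulo a power of X, where [ring] and the rules of derivation are
    available. *)
Let van K p := forall i, (i < K)%N -> p`_i = 0.

Let vanD K p q : van K p -> van K q -> van K (p + q).
Proof. by move=> hp hq i iK; rewrite coefD hp// hq// addr0. Qed.

Let vanN K p : van K p -> van K (- p).
Proof. by move=> hp i iK; rewrite coefN hp// oppr0. Qed.

Let vanM K p q : van K q -> van K (p * q).
Proof.
move=> hq i iK; rewrite coefM big1// => j _; rewrite hq ?mulr0//.
exact: leq_ltn_trans (leq_subr _ _) iK.
Qed.

Let vanXd K p : van K p -> van K ('X * p^`()).
Proof.
by move=> hp [|i] iK; rewrite coefXM//= coef_deriv hp// mul0rn.
Qed.

Let coef_trM M (u v : nat -> R) i : (i < M)%N ->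
  ((\poly_(k < M) u k) * (\poly_(k < M) v k))`_i = cauchy_prod u v i.
Proof.
move=> iM; rewrite coefM; apply: eq_bigr => j _; rewrite !coef_poly.
rewrite (leq_ltn_trans _ iM) ?leq_ord// (leq_ltn_trans _ iM)//.
exact: leq_subr.
Qed.

(* [q] is minus the logarithmic derivative of the series [psi], so that it
   solves the Riccati equation [s q' + b q = c + s q^2], whose recursion has
   nonnegative coefficients. *)
Lemma inverse_series_ge0 (b c psi0 : R) (psi : nat -> R) :
  0 < b -> 0 < c -> 0 < psi0 -> psi 0%N = psi0 ->
  (forall k, k.+1%:R * (k%:R + b) * psi k.+1 = - c * psi k) ->
  exists q a : nat -> R, [/\ forall n, 0 <= q n, forall n, 0 <= a n,
   forall n, (n%:R + b) * q n = (if n is m.+1 then cauchy_prod q q m else c),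
   forall n, n.+1%:R * a n.+1 = cauchy_prod q a n &
   forall n, cauchy_prod a psi n = (n == 0)%N%:R].
Proof.
move=> b0 c0 p0 psi0E psiS.
have [q qE] : exists q : nat -> R, forall n,
    q n = (if n is m.+1 then cauchy_prod q q m else c) / (n%:R + b).
  pose F n (q : nat -> R) := (if n is m.+1 then cauchy_prod q q m else c) / (n%:R + b).
  apply: (@strong_recursion _ F 0).
  move=> [//|n] u v uv; congr (_ / _); apply: eq_bigr => i _.
  by rewrite !uv// ltnS ?leq_subr//; exact: leq_ord.
(* The formal solution of u' = sg q u with u(0) = u0. The sign -1 gives [p], to be identified with
   psi, and the sign 1 gives its reciprocal [a]. *)
have rec_div (u0 sg : R) : exists u : nat -> R, u 0%N = u0 /\ forall n,
    n.+1%:R * u n.+1 = sg * cauchy_prod q u n.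
  have [u uE] : exists u : nat -> R, forall n,
      u n = if n is m.+1 then sg * cauchy_prod q u m / n%:R else u0.
    pose F n (u : nat -> R) := if n is m.+1 then sg * cauchy_prod q u m / n%:R else u0.
    apply: (@strong_recursion _ F 0).
    move=> [//|n] u v uv; congr (_ * _ / _); apply: eq_bigr => i _.
    by rewrite !uv// ltnS leq_subr.
  exists u; split; first by rewrite uE.
  by move=> n; rewrite uE mulrC divfK// pnatr_eq0.
have [p [pi0 piS]] := rec_div psi0 (-1).
have [a [a0 aS]] := rec_div psi0^-1 1.
have bn n : 0 < n%:R + b :> R by rewrite ltr_wpDl.
have qn n : (n%:R + b) * q n = (if n is m.+1 then cauchy_prod q q m else c).
  by rewrite [q n in LHS]qE mulrC divfK ?gt_eqF.
have q_ge0 n : 0 <= q n.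
  elim/ltn_ind : n => n ih; rewrite qE divr_ge0 ?(ltW (bn _))//.
  case: n ih => [_|n ih]; first exact: ltW.
  apply: sumr_ge0 => i _; rewrite mulr_ge0 ?ih// ?ltnS ?leq_subr//; exact: leq_ord.
have a_ge0 n : 0 <= a n.
  elim/ltn_ind : n => -[_|n ih]; first by rewrite a0 invr_ge0 ltW.
  suff: 0 <= n.+1%:R * a n.+1 by rewrite pmulr_rge0.
  rewrite aS mul1r; apply: sumr_ge0 => i _.
  by rewrite mulr_ge0 ?ih// ltnS leq_subr.
have E2 M : let Q := \poly_(k < M) q k in
    van M ('X * Q^`() + b%:P * Q - c%:P - 'X * (Q * Q)).
  move=> Q i iM; rewrite !coefD !coefN coefC coefCM !coefXM coef_deriv.
  case: i iM => [|i] iM; rewrite /=.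
    by rewrite add0r subr0 coef_poly iM -(qn 0%N) add0r subrr.
  rewrite subr0 !coef_poly !iM coef_trM ?(ltn_trans _ iM)//.
  by rewrite -mulr_natl -mulrDl (qn i.+1) subrr.
have E1 M : let Q := \poly_(k < M) q k in let P := \poly_(k < M) p k in
    van M.-1 (P^`() + Q * P).
  case: M => // M Q P i iM; rewrite coefD coef_deriv coef_trM ?(ltn_trans iM)//.
  by rewrite coef_poly !ltnS iM -mulr_natl piS mulN1r addNr.
have E3 M : let Q := \poly_(k < M) q k in let P := \poly_(k < M) a k in
    van M.-1 (P^`() - Q * P).
  case: M => // M Q P i iM; rewrite coefD coefN coef_deriv coef_trM ?(ltn_trans iM)//.
  by rewrite coef_poly !ltnS iM -mulr_natl aS mul1r subrr.
(* By the Riccati equation of [q], a solution of p' = - q p satisfies X p'' + b p' + c p = 0. The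
   coefficients of this equation give the recursion that defines psi from psi(0). *)
have ppsi n : p n = psi n.
  elim: n => [|n ih]; first by rewrite pi0.
  apply: (@mulfI _ (n.+1%:R * (n%:R + b))).
    by rewrite mulf_neq0 ?pnatr_eq0 ?gt_eqF.
  rewrite psiS -ih; apply/eqP; rewrite -subr_eq0 mulNr opprK.
  have {E1}e1 := E1 n.+3; have {E2}e2 := E2 n.+3.
  set Q := \poly_(k < n.+3) q k in e1 e2.
  set P := \poly_(k < n.+3) p k in e1.
  have : van n.+2 ('X * P^`()^`() + b%:P * P^`() + c%:P * P).
    rewrite [X in van _ X](_ : _ = 'X * (P^`() + Q * P)^`()
       + (b%:P - 'X * Q) * (P^`() + Q * P) -
       P * ('X * Q^`() + b%:P * Q - c%:P - 'X * (Q * Q))); last first.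
      by rewrite derivD derivM; ring.
    apply: vanD; [apply: vanD|].
    - exact: vanXd.
    - exact: vanM.
    - apply/vanN/vanM => i ilt; apply: e2; exact: ltnW.
  move=> /(_ n (leqW (leqnn _))).
  rewrite !coefD !coefCM coefXM !coef_deriv !coef_poly !ltnS (leqW (leqnn _)).
  have -> : (n <= n.+2)%N by exact: ltnW.
  move=> h; apply/eqP; rewrite -{}[RHS]h {e1 e2 Q P}.
  case: n ih => [|n] ih /=; first by rewrite !mulr1n mul1r !add0r.
  rewrite leqnSn -(mulr_natl (p _ *+ _)) -!(mulr_natl (p _)).
  by move: (n.+2%:R) (n.+1%:R) => u v; ring.
exists q, a; split => //.
  by move=> n; rewrite aS mul1r.
move=> [|n].
  by rewrite /cauchy_prod big_ord1 a0 psi0E mulVf// gt_eqF.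
have {E1}e1 := E1 n.+3; have {E3}e3 := E3 n.+3.
set Q := \poly_(k < n.+3) q k in e1 e3.
set P := \poly_(k < n.+3) p k in e1.
set A := \poly_(k < n.+3) a k in e3.
(* From a' = q a and p' = - q p, the derivative of a p is 0: all coefficients of a p but the
   constant one vanish. *)
have : van n.+2 (A * P)^`().
  rewrite derivM [X in van _ X](_ : _ = P * (A^`() - Q * A) + A * (P^`() + Q * P)); last by ring.
  by apply: vanD; exact: vanM.
move=> /(_ n (leqW (leqnn _)))/eqP; rewrite coef_deriv mulrn_eq0/=.
rewrite /A /P coef_trM ?ltnS ?leqW// => /eqP h; rewrite -[RHS]h.
by apply: eq_bigr => i _; rewrite ppsi.
Qed.

End formal_inverse.

(** * Mertens' theorem on Cauchy products *)

Section mertens.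
Context {R : realType}.
Implicit Types a b : nat -> R.

Let series0 a : series a 0%N = 0.
Proof. by rewrite /series/= big_geq. Qed.

Lemma series_cauchy_prod a b n :
  series (cauchy_prod a b) n = \sum_(0 <= i < n) a i * series b (n - i)%N.
Proof.
elim: n => [|n ih]; first by rewrite /series/= !big_geq.
rewrite seriesSr ih big_nat_recr//= subSnn seriesSr series0 add0r /cauchy_prod.
rewrite !big_mkord big_ord_recr/= subnn addrA; congr (_ + _).
rewrite -big_split/=; apply: eq_bigr => i _.
by rewrite subSn ?(ltnW (ltn_ord i))// seriesSr mulrDr.
Qed.

(** Mertens' theorem: since [a] is nonnegative its convergence is absolute, and plain convergence of
    the series of [b] suffices. *)
Lemma cvg_series_cauchy_prod a b (la lb : R) : (forall n, 0 <= a n) ->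
  series a @ \oo --> la -> series b @ \oo --> lb ->
  series (cauchy_prod a b) @ \oo --> la * lb.
Proof.
move=> a0 ala blb.
have [K [Kr /(_ (K + 1))HK]] : \forall K \near +oo, forall n, `|series b n| <= K.
  have /cvg_seq_bounded : cvgn (series b) by apply/cvg_ex; exists lb.
  by move=> [M [Mr HM]]; exists M; split => // x Mx n; exact: HM.
pose L := K + 1 + `|lb|.
have d_le n : `|series b n - lb| <= L.
  by rewrite (le_trans (ler_normB _ _))// lerD2r HK// ltrDl.
have L0 : 0 <= L by apply: le_trans (d_le 0%N).
have A_le n : series a n <= la.
  rewrite -(cvg_lim _ ala)//.
  apply: nondecreasing_cvgn_le => //; last by apply/cvg_ex; exists la.
  by apply: nondecreasing_series => i _ _; exact: a0.
have la0 : 0 <= la by apply: le_trans (A_le 0%N); rewrite series0.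
suff h : (fun n => series (cauchy_prod a b) n - series a n * lb) @ \oo --> (0 : R).
  have -> : series (cauchy_prod a b) =
      (fun n => series (cauchy_prod a b) n - series a n * lb + series a n * lb).
    by apply/funext => n; rewrite subrK.
  rewrite -[la * lb]add0r; apply: cvgD => //.
  by apply: cvgM => //; exact: cvg_cst.
apply/cvgrPdist_le => e e0.
(* The error splits into three parts: the indices below [M] cost at most la e', the remaining ones
   at most e' L, where [L] bounds every |series b n - lb|, and the error on [la] is absorbed in the
   slack e'. *)
pose e' := e / (la + L + 1).
have D0 : 0 < la + L + 1 by rewrite ltr_wpDl// addr_ge0.
have e'0 : 0 < e' by rewrite divr_gt0.
have /cvgrPdist_le/(_ _ e'0)[N _ HN] := blb.
have /cvgrPdist_le/(_ _ e'0)[M _ HM] := ala.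
exists (N + M)%N => //= n /= NMn.
have Mn : (M <= n)%N by rewrite (leq_trans _ NMn)// leq_addl.
rewrite sub0r normrN series_cauchy_prod /series/= mulr_suml -sumrB.
rewrite (le_trans (ler_norm_sum _ _ _))//.
under eq_bigr do rewrite -mulrBr normrM ger0_norm//.
rewrite (big_cat_nat (leq0n M) Mn)/=.
have -> : e = la * e' + e' * L + e'.
  by rewrite /e'; field; rewrite gt_eqF.
rewrite -[leLHS]addr0 lerD ?(ltW e'0)// lerD//.
  apply: (@le_trans _ _ (\sum_(0 <= i < M) a i * e')).
    apply: ler_sum_nat => i /andP[_ iM]; apply: ler_wpM2l => //.
    rewrite distrC; apply: HN => /=.
    by rewrite leq_subRL ?(ltnW (leq_trans iM Mn))// addnC (leq_trans _ NMn)// leq_add2l ltnW.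
  by rewrite -mulr_suml ler_wpM2r ?(ltW e'0)// -[leLHS]/(series a M).
apply: (@le_trans _ _ (\sum_(M <= i < n) a i * L)).
  by apply: ler_sum_nat => i _; apply: ler_wpM2l => //; exact: d_le.
rewrite -mulr_suml ler_wpM2r//.
have -> : \sum_(M <= i < n) a i = series a n - series a M.
  by rewrite sub_series_geq.
have := HM M (leqnn _); rewrite ger0_norm ?subr_ge0//.
by apply: le_trans; rewrite lerD2r.
Qed.

End mertens.

(** * Monotonicity and a maximum principle *)

Section real_derivatives.
Context {R : realType}.
Implicit Types f df : R -> R.

Lemma is_derive_within_continuous f df (i : interval R) :
  (forall x : R, is_derive x 1 f (df x)) -> {within [set` i], continuous f}.
Proof.
by move=> fdf; apply: derivable_within_continuous => x _; exact: ex_derive.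
Qed.

Lemma is_derive_nonincreasing f df (a b : R) :
  (forall x : R, is_derive x 1 f (df x)) -> a <= b ->
  (forall x, a < x < b -> df x <= 0) -> f b <= f a.
Proof.
move=> fdf; rewrite le_eqVlt => /predU1P[->//|ab] df0.
have [|c cab E] := @MVT _ f df a b ab (fun x _ => fdf x).
  exact: is_derive_within_continuous.
by rewrite -subr_le0 E pmulr_lle0 ?subr_gt0// df0// -in_itv.
Qed.

Lemma is_derive_mulr (f g : R -> R) (x df dg : R) :
  is_derive x 1 f df -> is_derive x 1 g dg ->
  is_derive x 1 (fun y => f y * g y) (df * g x + f x * dg).
Proof.
move=> fdf gdg.
apply: (@is_derive_eq _ _ _ _ _ _ _ _ (is_deriveM fdf gdg)).
by rewrite addrC /GRing.scale/= [g x * df]mulrC.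
Qed.

Lemma is_derive_lt0_left f (c dc : R) : is_derive c 1 f dc -> dc < 0 -> 0 < c ->
  exists2 x, 0 < x < c & f c < f x.
Proof.
move=> fc dc0 c0.
have : h^-1 *: (f (h *: 1 + c) - f c) @[h --> 0^'] --> dc.
  by rewrite -(@derive_val _ _ _ _ _ _ _ fc); exact: (@ex_derive _ _ _ _ _ _ _ fc).
move=> /cvgr_lt/(_ _ dc0)/nbhs_ballP[e /= e0 He].
pose h := Num.min (e / 2) (c / 2).
have h0 : 0 < h by rewrite lt_min !divr_gt0.
have hc : h < c by rewrite gt_min [X in _ || X]ltr_pdivrMr// ltr_pMr// ltr1n orbT.
have he : h < e by rewrite gt_min ltr_pdivrMr// ltr_pMr// ltr1n.
exists (c - h); first by rewrite subr_gt0 hc gtrBl h0.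
have := He (- h); rewrite /ball/= sub0r opprK gtr0_norm// => /(_ he).
rewrite oppr_eq0 gt_eqF// => /(_ isT).
rewrite /GRing.scale/= mulr1 invrN mulNr oppr_lt0 pmulr_rgt0 ?invr_gt0//.
by rewrite subr_gt0 addrC.
Qed.

(* At a positive maximum [c] of [v] on [0, S] one has [v' c >= 0]. *)
Lemma le0_of_linear_ode (v dv : R -> R) (S b : R) :
  (forall x : R, is_derive x 1 v (dv x)) -> 0 < b -> 0 <= S -> v 0 <= 0 ->
  (forall x, 0 < x <= S -> 0 < v x -> x * dv x <= - b * v x) ->
  v S <= 0.
Proof.
move=> vdv b0 S0 v0 H.
have [c] := EVT_max S0 (is_derive_within_continuous vdv).
rewrite in_itv/= => /andP[c0 cS] vmax.
have vSc : v S <= v c by apply: vmax; rewrite in_itv/= S0 lexx.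
rewrite (le_trans vSc)// leNgt; apply/negP => vc0.
have {}c0 : 0 < c.
  by rewrite lt_neqAle c0 andbT; apply/eqP => c0'; move: vc0; rewrite -c0' ltNge v0.
have dvc0 : dv c < 0.
  have : c * dv c < 0.
    by rewrite (le_lt_trans (H c _ vc0)) ?c0// mulNr oppr_lt0 mulr_gt0.
  by rewrite pmulr_rlt0.
have [x /andP[x0 xc]] := is_derive_lt0_left (vdv c) dvc0 c0.
by rewrite ltNge vmax// in_itv/= (ltW x0) (le_trans (ltW xc)).
Qed.

End real_derivatives.

(** * Entire power series *)

Section entire_series.
Context {R : realType}.
Implicit Types f : nat -> R.

(** Domination by the Taylor coefficients of C exp(c x). This condition is stable under formal
    derivation and gives convergence everywhere, hence termwise differentiation to any order. *)
Definition exp_bounded f := exists C c : R, [/\ 0 <= C, 0 <= c &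
  forall k, `|f k| <= C * c ^+ k / k`!%:R].

Lemma exp_bounded_diffs f : exp_bounded f -> exp_bounded (pseries_diffs f).
Proof.
move=> [C [c [C0 c0 H]]]; exists (C * c), c; split => //; first exact: mulr_ge0.
move=> k; rewrite /pseries_diffs normrM ger0_norm//.
rewrite (le_trans (ler_wpM2l _ (H k.+1)))// factS natrM exprS.
rewrite le_eqVlt; apply/orP; left; apply/eqP; field.
by rewrite nat1r !pnatr_eq0/= -lt0n fact_gt0.
Qed.

Lemma exp_bounded_cvg_norm f x : exp_bounded f ->
  cvgn (series (fun k => `|f k * x ^+ k|)).
Proof.
move=> [C [c [C0 c0 H]]].
apply: (@series_le_cvg _ _ (fun k => C * exp_coeff (c * `|x|) k)) => //.
- by move=> k; rewrite mulr_ge0// /exp_coeff/= divr_ge0// exprn_ge0// mulr_ge0.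
- move=> k; rewrite normrM normrX /exp_coeff/= exprMn mulrA [leRHS]mulrAC.
  by rewrite mulrA ler_wpM2r// ?exprn_ge0// mulrAC.
- apply: is_cvg_seriesZ; exact: is_cvg_series_exp_coeff.
Qed.

Lemma exp_bounded_cvg f x : exp_bounded f -> cvgn (pseries f x).
Proof. by move=> /(@exp_bounded_cvg_norm _ x) h; exact: normed_cvg. Qed.

Lemma exp_bounded_is_derive f x : exp_bounded f ->
  is_derive x (1 : R) (fun y => limn (pseries f y)) (limn (pseries (pseries_diffs f) x)).
Proof.
move=> hf; apply: (@pseries_snd_diffs _ f (`|x| + 1)).
- exact: exp_bounded_cvg.
- exact/exp_bounded_cvg/exp_bounded_diffs.
- exact/exp_bounded_cvg/exp_bounded_diffs/exp_bounded_diffs.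
- by rewrite [ltRHS]ger0_norm ?addr_ge0// ltrDl.
Qed.

Lemma lim_pseries0 f : limn (pseries f 0) = f 0%N.
Proof.
apply: (@lim_near_cst R^o) => //; exists 1%N => //= -[//|n] _.
rewrite /pseries /series/= big_nat_recl//= big1 ?addr0 ?mulr1// => i _.
by rewrite expr0n mulr0.
Qed.

End entire_series.

(** * The reciprocal of a Bessel-type series on a segment of positivity *)

Section inverse_of_bessel_type_series.
Context {R : realType}.
Variables (b c : R) (psi : nat -> R).
Hypotheses (b1 : 1 <= b) (c0 : 0 < c) (psi0 : 0 < psi 0%N).
Hypothesis psiS : forall k, k.+1%:R * (k%:R + b) * psi k.+1 = - c * psi k.

(** As k + b >= 1, the recursion gives (k + 1) |psi(k + 1)| <= c |psi(k)|. *)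
Lemma exp_bounded_bessel_type : exp_bounded psi.
Proof.
exists (psi 0%N), c; split; [exact: ltW|exact: ltW|].
elim => [|k ih]; first by rewrite expr0 fact0 divr1 mulr1 gtr0_norm.
have kb : 1 <= k%:R + b by rewrite (le_trans b1)// lerDr.
have k1 : 0 < k.+1%:R :> R by [].
have : k.+1%:R * `|psi k.+1| <= c * `|psi k|.
  rewrite -[c in leRHS]gtr0_norm// -[X in _ <= X * _]normrN -normrM -psiS 2!normrM.
  rewrite ler_wpM2r// ger0_norm// ler_peMr//.
  by rewrite ger0_norm// (le_trans _ kb).
rewrite -ler_pdivlMl// => /le_trans; apply.
apply: (@le_trans _ _ (k.+1%:R^-1 * (c * (psi 0%N * c ^+ k / k`!%:R)))).
  by rewrite ler_pM2l ?invr_gt0// ler_wpM2l// ltW.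
rewrite factS natrM exprS le_eqVlt; apply/orP; left; apply/eqP; field.
by rewrite nat1r !pnatr_eq0/= -lt0n fact_gt0.
Qed.

Let Psi s := limn (pseries psi s).
Let D s := limn (pseries (pseries_diffs psi) s).
Let D2 s := limn (pseries (pseries_diffs (pseries_diffs psi)) s).

Let ebpsi := exp_bounded_bessel_type.

Let is_derive_Psi x : is_derive x (1 : R) Psi (D x).
Proof. exact: exp_bounded_is_derive. Qed.

Let is_derive_D x : is_derive x (1 : R) D (D2 x).
Proof. exact/exp_bounded_is_derive/exp_bounded_diffs. Qed.

Let Psi_ode s : s * D2 s + b * D s + c * Psi s = 0.
Proof.
have h1 : pseries psi s n.+1 @[n --> \oo] --> Psi s.
  by rewrite (cvg_shiftS (pseries psi s)); exact: exp_bounded_cvg.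
have h2 : pseries (pseries_diffs psi) s n.+1 @[n --> \oo] --> D s.
  rewrite (cvg_shiftS (pseries _ s)).
  exact/exp_bounded_cvg/exp_bounded_diffs.
have h3 : pseries (pseries_diffs (pseries_diffs psi)) s @ \oo --> D2 s.
  exact/exp_bounded_cvg/exp_bounded_diffs/exp_bounded_diffs.
(* The partial sums are shifted so that the recursion cancels them degree by degree: this
   combination is exactly 0 for every [n], not only in the limit. *)
have h : s * pseries (pseries_diffs (pseries_diffs psi)) s n +
    b * pseries (pseries_diffs psi) s n.+1 + c * pseries psi s n.+1
    @[n --> \oo] --> s * D2 s + b * D s + c * Psi s.
  by apply: cvgD; [apply: cvgD|]; apply: cvgM => //; exact: cvg_cst.
rewrite -(cvg_lim _ h)//; apply: (@lim_near_cst R^o) => //; apply: nearW.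
elim => [|n ih] /=.
  rewrite /pseries /series/= !big_nat1 big_geq// mulr0 add0r !mulr1.
  have := psiS 0; rewrite /pseries_diffs !mul1r add0r mulNr => ->.
  by rewrite addNr.
move: ih; rewrite /pseries !(seriesSr _ n.+1) !(seriesSr _ n) => ih.
rewrite -[RHS]addr0 -{1}[in RHS]ih.
have E : s * (pseries_diffs (pseries_diffs psi) n * s ^+ n) +
    b * (pseries_diffs psi n.+1 * s ^+ n.+1) + c * (psi n.+1 * s ^+ n.+1) = 0.
  have := psiS n.+1; rewrite /pseries_diffs exprS.
  move=> /eqP; rewrite mulNr -addr_eq0 => /eqP E.
  rewrite -[RHS](mul0r (s * s ^+ n)) -E.
  by move: (n.+2%:R) (n.+1%:R) => u v; ring.
by rewrite -[X in _ = _ + X]E /=; ring.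
Qed.

Let horner_le (p q : {poly R}) x : 0 <= x ->
  (forall i, p`_i <= q`_i) -> p.[x] <= q.[x].
Proof.
move=> x0 pq; rewrite -subr_ge0 -hornerN -hornerD horner_coef.
apply: sumr_ge0 => i _; rewrite mulr_ge0 ?exprn_ge0// coefD coefN subr_ge0.
exact: pq.
Qed.

Let horner_ge0 (p : {poly R}) x : 0 <= x -> (forall i, 0 <= p`_i) -> 0 <= p.[x].
Proof.
move=> x0 hp; rewrite horner_coef; apply: sumr_ge0 => i _.
by rewrite mulr_ge0// exprn_ge0.
Qed.

Variable S : R.
Hypotheses (S0 : 0 <= S) (Psi_gt0 : forall s, 0 <= s <= S -> 0 < Psi s).

(* The truncation [Q] of [q = - psi' / psi] is a subsolution of the Riccati
   equation of [q], hence [Q <= - psi' / psi] on [0, S], and then the product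
   of the truncation of [a = 1 / psi] and [psi] is nonincreasing. *)
Lemma truncated_inverse_le (q a : nat -> R) N :
  (forall n, 0 <= q n) -> (forall n, 0 <= a n) ->
  (forall n, (n%:R + b) * q n = (if n is m.+1 then cauchy_prod q q m else c)) ->
  (forall n, n.+1%:R * a n.+1 = cauchy_prod q a n) ->
  a 0%N * psi 0%N = 1 ->
  (\poly_(i < N.+1) a i).[S] * Psi S <= 1.
Proof.
move=> q0 a0 qE aE a0E.
set A := \poly_(i < N.+1) a i.
pose Q := \poly_(i < N.+1) q i.
have Qi i : 0 <= Q`_i by rewrite coef_poly; case: ifP.
have Ai i : 0 <= A`_i by rewrite coef_poly; case: ifP.
have coefM_ge0 (p r : {poly R}) i : (forall j, 0 <= p`_j) -> (forall j, 0 <= r`_j) ->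
    0 <= (p * r)`_i.
  by move=> hp hr; rewrite coefM; apply: sumr_ge0 => j _; exact: mulr_ge0.
have coef_trM (u v : nat -> R) i : (i < N.+1)%N ->
    ((\poly_(k < N.+1) u k) * (\poly_(k < N.+1) v k))`_i = cauchy_prod u v i.
  move=> iM; rewrite coefM; apply: eq_bigr => j _; rewrite !coef_poly.
  rewrite (leq_ltn_trans _ iM) ?leq_ord// (leq_ltn_trans _ iM)//.
  exact: leq_subr.
(* A' and Q A agree up to degree N - 1; beyond it A' has no coefficient while those of Q A are
   nonnegative. [dQ] holds for the same reason: truncation turns both equations into
   inequalities. *)
have dA x : 0 <= x -> A^`().[x] <= (Q * A).[x].
  move=> x0; apply: horner_le => // i; rewrite coef_deriv.
  have [iN|iN] := ltnP i N; last by rewrite coef_poly ltnS ltnNge iN/= mul0rn coefM_ge0.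
  by rewrite /Q /A coef_trM ?ltnS ?(ltnW iN)// coef_poly ltnS iN -mulr_natl aE.
have dQ x : 0 <= x -> x * Q^`().[x] + b * Q.[x] <= c + x * (Q.[x] * Q.[x]).
  move=> x0.
  have -> : x * Q^`().[x] + b * Q.[x] = ('X * Q^`() + b *: Q).[x] by rewrite !hornerE.
  have -> : c + x * (Q.[x] * Q.[x]) = (c%:P + 'X * (Q * Q)).[x] by rewrite !hornerE.
  apply: horner_le => // i; rewrite !coefD coefZ coefC !coefXM coef_deriv.
  have [iN|iN] := ltnP i N.+1.
    case: i iN => [|i] iN/=.
      by rewrite add0r addr0 coef_poly iN -(qE 0%N) add0r.
    rewrite add0r /Q coef_trM ?(ltn_trans _ iN)// coef_poly iN -(qE i.+1).
    by rewrite -(mulr_natl (q _)) mulrDl.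
  case: i iN => // i iN; rewrite [Q`_i.+1]coef_poly ltnNge iN/= mul0rn mulr0 !add0r.
  exact: coefM_ge0.
have w_le0 s : 0 <= s <= S -> Q.[s] * Psi s + D s <= 0.
  move=> /andP[s0 sS].
  pose M := Q.[s].
  pose w (x : R) : R := Q.[x] * Psi x + D x.
  pose dw (x : R) : R := Q^`().[x] * Psi x + Q.[x] * D x + D2 x.
  have wdw x : is_derive x (1 : R) w (dw x).
    exact: (is_deriveD (is_derive_mulr (is_derive_poly Q x) (is_derive_Psi x)) (is_derive_D x)).
  (* Integrating factor: w satisfies x w' <= (x Q(x) - b) w, and since Q <= M = Q(s) on [0, s], the
     factor exp(- M x) absorbs x Q(x) where w > 0. The inequality left is the one of
     [le0_of_linear_ode]. *)
  pose v (x : R) : R := w x * expR (- M * x).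
  pose dv (x : R) : R := (dw x - M * w x) * expR (- M * x).
  have vdv x : is_derive x (1 : R) v (dv x).
    have exp_der : is_derive x (1 : R) (fun y => expR (- M * y)) (- M * expR (- M * x)).
      by apply: is_derive_eq; rewrite /GRing.scale/= mulr1 mulrC.
    have := is_derive_mulr (wdw x) exp_der; rewrite /v /dv => h.
    by apply: is_derive_eq; ring.
  have : v s <= 0.
    apply: (@le0_of_linear_ode _ v dv s b) => //.
    - exact: lt_le_trans b1.
    - rewrite /v /w mulr0 expR0 mulr1 /Psi /D !lim_pseries0 horner_coef0 coef_poly/=.
      rewrite /pseries_diffs mul1r.
      have b0 : b != 0 by rewrite gt_eqF// (lt_le_trans _ b1).
      rewrite -(@pmulr_rle0 _ b) ?(lt_le_trans _ b1)// mulrDr mulrA.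
      have := qE 0; rewrite add0r => ->; have := psiS 0; rewrite add0r mul1r => ->.
      by rewrite mulNr subrr.
    - move=> x /andP[x0 xs]; rewrite /v pmulr_lgt0 ?expR_gt0// => wx0.
      rewrite /dv mulrA mulrA ler_pM2r ?expR_gt0//.
      have Px : 0 < Psi x by apply: Psi_gt0; rewrite (ltW x0) (le_trans xs).
      have QM : Q.[x] <= M.
        rewrite /M !horner_coef; apply: ler_sum => i _; rewrite ler_wpM2l//.
        by rewrite lerXn2r ?nnegrE// ltW.
      have : x * dw x <= (x * Q.[x] - b) * w x.
        rewrite /dw /w.
        have -> : x * (Q^`().[x] * Psi x + Q.[x] * D x + D2 x) =
            (x * Q^`().[x]) * Psi x + x * Q.[x] * D x + x * D2 x by ring.
        have -> : x * D2 x = - b * D x - c * Psi x.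
          by apply/eqP; rewrite -subr_eq0 mulNr !opprD !opprK addrA Psi_ode.
        have := ler_wpM2r (ltW Px) (dQ x (ltW x0)).
        lra.
      rewrite mulrBr => /lerB/(_ (lexx (x * (M * w x))))/le_trans; apply.
      rewrite mulrBl addrAC -mulrA -mulrBr -mulrBl mulNr gerDr.
      by rewrite pmulr_rle0// pmulr_lle0// subr_le0.
  by rewrite /v pmulr_lle0// expR_gt0.
pose F (x : R) : R := A.[x] * Psi x; pose dF (x : R) : R := A^`().[x] * Psi x + A.[x] * D x.
have FdF x : is_derive x (1 : R) F (dF x).
  exact: (is_derive_mulr (is_derive_poly A x) (is_derive_Psi x)).
have := @is_derive_nonincreasing _ F dF 0 S FdF S0.
rewrite [F 0](_ : _ = 1); last first.
  by rewrite /F horner_coef0 coef_poly/= /Psi lim_pseries0.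
apply => x /andP[x0 xS]; rewrite /dF.
have xS' : 0 <= x <= S by rewrite !ltW.
apply: (@le_trans _ _ (A.[x] * (Q.[x] * Psi x + D x))).
  have := ler_wpM2r (ltW (Psi_gt0 xS')) (dA x (ltW x0)); rewrite hornerM; lra.
by rewrite mulr_ge0_le0// ?w_le0// horner_ge0// ltW.
Qed.

(** The partial sums at [S] increase and stay below 1 / Psi(S), which gives convergence on all of
    [0, S]. Mertens' theorem then turns the formal identity a psi = 1 into an identity of
    functions. *)
Lemma inverse_series : exists a : nat -> R,
  [/\ forall n, 0 <= a n, cvgn (pseries a S) &
      forall s, 0 <= s <= S -> limn (pseries a s) * limn (pseries psi s) = 1].
Proof.
have b0 : 0 < b by exact: lt_le_trans b1.
have [q [a [q0 a0 qE aE apsi]]] := inverse_series_ge0 b0 c0 psi0 erefl psiS.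
have a0E : a 0%N * psi 0%N = 1.
  by have := apsi 0; rewrite /cauchy_prod big_ord1.
have PS : 0 < Psi S by apply: Psi_gt0; rewrite S0 lexx.
have aS : cvgn (pseries a S).
  apply: nondecreasing_is_cvgn.
    by apply: nondecreasing_series => i _ _; rewrite mulr_ge0// exprn_ge0.
  exists (Psi S)^-1 => _ [n _ <-].
  rewrite -[leRHS]mul1r ler_pdivlMr//.
  have [|m] := posnP n; first by move=> ->; rewrite /pseries/series/= big_geq// mul0r.
  rewrite -(prednK m) (le_trans _ (truncated_inverse_le n.-1 q0 a0 qE aE a0E))//.
  by rewrite ler_wpM2r ?(ltW PS)// horner_poly /pseries /series/= big_mkord.
exists a; split => // s /andP[s0 sS].
have as_ : cvgn (pseries a s).
  apply: series_le_cvg aS.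
  - by move=> n; rewrite mulr_ge0// exprn_ge0.
  - by move=> n; rewrite mulr_ge0// exprn_ge0.
  - by move=> n; rewrite ler_wpM2l// lerXn2r// nnegrE.
have ps : cvgn (pseries psi s) by exact: exp_bounded_cvg.
have as0 n : 0 <= a n * s ^+ n by rewrite mulr_ge0// exprn_ge0.
have := cvg_series_cauchy_prod as0 as_ ps.
rewrite (_ : cauchy_prod _ _ = (fun n => (n == 0)%N%:R)).
  move=> h; rewrite -(cvg_lim _ h)//.
  apply: (@lim_near_cst R^o) => //; exists 1%N => //= -[//|n] _.
  by rewrite /series/= big_nat_recl//= big1 ?addr0.
apply/funext => n; rewrite -[RHS]mulr1 -(expr0 s).
transitivity (cauchy_prod a psi n * s ^+ n); last first.
  by rewrite apsi; case: n => // n; rewrite !mul0r.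
rewrite /cauchy_prod mulr_suml; apply: eq_bigr => i _.
have -> : s ^+ n = s ^+ i * s ^+ (n - i) by rewrite -exprD subnKC// leq_ord.
by rewrite mulrACA.
Qed.

End inverse_of_bessel_type_series.

(** * The square as an absolutely convergent cosine series *)

Section square_cosine_series.
Context {R : realType}.
Implicit Types (x t : R) (n : nat).

Lemma is_derive_cosZ (a x : R) :
  is_derive x 1 (fun y => cos (a * y)) (- a * sin (a * x)).
Proof.
have ha : is_derive x 1 (fun y => a * y) a.
  by apply: is_derive_eq; rewrite /GRing.scale/= mulr1.
have := is_derive1_comp (is_derive_cos (a * x)) ha.
by rewrite mulNr mulrC mulNr.
Qed.

Lemma is_derive_sinZ (a x : R) :
  is_derive x 1 (fun y => sin (a * y)) (a * cos (a * x)).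
Proof.
have ha : is_derive x 1 (fun y => a * y) a.
  by apply: is_derive_eq; rewrite /GRing.scale/= mulr1.
by have := is_derive1_comp (is_derive_sin (a * x)) ha; rewrite mulrC.
Qed.

Lemma is_derive_sum_nat (f df : nat -> R -> R) n x :
  (forall m, is_derive x 1 (f m) (df m x)) ->
  is_derive x 1 (fun y => \sum_(0 <= m < n) f m y) (\sum_(0 <= m < n) df m x).
Proof.
move=> h; elim: n => [|n ih].
  rewrite big_geq//; under eq_fun do rewrite big_geq//.
  exact: is_derive_cst.
rewrite big_nat_recr//=; under eq_fun do rewrite big_nat_recr//=.
exact: is_deriveD.
Qed.

Lemma le_norm_of_derive_bound (f df : R -> R) (t M : R) : 0 <= t ->
  (forall x, 0 <= x <= t -> is_derive x 1 f (df x)) ->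
  (forall x, 0 <= x <= t -> `|df x| <= M) -> f 0 = 0 -> `|f t| <= M * t.
Proof.
move=> + fdf dfM f0; rewrite le_eqVlt => /predU1P[<-|t0].
  by rewrite f0 normr0 mulr0.
have [||c] := @MVT _ f df 0 t t0.
- by move=> x; rewrite in_itv/= => /andP[x0 xt]; apply: fdf; rewrite !ltW.
- apply: derivable_within_continuous => x; rewrite in_itv/= => xt.
  exact: (@ex_derive _ _ _ _ _ _ _ (fdf x xt)).
rewrite in_itv/= f0 subr0 => /andP[c0 ct] ->.
rewrite ?subr0 normrM (gtr0_norm t0) ler_wpM2r ?(ltW t0)//.
by rewrite dfM// !ltW.
Qed.

(** [E n] is the error of the n-th partial sum of the Fourier series of x^2 / 4, after subtraction
    of the values at 0, so that the sum of the [u m] never has to be evaluated. [E1 n] and [E2 n]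
    are its first two derivatives. *)
Let u m : R := (-1) ^+ m.+1 / m.+1%:R ^+ 2.
Let E n x := \sum_(0 <= m < n) u m * (cos (m.+1%:R * x) - 1) - x ^+ 2 / 4.
Let E1 n x := \sum_(0 <= m < n) (-1) ^+ m / m.+1%:R * sin (m.+1%:R * x) - x / 2.
Let E2 n x := \sum_(0 <= m < n) (-1) ^+ m * cos (m.+1%:R * x) - 2^-1.

Let is_derive_E n x : is_derive x 1 (E n) (E1 n x).
Proof.
rewrite /E /E1; apply: is_deriveB.
  pose df m x := (-1) ^+ m / m.+1%:R * sin (m.+1%:R * x) : R.
  apply: (@is_derive_sum_nat _ df) => m.
  have h := is_derive_cosZ m.+1%:R x.
  apply: is_derive_eq; rewrite /df /GRing.scale/= /u subr0 exprS.
  by field; rewrite nat1r pnatr_eq0.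
by apply: is_derive_eq; rewrite /GRing.scale/=; field.
Qed.

Let is_derive_E1 n x : is_derive x 1 (E1 n) (E2 n x).
Proof.
rewrite /E1 /E2; apply: is_deriveB.
  pose df m x := (-1) ^+ m * cos (m.+1%:R * x) : R.
  apply: (@is_derive_sum_nat _ df) => m.
  have h := is_derive_sinZ m.+1%:R x.
  apply: is_derive_eq; rewrite /df /GRing.scale/=.
  by field; rewrite nat1r pnatr_eq0.
by apply: is_derive_eq; rewrite /GRing.scale/=; field.
Qed.

(** The closed form of an alternating Dirichlet kernel: multiplied by 2 cos(x / 2), the sum
    telescopes, and the term -1/2 of [E2] cancels the fixed end. *)
Let E2_closed n x : 2 * cos (x / 2) * E2 n x = - (-1) ^+ n * cos ((n%:R + 2^-1) * x).
Proof.
rewrite /E2; elim: n => [|n ih].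
  rewrite big_geq// sub0r expr0 mulN1r add0r [2^-1 * x]mulrC.
  by field.
rewrite big_nat_recr//= addrAC mulrDr ih exprS.
have -> : (n%:R + 2^-1) * x = n.+1%:R * x - x / 2 by rewrite -natr1; field.
have -> : (n.+1%:R + 2^-1) * x = n.+1%:R * x + x / 2 by field.
by rewrite cosB cosD; ring.
Qed.

(** [E2] oscillates at the frequency w = n + 1/2. One integration by parts, carried out with the
    mean value theorem, gains a factor 1 / w for [E1], and integrating once more keeps it for [E].
    The constant involves 1 / cos(t / 2) and blows up as t tends to pi. *)
Let E_bound t : 0 <= t < pi -> exists2 C : R, 0 <= C &
  forall n, `|E n t| <= C / (n%:R + 2^-1).
Proof.
move=> /andP[t0 tpi].
have cos_ge x : 0 <= x <= t -> cos (t / 2) <= cos (x / 2).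
  move=> /andP[x0 xt].
  have itv y : 0 <= y <= t -> y / 2 \in `[0, pi].
    move=> /andP[y0 yt]; rewrite in_itv/= divr_ge0//= ler_pdivrMr//.
    by rewrite (le_trans yt)// (le_trans (ltW tpi))// ler_peMr ?pi_ge0// ler1n.
  by rewrite leNgt ltr_cos ?itv ?lexx ?x0 ?t0// -leNgt ler_pM2r.
pose k := cos (t / 2).
have k0 : 0 < k.
  rewrite cos_gt0_pihalf// ltr_pM2r// tpi andbT.
  by rewrite (@lt_le_trans _ _ 0) ?divr_ge0// oppr_lt0 divr_gt0// pi_gt0.
pose h x : R := (2 * cos (x / 2))^-1.
pose dh x : R := sin (x / 2) / (2 * cos (x / 2)) ^+ 2.
have hdh x : 0 <= x <= t -> is_derive x 1 h (dh x).
  move=> xt; have c0 : 2 * cos (x / 2) != 0 :> R.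
    by rewrite mulf_neq0// gt_eqF// (lt_le_trans k0)// cos_ge.
  have d2 : is_derive x (1 : R) (fun y => 2 * cos (y / 2)) (- sin (x / 2)).
    have := is_derive_cosZ 2^-1 x; rewrite [2^-1 * x]mulrC.
    under [X in is_derive _ _ X]eq_fun do rewrite mulrC.
    by move=> hc; apply: is_derive_eq; rewrite /GRing.scale/=; field.
  apply: (is_derive_eq (@is_deriveV _ (fun y : R => 2 * cos (y / 2)) x _ _ c0 d2)).
  by rewrite /GRing.scale/= /dh mulrNN mulrC.
have k2 x : 0 <= x <= t -> k <= 2 * cos (x / 2).
  by move=> /cos_ge; rewrite -/k; lra.
have k2_gt0 x : 0 <= x <= t -> 0 < 2 * cos (x / 2).
  by move=> /k2; exact: lt_le_trans.
have h_le x : 0 <= x <= t -> `|h x| <= k^-1.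
  move=> xt; rewrite /h gtr0_norm ?invr_gt0 ?k2_gt0//.
  by rewrite lef_pV2 ?posrE ?k2_gt0// k2.
have dh_le x : 0 <= x <= t -> `|dh x| <= (k ^+ 2)^-1.
  move=> xt; rewrite /dh normrM -[leRHS]mul1r ler_pM//.
    by rewrite ler_norml sin_geN1 sin_le1.
  rewrite gtr0_norm ?invr_gt0 ?exprn_gt0 ?k2_gt0//.
  rewrite lef_pV2 ?posrE ?exprn_gt0 ?k2_gt0//.
  by rewrite lerXn2r ?nnegrE ?(ltW k0) ?(ltW (k2_gt0 _ xt))// k2.
exists (((k ^+ 2)^-1 * t + k^-1) * t).
  by rewrite mulr_ge0// addr_ge0 ?mulr_ge0 ?invr_ge0 ?exprn_ge0// ltW.
move=> n; pose w : R := n%:R + 2^-1.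
have w0 : 0 < w by rewrite ltr_wpDl// invr_gt0.
(* [E2 n] equals - (-1)^n cos(w x) h(x). The term added to [E1] is the boundary term of the
   integration by parts, so only the part with h' is left in F', already divided by w. *)
pose F x : R := E1 n x + (-1) ^+ n * (sin (w * x) * h x) / w.
pose dF x : R := (-1) ^+ n * sin (w * x) * dh x / w.
have FdF x : 0 <= x <= t -> is_derive x 1 F (dF x).
  move=> xt; have hx := hdh _ xt.
  have sx := is_derive_mulr (is_derive_sinZ w x) hx.
  have e1 := is_derive_E1 n x.
  have c0 : cos (x / 2) != 0 by rewrite gt_eqF// (lt_le_trans k0)// cos_ge.
  have e2 : E2 n x = - (-1) ^+ n * cos (w * x) * h x.
    by rewrite -(E2_closed n x) /h mulrAC divff ?mul1r// mulf_neq0.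
  rewrite /F /dF; apply: is_derive_eq.
  by rewrite e2 /GRing.scale/=; field; rewrite gt_eqF.
have F_le x : 0 <= x <= t -> `|F x| <= (k ^+ 2)^-1 / w * t.
  move=> /andP[x0 xt].
  have : `|F x| <= (k ^+ 2)^-1 / w * x.
    apply: (@le_norm_of_derive_bound F dF) => //.
    - by move=> y /andP[y0 yx]; apply: FdF; rewrite y0 (le_trans yx).
    - move=> y /andP[y0 yx].
      rewrite /dF normrM [`|w^-1|]gtr0_norm ?invr_gt0// ler_pM2r ?invr_gt0//.
      rewrite normrM normrM normrX normrN1 expr1n mul1r -[leRHS]mul1r.
      rewrite ler_pM// ?dh_le ?y0 ?(le_trans yx)//.
      by rewrite ler_norml sin_geN1 sin_le1.
    - rewrite /F /E1 mul0r subr0 mulr0 sin0 mul0r mulr0 mul0r addr0 big1// => i _.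
      by rewrite mulr0 sin0 mulr0.
  move/le_trans; apply; rewrite ler_wpM2l// divr_ge0 ?(ltW w0)//.
  by rewrite invr_ge0 exprn_ge0 // ltW.
rewrite -mulrA [t / _]mulrC mulrA.
apply: (@le_norm_of_derive_bound (E n) (E1 n)) => //.
  move=> x xt.
  have -> : E1 n x = F x - (-1) ^+ n * (sin (w * x) * h x) / w by rewrite /F addrK.
  apply: (le_trans (ler_normB _ _)); rewrite -/w [leRHS]mulrDl lerD//.
    by rewrite mulrAC F_le.
  rewrite normrM [`|w^-1|]gtr0_norm ?invr_gt0// ler_pM2r ?invr_gt0//.
  rewrite normrM normrX normrN1 expr1n mul1r normrM -[leRHS]mul1r ler_pM ?h_le//.
  by rewrite ler_norml sin_geN1 sin_le1.
rewrite /E expr0n/= mul0r subr0 big1// => i _.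
by rewrite mulr0 cos0 subrr mulr0.
Qed.

(** The factor 2 makes 1 / (m + 1)^2 <= 2 (1 / (m + 1) - 1 / (m + 2)) true for all m, with equality
    at m = 0; the right-hand sides telescope. *)
Let tail M n : (M <= n)%N ->
  \sum_(M <= m < n) `|u m| <= 2 / M.+1%:R.
Proof.
move=> Mn.
apply: (@le_trans _ _ (\sum_(M <= m < n) (2 * (m.+1%:R^-1 - m.+2%:R^-1)))).
  apply: ler_sum_nat => m _; rewrite /u normrM normrX normrN1 expr1n mul1r.
  rewrite gtr0_norm ?invr_gt0 ?exprn_gt0//.
  have m1 : 0 < m.+1%:R :> R by [].
  have m2 : 0 < m.+2%:R :> R by [].
  rewrite -subr_ge0; have -> : 2 * (m.+1%:R^-1 - m.+2%:R^-1) - m.+1%:R ^- 2 =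
      m%:R / (m.+1%:R ^+ 2 * m.+2%:R) :> R.
    rewrite -!natr1; field.
    by rewrite (natr1 m) (natr1 m.+1) !gt_eqF.
  by rewrite divr_ge0// mulr_ge0// exprn_ge0.
rewrite -mulr_sumr ler_pM2l//.
have -> : \sum_(M <= m < n) (m.+1%:R^-1 - m.+2%:R^-1) = M.+1%:R^-1 - n.+1%:R^-1 :> R.
  rewrite -(opprB n.+1%:R^-1) -(@telescope_sumr _ _ _ (fun m => m.+1%:R^-1 : R))// -sumrN.
  by apply: eq_bigr => i _; rewrite opprB.
by rewrite gerBl invr_ge0.
Qed.

Let cvg_abs_u : cvgn (series (fun m => `|u m|)).
Proof.
apply: nondecreasing_is_cvgn; first exact: nondecreasing_series.
by exists 2 => _ [n _ <-]; have := tail (leq0n n); rewrite divr1.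
Qed.

Let E_cauchy M n x : (M <= n)%N -> `|E n x - E M x| <= 4 / M.+1%:R.
Proof.
move=> Mn; rewrite /E opprB addrA subrK (big_cat_nat (leq0n M) Mn)/= addrAC subrr add0r.
rewrite (le_trans (ler_norm_sum _ _ _))//.
apply: (@le_trans _ _ (\sum_(M <= m < n) `|u m| * 2)).
  apply: ler_sum_nat => m _; rewrite normrM ler_wpM2l// (le_trans (ler_normB _ _))//.
  by rewrite normr1 -[leRHS]/(1 + 1) lerD// cos_max.
rewrite -mulr_suml (_ : 4 / M.+1%:R = 2 / M.+1%:R * 2); last by rewrite mulrAC -natrM.
by rewrite ler_wpM2r// tail.
Qed.

Let cvg_E_lt t : 0 <= t < pi -> E n t @[n --> \oo] --> 0.
Proof.
move=> tpi; have [C C0 H] := E_bound tpi.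
apply/cvgrPdist_le => e e0.
have /cvgrPdist_le/(_ (e / (C + 1))) := @cvg_harmonic R.
rewrite divr_gt0 ?ltr_wpDl// => /(_ isT)[N _ HN].
exists N.+1 => //= -[//|n] /= Nn; rewrite sub0r normrN (le_trans (H _))//.
have := HN n Nn; rewrite sub0r normrN /harmonic/= gtr0_norm ?invr_gt0//.
rewrite ler_pdivlMr ?ltr_wpDl// => /(le_trans _); apply.
rewrite mulrC ler_pM ?invr_ge0 ?lerDl// ?addr_ge0// ?lef_pV2 ?posrE ?ltr_wpDl//.
by rewrite lerDl.
Qed.

(** The endpoint is indispensable, being where the sum of the |c_m| is read off, but [E_bound]
    degenerates there. The estimate [E_cauchy] is uniform in x, so convergence is transferred from a
    nearby t < pi by continuity of a single [E N]. *)
Let cvg_E_pi : E n pi @[n --> \oo] --> 0.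
Proof.
apply/cvgrPdist_le => e e0.
have e4 : 0 < e / 4 by rewrite divr_gt0.
have /cvgrPdist_le/(_ (e / 4 / 4)) := @cvg_harmonic R.
rewrite divr_gt0// => /(_ isT)[N _ /(_ N (leqnn _))].
rewrite sub0r normrN /harmonic/= gtr0_norm ?invr_gt0// => HN.
have {}HN x n : (N <= n)%N -> `|E n x - E N x| <= e / 4.
  move=> /(@E_cauchy _ _ x)/le_trans; apply.
  by rewrite mulrC -ler_pdivlMr.
have cE : {for pi, continuous (E N)}.
  by apply/differentiable_continuous/derivable1_diffP; exact: (@ex_derive _ _ _ _ _ _ _ (is_derive_E N pi)).
move/cvgrPdist_lt : cE => /(_ _ e4)/nbhs_ballP[dl /= dl0 Hdl].
have pi0 := pi_gt0 R.
pose t := pi - Num.min (dl / 2) (pi / 2).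
have m0 : 0 < Num.min (dl / 2) (pi / 2) by rewrite lt_min !divr_gt0.
have tpi : 0 <= t < pi.
  rewrite /t subr_ge0 gtrBl m0 andbT ge_min [X in _ || X]ler_pdivrMr//.
  by rewrite ler_peMr ?ler1n ?orbT// ltW.
have Ht : `|E N pi - E N t| < e / 4.
  apply: Hdl; rewrite /ball/= /t opprB addrCA subrr addr0 gtr0_norm//.
  by rewrite gt_min ltr_pdivrMr// ltr_pMr// ltr1n.
have /cvgrPdist_le/(_ _ e4)[M _ HM] := cvg_E_lt tpi.
exists (maxn N M) => // n /=; rewrite geq_max => /andP[Nn Mn].
have := HM n Mn; have := HN t n Nn; have := HN pi n Nn; move: Ht.
rewrite !sub0r !normrN.
move: (E n pi) (E N pi) (E N t) (E n t) => a b c d.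
rewrite ltr_norml !ler_norml => /andP[? ?] /andP[? ?] /andP[? ?] /andP[? ?].
by apply/andP; split; lra.
Qed.

Let U : R := limn (series u).

Let cvg_u : series u @ \oo --> U.
Proof. exact: normed_cvg. Qed.

Let cvg_u_cos t : 0 <= t <= pi ->
  series (fun m => u m * cos (m.+1%:R * t)) @ \oo --> U + t ^+ 2 / 4.
Proof.
move=> /andP[t0 tpi].
have cE : E n t @[n --> \oo] --> 0.
  by move: tpi; rewrite le_eqVlt => /predU1P[->//|tpi]; apply: cvg_E_lt; rewrite t0.
rewrite (_ : series _ = (fun n => E n t + (series u n + t ^+ 2 / 4))).
  by rewrite -[X in _ --> X]add0r; apply: cvgD => //; apply: cvgD => //; exact: cvg_cst.
apply/funext => n; rewrite /E /series/= addrCA subrK addrC -big_split/=.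
by apply: eq_bigr => m _; rewrite mulrBr mulr1 subrK.
Qed.

(** Only the sign of this alternating sum matters: it makes the constant coefficient of the cosine
    series nonnegative, hence equal to its absolute value. *)
Let U_le0 : U <= 0.
Proof.
have sN : series (- u) = - series u.
  apply/funext => n; rewrite /series/=.
  by rewrite [RHS](_ : _ = - \sum_(0 <= k < n) u k)// -sumrN.
have h : series (- u) @ \oo --> - U by rewrite sN; exact: cvgN.
rewrite -oppr_ge0 -(cvg_lim _ h)//.
have := @lt_sum_lim_series _ (- u) 0%N (cvgP _ h); rewrite big_geq// => H; apply/ltW/H => d.
have uE k : (- u) k = (-1) ^+ k / k.+1%:R ^+ 2.
  by rewrite [LHS](_ : _ = - u k)// /u exprS mulN1r mulNr opprK.
rewrite !uE !add0n -(signr_odd _ d.*2) -(signr_odd _ d.*2.+1)/= odd_double.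
rewrite expr1 expr0 mulN1r mul1r subr_gt0 ltf_pV2 ?posrE ?exprn_gt0//.
by rewrite ltrXn2r// ltr_nat.
Qed.

Let cos_natpi m : cos (m%:R * pi) = (-1) ^+ m :> R.
Proof.
elim: m => [|m ih]; first by rewrite mul0r cos0.
by rewrite -natr1 mulrDl mul1r cosDpi ih exprS mulN1r.
Qed.

(* The sum of the absolute values is the value of the series at [t = L]. *)
Lemma square_cosine_series (L : R) : 0 < L -> exists c : nat -> R,
  series (fun m => `|c m|) @ \oo --> L ^+ 2 /\
  forall t, `|t| <= L -> series (fun m => c m * cos (m%:R * (pi / L) * t)) @ \oo --> t ^+ 2.
Proof.
move=> L0; pose k := (L / pi) ^+ 2.
have pi0 := pi_gt0 R.
have k0 : 0 < k by rewrite exprn_gt0// divr_gt0.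
have pin : pi != 0 :> R by rewrite gt_eqF.
have Ln : L != 0 by rewrite gt_eqF.
have pL : 0 <= pi / L by rewrite divr_ge0// ltW.
have k4 : 0 < 4 * k by rewrite mulr_gt0.
(* The expansion of x^2 / 4 at x = pi t / L, multiplied by 4 k = 4 (L / pi)^2; the values at 0 that
   were subtracted in [E] are collected in the constant coefficient. At t = L the factor cos(m pi) =
   (-1)^m cancels the sign of the coefficients with m >= 1. *)
exists (fun m => if m is m'.+1 then 4 * k * u m' else - (4 * k * U)).
split.
  rewrite -cvg_shiftS.
  rewrite (_ : (fun _ => _) = (fun n => - (4 * k * U) +
     4 * k * series (fun m => u m * cos (m.+1%:R * pi)) n)); last first.
    apply/funext => n; rewrite /series/= big_nat_recl//= ger0_norm; last first.
      by rewrite oppr_ge0 mulr_ge0_le0// ltW.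
    congr (_ + _); rewrite mulr_sumr; apply: eq_bigr => m _.
    rewrite normrM (gtr0_norm k4) cos_natpi; congr (_ * _).
    rewrite /u mulrAC -exprMn mulrNN mulr1 expr1n normrM normrX normrN1 expr1n.
    by rewrite mul1r gtr0_norm ?invr_gt0 ?exprn_gt0// mul1r.
  have -> : L ^+ 2 = - (4 * k * U) + 4 * k * (U + pi ^+ 2 / 4).
    have key (V p : R) : p != 0 -> L ^+ 2 =
        - (4 * (L / p) ^+ 2 * V) + 4 * (L / p) ^+ 2 * (V + p ^+ 2 / 4).
      by move=> p0; field.
    exact: key.
  apply: cvgD; first exact: cvg_cst.
  by apply: cvgM; [exact: cvg_cst|apply: cvg_u_cos; rewrite lexx ltW].
move=> t tL; rewrite -cvg_shiftS.
rewrite (_ : (fun _ => _) = (fun n => - (4 * k * U) +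
    4 * k * series (fun m => u m * cos (m.+1%:R * (pi / L * `|t|))) n)); last first.
  apply/funext => n; rewrite /series/= big_nat_recl//= !mul0r cos0 mulr1.
  congr (_ + _); rewrite mulr_sumr; apply: eq_bigr => m _.
  rewrite mulrA -[in LHS](cos_norm (_ * t)) normrM ger0_norm; last first.
    by rewrite -mulrA mulr_ge0.
  by rewrite -!mulrA.
have -> : t ^+ 2 = - (4 * k * U) + 4 * k * (U + (pi / L * `|t|) ^+ 2 / 4).
  have key (V p : R) : p != 0 -> `|t| ^+ 2 =
      - (4 * (L / p) ^+ 2 * V) + 4 * (L / p) ^+ 2 * (V + (p / L * `|t|) ^+ 2 / 4).
    by move=> p0; field; apply/andP.
  by rewrite -[LHS]real_normK ?num_real// (key U _ pin).
apply: cvgD; first exact: cvg_cst.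
apply: cvgM; [exact: cvg_cst|apply: cvg_u_cos].
by rewrite mulr_ge0//= mulrAC ler_pdivrMr// ler_pM2l.
Qed.

End square_cosine_series.

(** * Lebesgue measure on R^d *)

Section affine_change.
Context {R : realType}.

Lemma lebesgue_measure_affine (a v : R) (A : set (measurableTypeR R)) :
  a != 0 -> measurable A ->
  lebesgue_measure A =
  (`|a|%:E * lebesgue_measure ((fun x : measurableTypeR R => (a * x + v : measurableTypeR R)%R) @^-1` A))%E.
Proof.
move=> a0 mA.
pose f (x : measurableTypeR R) : measurableTypeR R := a * x + v.
have mf : measurable_fun [set: measurableTypeR R] f.
  by apply: measurable_funD => //; apply: measurable_funM.
pose m : {measure set (measurableTypeR R) -> \bar R} :=
  measure_function_pushforward__canonical__measure_function_Measure lebesgue_measure mf.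
pose m' : {measure set (measurableTypeR R) -> \bar R} := mscale (NngNum (normr_ge0 a)) m.
apply: (@lebesgue_measure_unique _ m') => // _ [[x y]] /= xy <-.
rewrite /m' /mscale/= /pushforward.
have [lt0|gt0|] := ltgtP a 0; last by move=> a00; rewrite a00 eqxx in a0.
- have -> : f @^-1` [set` `]x, y]] = [set` `[(y - v) / a, (x - v) / a[].
    apply/seteqP; split => z/=; rewrite !in_itv/= /f => /andP[h1 h2]; apply/andP; split.
    + by rewrite ler_ndivrMr// mulrC lerBrDr.
    + by rewrite ltr_ndivlMr// mulrC ltrBlDr.
    + by move: h2; rewrite ltr_ndivlMr// mulrC ltrBlDr.
    + by move: h1; rewrite ler_ndivrMr// mulrC lerBrDr.
  rewrite !lebesgue_measure_itv/= !lte_fin ltr_nM2r ?invr_lt0// ltrBlDr subrK.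
  case: ifPn => _; last by rewrite mule0.
  rewrite ltr0_norm// -EFinB -EFinM -mulrBl opprB addrA subrK.
  by rewrite mulNr mulrCA divff// mulr1 opprB.
- have -> : f @^-1` [set` `]x, y]] = [set` `](x - v) / a, (y - v) / a]].
    apply/seteqP; split => z/=; rewrite !in_itv/= /f => /andP[h1 h2]; apply/andP; split.
    + by rewrite ltr_pdivrMr// mulrC ltrBlDr.
    + by rewrite ler_pdivlMr// mulrC lerBrDr.
    + by move: h1; rewrite ltr_pdivrMr// mulrC ltrBlDr.
    + by move: h2; rewrite ler_pdivlMr// mulrC lerBrDr.
  rewrite !lebesgue_measure_itv/= !lte_fin ltr_pM2r ?invr_gt0// ltrBlDr subrK.
  case: ifPn => _; last by rewrite mule0.
  rewrite gtr0_norm// -EFinB -EFinM -mulrBl opprB addrA subrK.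
  by rewrite mulrCA divff// mulr1.
Qed.

Local Notation mu d := (@borel_lebesgue R d).

Lemma rVunconsK d : cancel (@rVuncons R d) (@rVcons R d).
Proof.
move=> x; apply/rowP => i; case: (unliftP ord0 i) => [j ->|->].
  by rewrite rVconsS mxE.
by rewrite rVcons0.
Qed.

Lemma rVcons_affine d (a : R) p q :
  a *: @rVcons R d p + rVcons q = rVcons (a * p.1 + q.1, a *: p.2 + q.2).
Proof.
apply/rowP => i; rewrite [LHS]mxE [X in X + _]mxE.
case: (unliftP ord0 i) => [j ->|->].
  by rewrite !rVconsS !mxE.
by rewrite !rVcons0.
Qed.

Lemma measurable_affine_rV d (a : R) (v : 'rV[R]_d) :
  measurable_fun setT (fun x : 'rV[R]_d => a *: x + v).
Proof.
apply: measurable_fun_rV => i.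
rewrite (_ : _ \o _ = (fun x => a * rVcoor i x + v ord0 i)); last first.
  by apply/funext => x; rewrite /rVcoor/= !mxE.
apply: measurable_funD => //; apply: measurable_funM => //.
exact: measurable_rVcoor.
Qed.

(** Slicing along the first coordinate: the real line contributes one factor |a| and the sections
    |a|^d by induction. This single formula covers the translations, the reflection and the
    dilations used later. *)
Lemma borel_lebesgue_affine d (a : R) (v : 'rV[R]_d) (A : set 'rV[R]_d) :
  a != 0 -> measurable A ->
  mu d A = ((`|a| ^+ d)%:E * mu d ((fun x => a *: x + v)%R @^-1` A))%E.
Proof.
move=> a0; elim: d v A => [|d ih] v A mA.
  rewrite expr0 mul1e /= !diracE; congr (_%:R%:E).
  rewrite (_ : _ @^-1` A = A)//; apply/seteqP; split => x/=;
    by rewrite (thinmx0 (_ + _)) (thinmx0 x).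
have mc : measurable_fun setT (@rVcons R d) by exact: measurable_rVcons.
have mcA : measurable (@rVcons R d @^-1` A) by rewrite -[X in measurable X]setTI; exact: mc.
pose B := rVcons (d:=d) @^-1` A.
rewrite /= /lebesgue_rVS /pushforward /product_measure1/= -/B.
pose phi (x : measurableTypeR R) := mu d (xsection B x).
have mphi : measurable_fun setT phi by exact: measurable_fun_xsection.
pose f (x : measurableTypeR R) : measurableTypeR R := a * x + v ord0 ord0.
have mf : measurable_fun [set: measurableTypeR R] f.
  by apply: measurable_funD => //; apply: measurable_funM.
transitivity (`|a|%:E * \int[lebesgue_measure]_x phi (f x))%E.
  transitivity (\int[mscale (NngNum (normr_ge0 a))
     (measure_function_pushforward__canonical__measure_function_Measure lebesgue_measure mf)]_x phi x)%E.
    apply: eq_measure_integral => X mX _.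
    exact: (lebesgue_measure_affine (v ord0 ord0) a0 mX).
  rewrite ge0_integral_mscale//=; congr (_ * _)%E.
  by rewrite ge0_integral_pushforward.
rewrite exprS EFinM -muleA; congr (_ * _)%E.
rewrite -ge0_integralZl//; last first.
  by apply: (@measurable_fun_xsection _ _ _ _ _ (mu d)); rewrite -[X in measurable X]setTI;
    apply: mc => //; rewrite -[X in measurable X]setTI; exact: measurable_affine_rV.
apply: eq_integral => x _; rewrite /phi (ih (rVuncons v).2); last exact: measurable_xsection.
have E y : a *: rVcons (x, y) + v = rVcons (f x, a *: y + (rVuncons v).2).
  by rewrite -{1}(rVunconsK v) rVcons_affine.
by congr (_ * mu d _)%E; apply/seteqP; split => y; rewrite /xsection/= !inE/= /B/= E.
Qed.

Lemma ge0_integral_borel_lebesgueS d (f : 'rV[R]_d.+1 -> \bar R) :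
  measurable_fun setT f -> (forall x, 0 <= f x)%E ->
  (\int[mu d.+1]_x f x = \int[lebesgue_measure]_x \int[mu d]_y f (rVcons (x, y)))%E.
Proof.
move=> mf f0.
transitivity (\int[pushforward (@lebesgue_measure R \x mu d)%E (@rVcons R d)]_x f x)%E => //.
rewrite ge0_integral_pushforward//; last exact: measurable_rVcons.
rewrite preimage_setT fubini_tonelli1//.
  by apply: measurableT_comp => //; exact: measurable_rVcons.
by move=> x; exact: f0.
Qed.

End affine_change.

(** * Borel versions of Lebesgue measurable sets and functions *)

Section measure_completion.
Context {R : realType} {d : measure_display} {T : measurableType d}.
Variable mu : {sigma_finite_measure set T -> \bar R}.

Lemma measurable_hull (X : set T) :
  exists H, [/\ measurable H, X `<=` H & mu H = (mu^* X)%mu].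
Proof.
have hull_eps n : exists H, [/\ measurable H, X `<=` H &
    (mu H <= mu^*%mu X + (n.+1%:R^-1)%:E)%E].
  have [->|Xfin] := eqVneq (mu^*%mu X) +oo%E.
    by exists setT; split => //; rewrite addye ?leey.
  have Xfin' : mu^*%mu X \is a fin_num.
    by rewrite ge0_fin_numE ?ltey// mu_ext_ge0.
  have n0 : 0 < n.+1%:R^-1 :> R by [].
  have [_ [A [mA XA] <-] HA] := lb_ereal_inf_adherent n0 Xfin'.
  exists (\bigcup_k A k); split => //; first exact: bigcupT_measurable.
  apply: le_trans (ltW HA); apply: measure_sigma_subadditive => //.
  exact: bigcupT_measurable.
pose H n := sval (cid (hull_eps n)).
have HP n := svalP (cid (hull_eps n)).
have mH : measurable (\bigcap_n H n).
  by apply: bigcapT_measurable => n; case: (HP n).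
have XH : X `<=` \bigcap_n H n.
  by move=> x Xx n _; case: (HP n) => _ XH _; exact: XH.
exists (\bigcap_n H n); split => //.
apply/eqP; rewrite eq_le; apply/andP; split; last first.
  by rewrite -(measurable_mu_extE mu mH); exact: le_mu_ext.
apply/lee_addgt0Pr => e e0.
have [n ne] : exists n, n.+1%:R^-1 < e.
  have /cvgrPdist_lt/(_ _ e0)[n _ /(_ n (leqnn n))] := @cvg_harmonic R.
  by rewrite sub0r normrN gtr0_norm ?invr_gt0// => h; exists n.
have [mHn _ /le_trans HPn] := HP n.
apply: (@le_trans _ _ (mu (H n))).
  by apply: le_measure; rewrite ?inE//; exact: bigcap_inf.
by apply: HPn; rewrite leeD2l// lee_fin ltW.
Qed.

(** Sigma-finiteness reduces the question to pieces of finite measure. On each of them a measurable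
    hull of [A] exceeds [A] by a set of outer measure 0, which has a null measurable hull in
    turn. *)
Lemma caratheodory_borel_version (A : set T) : (mu^*)%mu.-cara.-measurable A ->
  exists B Z, [/\ measurable B, measurable Z, mu Z = 0%E &
    forall x, ~ Z x -> A x <-> B x].
Proof.
move=> mA.
have /sigma_finiteP[F [FT _ Foo]] := sigma_finiteT mu.
have step n : exists B Z, [/\ measurable B, measurable Z, mu Z = 0%E,
    A `&` F n `<=` B & B `\` Z `<=` A].
  have [mF Fn] := Foo n.
  have [H [mH AH muH]] := measurable_hull (A `&` F n).
  have Hfin : (mu^*%mu (H `&` A) \is a fin_num)%E.
    rewrite ge0_fin_numE ?mu_ext_ge0//.
    apply: (@le_lt_trans _ _ (mu (F n))) => //.
    apply: (@le_trans _ _ (mu H)); last first.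
      by rewrite muH -(measurable_mu_extE mu mF); apply: le_mu_ext => x [].
    by rewrite -(measurable_mu_extE mu mH); apply: le_mu_ext => x [].
  (* Splitting [H] by [A] with the Caratheodory condition gives mu H = mu^*(H inside A) + mu^*(H
     outside A). The first term is already at least mu H, and being finite it can be subtracted. *)
  have E : mu^*%mu (H `&` ~` A) = 0%E.
    have h1 : (mu H <= mu^*%mu (H `&` A))%E.
      by rewrite muH; apply: le_mu_ext => x [Ax Fx]; split => //; apply: AH.
    have h2 : (mu H = mu^*%mu (H `&` A) + mu^*%mu (H `&` ~` A))%E.
      by rewrite -(measurable_mu_extE mu mH); exact: mA.
    apply/eqP; rewrite eq_le mu_ext_ge0// andbT.
    by move: h1; rewrite h2 -leeBrDl// subee.
  have [Z [mZ HZ muZ]] := measurable_hull (H `&` ~` A).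
  exists H, Z; split => //; first by rewrite muZ.
  by move=> x [Hx Zx]; apply: contrapT => Ax; apply: Zx; exact: HZ.
pose B n := sval (cid (step n)).
have BP n := svalP (cid (step n)).
pose Z n := sval (cid (BP n)).
have ZP n := svalP (cid (BP n)).
exists (\bigcup_n B n), (\bigcup_n Z n); split.
- by apply: bigcupT_measurable => n; case: (ZP n).
- by apply: bigcupT_measurable => n; case: (ZP n).
- have mZ n : measurable (Z n) by case: (ZP n).
  apply/negligibleP; first exact: bigcupT_measurable.
  by apply: negligible_bigcup => n; apply/negligibleP => //; case: (ZP n).
- move=> x Zx; split => [Ax|[n _ Bx]].
    have [n _ Fx] : (\bigcup_n F n) x by rewrite -FT.
    by exists n => //; case: (ZP n) => _ _ _ h _; apply: h.
  have [_ _ _ _ h] := ZP n; apply: h; split => // Znx; apply: Zx.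
  by exists n.
Qed.

Let cara := caratheodory_type (mu^*)%mu.

(** The superlevel sets of [f] at rational levels have Borel versions off null sets. Off their
    countable union [NZ] the function [f] is kept, and it is set to 0 on [NZ]. *)
Lemma caratheodory_fun_borel_version (f : cara -> R) :
  measurable_fun setT f -> exists g : T -> R, exists Z : set T,
  [/\ measurable_fun setT g, measurable Z, mu Z = 0%E & forall x, ~ Z x -> f x = g x].
Proof.
move=> mf.
have step (q : rat) : exists B Z, [/\ measurable B, measurable Z, mu Z = 0%E &
    forall x, ~ Z x -> ratr q < f x <-> B x].
  apply: (@caratheodory_borel_version [set x | ratr q < f x]).
  rewrite [X in _ X](_ : _ = setT `&` f @^-1` `]ratr q, +oo[%classic); last first.
    by rewrite setTI; apply/seteqP; split => x/=; rewrite in_itv/= andbT.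
  by apply: mf => //; exact: measurable_itv.
pose B q := sval (cid (step q)).
have BP q := svalP (cid (step q)).
pose Z q := sval (cid (BP q)).
have ZP q := svalP (cid (BP q)).
pose Z' n := if unpickle n is Some q then Z q else set0.
pose NZ := \bigcup_n Z' n.
have ZNZ q : Z q `<=` NZ.
  move=> x Zx; exists (pickle q); first exact: I.
  by rewrite /Z' pickleK.
have mZ q : measurable (Z q) by case: (ZP q).
have mB q : measurable (B q) by case: (ZP q).
have mNZ : measurable NZ.
  by apply: bigcupT_measurable => n; rewrite /Z'; case: unpickle.
exists (fun x => f x * \1_(~` NZ) x), NZ; split => //.
- apply: (measurability _ (RGenOInfty.measurableE R)) => //= _ [_ [r ->] <-].
  rewrite setTI.
  (* The set where the new function exceeds [r]: rational levels [q > r] detect it off [NZ], and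
     since the value on [NZ] is 0, all of [NZ] is included as soon as some such [q] is negative. *)
  rewrite (_ : _ @^-1` _ = \bigcup_q (if r < ratr q then
      (B q `\` NZ) `|` (if 0 > ratr q :> R then NZ else set0) else set0)).
    apply: countable_bigcupT_measurable => [|q]; first exact: countableP.
    case: ifP => // _; apply: measurableU.
      exact: measurableD.
    by case: ifP.
  apply/seteqP; split => x/=.
    rewrite in_itv/= andbT => rx.
    have [q] := rat_in_itvoo rx; rewrite in_itv/= => /andP[rq qf].
    exists q => //=; rewrite rq; have [NZx|NZx] := pselect (NZ x).
      right; move: qf; rewrite indicE memNset ?mulr0; last by move=> /(_ NZx).
      by move=> ->.
    left; split => //; have [_ _ _ h] := ZP q; apply/h.
      by move=> Zx; apply: NZx; exact: (ZNZ q).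
    by move: qf; rewrite indicE mem_set// mulr1.
  move=> [q _]; case: ifPn => // rq [].
    move=> [Bx NZx]; rewrite in_itv/= andbT (lt_trans rq)//.
    rewrite indicE mem_set// mulr1; have [_ _ _ h] := ZP q; apply/h => //.
    by move=> Zx; apply: NZx; exact: (ZNZ q).
  case: ifPn => // q0 NZx; rewrite in_itv/= andbT (lt_trans rq)//.
  by rewrite indicE memNset ?mulr0// => /(_ NZx).
- apply/negligibleP => //.
  apply: negligible_bigcup => n; rewrite /Z'; case: unpickle => [q|].
    by apply/negligibleP => //; case: (ZP q).
  exact: negligible_set0.
- by move=> x NZx; rewrite indicE mem_set// mulr1.
Qed.

End measure_completion.

Section completed_integrals.
Context {R : realType} {d : nat}.
Local Notation mu := (@borel_lebesgue R d).
Local Notation la := (@lebesgue_Rd R d).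
Local Notation rV := 'rV[R]_d.

(** The bridge between the two sigma-algebras: the image of the completed measure under the identity
    is the Borel measure, so integrals of Borel functions are transferred as pushforwards. *)
Lemma measurable_id_Rd : measurable_fun setT (id : Rd R d -> rV).
Proof.
move=> _ A mA; rewrite setTI; apply: sub_caratheodory.
exact: sub_sigma_algebra.
Qed.

Lemma lebesgue_Rd_borel (A : set rV) : measurable A -> la A = mu A.
Proof. exact: measurable_mu_extE. Qed.

Lemma measurable_Rd_borel (A : set rV) : measurable A -> measurable (A : set (Rd R d)).
Proof. by move=> mA; rewrite -[X in measurable X]setTI; exact: measurable_id_Rd. Qed.

Lemma ge0_integral_Rd (g : rV -> \bar R) : measurable_fun setT g ->
  (forall x, 0 <= g x)%E -> (\int[la]_x g x = \int[mu]_x g x)%E.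
Proof.
move=> mg g0.
have := @ge0_integral_pushforward _ _ _ _ _ _ measurable_id_Rd la setT g measurableT mg.
rewrite preimage_setT => <- //.
pose m := measure_function_pushforward__canonical__measure_function_Measure la measurable_id_Rd.
apply: (@eq_measure_integral _ _ _ setT mu m g) => A mA _.
exact: lebesgue_Rd_borel.
Qed.

Lemma integral_Rd (g : rV -> \bar R) : measurable_fun setT g ->
  (\int[la]_x g x = \int[mu]_x g x)%E.
Proof.
move=> mg; rewrite integralE [RHS]integralE; congr (_ - _)%E;
  apply: ge0_integral_Rd => //.
- exact: measurable_funepos.
- exact: measurable_funeneg.
Qed.

Variables (Z : set rV).
Hypotheses (mZ : measurable Z) (Z0 : mu Z = 0%E).

Lemma ae_eq_Rd (F G : rV -> \bar R) : (forall x, ~ Z x -> F x = G x) ->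
  ae_eq la setT F G.
Proof.
move=> FG; exists Z; split; first exact: measurable_Rd_borel.
  by apply: etrans Z0; exact: lebesgue_Rd_borel.
by move=> x /= nFG; apply: contrapT => /FG FGx; apply: nFG.
Qed.

Lemma ae_measurable_Rd (F G : rV -> \bar R) : (forall x, ~ Z x -> F x = G x) ->
  measurable_fun setT G -> measurable_fun setT (F : Rd R d -> \bar R).
Proof.
move=> FG mG.
apply: (@ae_measurable_fun _ _ _ la _ setT G).
- exact: measure_is_complete_caratheodory.
- by apply: ae_eq_Rd => x /FG.
- by apply: (measurableT_comp mG); exact: measurable_id_Rd.
Qed.

Lemma integral_Rd_ae (F G : rV -> \bar R) : (forall x, ~ Z x -> F x = G x) ->
  measurable_fun setT G -> (\int[la]_x F x = \int[mu]_x G x)%E.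
Proof.
move=> FG mG; rewrite -(integral_Rd mG).
apply: ae_eq_integral; first exact: measurableT.
- exact: ae_measurable_Rd FG mG.
- by apply: (measurableT_comp mG); exact: measurable_id_Rd.
- exact: ae_eq_Rd.
Qed.

Lemma integrable_Rd_ae (F G : rV -> \bar R) : (forall x, ~ Z x -> F x = G x) ->
  measurable_fun setT G -> la.-integrable setT F -> mu.-integrable setT G.
Proof.
move=> FG mG /integrableP[_ iF]; apply/integrableP; split => //.
rewrite -(@integral_Rd_ae (abse \o F)) //.
  by move=> x /FG /= ->.
exact: measurableT_comp.
Qed.

End completed_integrals.

(** * Complex-valued integrable functions *)

Section complex_arith.
Context {R : realType}.
Implicit Types z w : R[i].
Local Notation Re := (@complex.Re R).
Local Notation Im := (@complex.Im R).

Lemma ReM z w : Re (z * w) = Re z * Re w - Im z * Im w.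
Proof. by case: z w => [a b] [c e]. Qed.

Lemma ImM z w : Im (z * w) = Re z * Im w + Im z * Re w.
Proof. by case: z w => [a b] [c e]. Qed.

Lemma ReD z w : Re (z + w) = Re z + Re w.
Proof. by case: z w => [a b] [c e]. Qed.

Lemma ImD z w : Im (z + w) = Im z + Im w.
Proof. by case: z w => [a b] [c e]. Qed.

Lemma cmodE z : cmod z = Num.sqrt (Re z ^+ 2 + Im z ^+ 2).
Proof. by case: z => [a b]; rewrite /cmod normc_def. Qed.

Lemma cmod_ge0 z : 0 <= cmod z.
Proof. by rewrite cmodE sqrtr_ge0. Qed.

Lemma normr_cmod z : `|z| = (cmod z)%:C%C.
Proof. by case: z => [a b]; rewrite /cmod normc_def. Qed.

Lemma cmodD z w : cmod (z + w) <= cmod z + cmod w.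
Proof. by have := ler_normD z w; rewrite !normr_cmod -rmorphD/= lecR. Qed.

Lemma cmodM z w : cmod (z * w) = cmod z * cmod w.
Proof. by have := normrM z w; rewrite !normr_cmod -rmorphM/= => -[]. Qed.

Lemma cmod_real (a : R) : cmod a%:C%C = `|a|.
Proof. by rewrite cmodE/= expr0n addr0 sqrtr_sqr. Qed.

Lemma Re_le_cmod z : `|Re z| <= cmod z.
Proof. by rewrite cmodE -sqrtr_sqr ler_sqrt ?addr_ge0 ?sqr_ge0// lerDl sqr_ge0. Qed.

Lemma Im_le_cmod z : `|Im z| <= cmod z.
Proof. by rewrite cmodE -sqrtr_sqr ler_sqrt ?addr_ge0 ?sqr_ge0// lerDr sqr_ge0. Qed.

Lemma cmod_le_ReIm z : cmod z <= `|Re z| + `|Im z|.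
Proof.
rewrite cmodE -[leRHS]ger0_norm ?addr_ge0// -sqrtr_sqr ler_sqrt ?sqr_ge0//.
rewrite sqrrD !real_normK ?num_real// -addrA lerD2l.
by rewrite lerDr mulrn_wge0// mulr_ge0.
Qed.

Lemma cisD (u v : R) : cis (u + v) = cis u * cis v.
Proof. by rewrite /cis cosD sinD; congr (_ +i* _)%C; rewrite addrC. Qed.

Lemma cisN_add (u : R) : cis (- u) + cis u = (2 * cos u)%:C%C.
Proof.
rewrite /cis cosN sinN; apply/eqP; rewrite eq_complex/= addNr eqxx andbT.
by rewrite mulrDl mul1r.
Qed.

Lemma eq_ReIm z w : Re z = Re w -> Im z = Im w -> z = w.
Proof. by case: z w => [a b] [c e] /= -> ->. Qed.

End complex_arith.

Section complex_integral.
Context {R : realType} {dd : measure_display} {T : measurableType dd}.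
Variable mu : {measure set T -> \bar R}.
Implicit Types (f g : T -> R[i]) (h m u : T -> R).
Local Notation Re := (@complex.Re R).
Local Notation Im := (@complex.Im R).

Definition cmeasurable f :=
  measurable_fun setT (fun x => Re (f x)) /\ measurable_fun setT (fun x => Im (f x)).

Definition cintegrable f :=
  mu.-integrable setT (fun x => (Re (f x))%:E) /\ mu.-integrable setT (fun x => (Im (f x))%:E).

Definition cintegral f : R[i] :=
  ((\int[mu]_x Re (f x)) +i* (\int[mu]_x Im (f x)))%C.

Definition cnorm1 f : \bar R := (\int[mu]_x (cmod (f x))%:E)%E.

Lemma cmeasurable_cmod f : cmeasurable f -> measurable_fun setT (fun x => cmod (f x)).
Proof.
move=> [mr mi].
under eq_fun do rewrite cmodE.
apply: (measurableT_comp (f := @Num.sqrt R)).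
  by apply: continuous_measurable_fun; exact: sqrt_continuous.
by apply: measurable_funD; exact: measurable_funX.
Qed.

Lemma cintegrable_measurable f : cintegrable f -> cmeasurable f.
Proof.
by move=> [fr fi]; split; apply/measurable_EFinP; [move: fr|move: fi]; exact: measurable_int.
Qed.

Lemma cnorm1_ge0 f : (0 <= cnorm1 f)%E.
Proof. by apply: integral_ge0 => x _; rewrite lee_fin cmod_ge0. Qed.

Lemma cnorm1_fin f : cintegrable f -> (cnorm1 f < +oo)%E.
Proof.
move=> [fr fi].
apply: (@le_lt_trans _ _ (\int[mu]_x (`|Re (f x)|%:E + `|Im (f x)|%:E))%E).
  apply: ge0_le_integral => //.
  - by move=> x _; rewrite lee_fin cmod_ge0.
  - by apply/measurable_EFinP/cmeasurable_cmod/cintegrable_measurable.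
  - apply: emeasurable_funD; apply/measurable_EFinP; apply: measurableT_comp => //;
      by have [] := cintegrable_measurable (conj fr fi).
  - by move=> x _; rewrite lee_fin cmod_le_ReIm.
have /integrable_lty := integrableD measurableT (integrable_norm fr) (integrable_norm fi).
exact.
Qed.

Lemma cintegrableP f : cintegrable f <-> cmeasurable f /\ (cnorm1 f < +oo)%E.
Proof.
split=> [fi|[fm ffin]]; first by split; [exact: cintegrable_measurable|exact: cnorm1_fin].
have mc := cmeasurable_cmod fm.
case: (fm) => mr mi; split; apply/integrableP; split; try exact/measurable_EFinP;
  apply: le_lt_trans ffin; apply: ge0_le_integral => //.
- by apply/measurable_EFinP; exact: measurableT_comp.
- exact/measurable_EFinP.
- by move=> x _; rewrite lee_fin Re_le_cmod.
- by apply/measurable_EFinP; exact: measurableT_comp.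
- exact/measurable_EFinP.
- by move=> x _; rewrite lee_fin Im_le_cmod.
Qed.

Lemma cvg_Rintegral_dominated (hn : nat -> T -> R) h (b : T -> R) (Z : set T) :
  measurable Z -> mu Z = 0%E ->
  (forall n, measurable_fun setT (hn n)) -> measurable_fun setT h ->
  mu.-integrable setT (EFin \o b) ->
  (forall n x, ~ Z x -> `|hn n x| <= b x) ->
  (forall x, ~ Z x -> hn n x @[n --> \oo] --> h x) ->
  mu.-integrable setT (EFin \o h) /\
  \int[mu]_x hn n x @[n --> \oo] --> \int[mu]_x h x.
Proof.
move=> mZ Z0 mhn mh ig bn cvh.
have c1 : {ae mu, forall x, setT x -> (EFin \o hn n) x @[n --> \oo] --> (EFin \o h) x}.
  exists Z; split => // x /= nc; apply: contrapT => Zx; apply: nc => _.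
  by apply: cvg_EFin; [exact: nearW|exact: cvh].
have c2 : {ae mu, forall x n, setT x -> (`|(EFin \o hn n) x| <= (EFin \o b) x)%E}.
  exists Z; split => // x /= nc; apply: contrapT => Zx; apply: nc => n _.
  by rewrite lee_fin bn.
have mEhn n : measurable_fun setT (EFin \o hn n) by exact/measurable_EFinP.
have mEh : measurable_fun setT (EFin \o h) by exact/measurable_EFinP.
have [ih _ C] := dominated_convergence measurableT mEhn mEh c1 ig c2.
split => //; apply: fine_cvg; rewrite fineK//; exact: integrable_fin_num.
Qed.

Lemma cmeasurableD f g : cmeasurable f -> cmeasurable g -> cmeasurable (fun x => f x + g x).
Proof.
move=> [? ?] [? ?]; split.
- by under eq_fun do rewrite ReD; exact: measurable_funD.
- by under eq_fun do rewrite ImD; exact: measurable_funD.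
Qed.

Lemma cmeasurableM f g : cmeasurable f -> cmeasurable g -> cmeasurable (fun x => f x * g x).
Proof.
move=> [? ?] [? ?]; split.
- by under eq_fun do rewrite ReM; apply: measurable_funB; exact: measurable_funM.
- by under eq_fun do rewrite ImM; apply: measurable_funD; exact: measurable_funM.
Qed.

Lemma cmeasurable_real m : measurable_fun setT m -> cmeasurable (fun x => (m x)%:C%C).
Proof. by move=> mm; split => //=; exact: measurable_cst. Qed.

Lemma cmeasurable_cis u : measurable_fun setT u -> cmeasurable (fun x => cis (u x)).
Proof.
move=> mu_; split => /=.
- by apply: (measurableT_comp _ mu_); apply: continuous_measurable_fun; exact: continuous_cos.
- by apply: (measurableT_comp _ mu_); apply: continuous_measurable_fun; exact: continuous_sin.
Qed.

Lemma cmod_cis (u : R) : cmod (cis u) = 1.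
Proof. by rewrite cmodE/= cos2Dsin2 sqrtr1. Qed.

Lemma cintegrableM_bounded f g (C : R) : cintegrable f -> cmeasurable g ->
  (forall x, cmod (g x) <= C) -> cintegrable (fun x => f x * g x).
Proof.
move=> fi gm gC; apply/cintegrableP; split.
  by apply: cmeasurableM => //; exact: cintegrable_measurable.
(* If [T] is empty, [C] may be negative, hence the maximum with 0. *)
wlog C0 : C gC / 0 <= C.
  move=> H; apply: (H (Num.max C 0)); last by rewrite le_max lexx orbT.
  by move=> x; rewrite le_max gC.
apply: (@le_lt_trans _ _ (\int[mu]_x (C%:E * (cmod (f x))%:E))%E).
  apply: ge0_le_integral => //.
  - by move=> x _; rewrite lee_fin cmod_ge0.
  - apply/measurable_EFinP/cmeasurable_cmod/cmeasurableM => //.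
    exact: cintegrable_measurable.
  - apply: measurable_funeM; apply/measurable_EFinP/cmeasurable_cmod.
    exact: cintegrable_measurable.
  - move=> x _; rewrite -EFinM lee_fin cmodM mulrC ler_wpM2r//; exact: cmod_ge0.
rewrite ge0_integralZl//.
- by rewrite lte_mul_pinfty ?lee_fin//; exact: cnorm1_fin.
- by apply/measurable_EFinP/cmeasurable_cmod; exact: cintegrable_measurable.
- by move=> x _; rewrite lee_fin cmod_ge0.
Qed.

Lemma cintegrableMr f (c : R[i]) : cintegrable f -> cintegrable (fun x => f x * c).
Proof.
by move=> fi; apply: (@cintegrableM_bounded f (fun=> c) (cmod c)).
Qed.

Lemma cintegrableMl f (c : R[i]) : cintegrable f -> cintegrable (fun x => c * f x).
Proof. by move=> /(cintegrableMr c); congr cintegrable; apply/funext => x; rewrite mulrC. Qed.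

Lemma cintegrable_cis f u : cintegrable f -> measurable_fun setT u ->
  cintegrable (fun x => f x * cis (u x)).
Proof.
move=> fi mu_; apply: (@cintegrableM_bounded _ _ 1) => //; first exact: cmeasurable_cis.
by move=> x; rewrite cmod_cis.
Qed.

Lemma cintegrableD f g : cintegrable f -> cintegrable g -> cintegrable (fun x => f x + g x).
Proof.
move=> [fr fi] [gr gi]; split.
- by under eq_fun do rewrite ReD EFinD; exact: integrableD.
- by under eq_fun do rewrite ImD EFinD; exact: integrableD.
Qed.

Lemma cintegralD f g : cintegrable f -> cintegrable g ->
  cintegral (fun x => f x + g x) = cintegral f + cintegral g.
Proof.
move=> [fr fi] [gr gi]; apply: eq_ReIm => /=.
- by under eq_Rintegral do rewrite ReD; rewrite RintegralD.
- by under eq_Rintegral do rewrite ImD; rewrite RintegralD.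
Qed.

Lemma cintegralMr f (c : R[i]) : cintegrable f ->
  cintegral (fun x => f x * c) = cintegral f * c.
Proof.
move=> [fr fi].
have frc k : mu.-integrable setT (EFin \o (fun x => Re (f x) * k)).
  exact: (integrableZr measurableT k fr).
have fic k : mu.-integrable setT (EFin \o (fun x => Im (f x) * k)).
  exact: (integrableZr measurableT k fi).
apply: eq_ReIm => /=.
- under eq_Rintegral do rewrite ReM.
  by rewrite RintegralB// !RintegralZr// ReM.
- under eq_Rintegral do rewrite ImM.
  by rewrite RintegralD// !RintegralZr// ImM.
Qed.

Lemma cnorm1D f g : cmeasurable f -> cmeasurable g ->
  (cnorm1 (fun x => f x + g x)%R <= cnorm1 f + cnorm1 g)%E.
Proof.
move=> fm gm; have mc (h : T -> R[i]) (hm : cmeasurable h) :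
    measurable_fun setT (fun x => (cmod (h x))%:E).
  by apply/measurable_EFinP; exact: cmeasurable_cmod.
rewrite /cnorm1 -ge0_integralD//; [|by move=> x _; rewrite lee_fin cmod_ge0|exact: mc
  |by move=> x _; rewrite lee_fin cmod_ge0|exact: mc].
apply: ge0_le_integral => //.
- by move=> x _; rewrite lee_fin cmod_ge0.
- by apply: mc; exact: cmeasurableD.
- by apply: emeasurable_funD; exact: mc.
- by move=> x _; rewrite -EFinD lee_fin cmodD.
Qed.

Lemma cnorm1_real_mul f (a : R) : cmeasurable f ->
  cnorm1 (fun x => a%:C%C * f x) = (`|a|%:E * cnorm1 f)%E.
Proof.
move=> fm; rewrite /cnorm1; under eq_integral do rewrite cmodM cmod_real EFinM.
rewrite ge0_integralZl//.
- by apply/measurable_EFinP; exact: cmeasurable_cmod.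
- by move=> x _; rewrite lee_fin cmod_ge0.
Qed.

End complex_integral.

(** * Injectivity of the Fourier transform *)

Lemma cvgn_eventually_cst {R : realType} (u : nat -> R) (l : R) (N : nat) :
  (forall n, (N <= n)%N -> u n = l) -> u n @[n --> \oo] --> l.
Proof.
move=> h; apply/cvgrPdist_le => e e0; exists N => // n /= /h ->.
by rewrite subrr normr0 ltW.
Qed.

Section dotp_lemmas.
Context {R : realType} {d : nat}.
Implicit Types x y t : 'rV[R]_d.

Lemma dotpDl x y t : dotp (x + y) t = dotp x t + dotp y t.
Proof. by rewrite /dotp -big_split/=; apply: eq_bigr => i _; rewrite mxE mulrDl. Qed.

Lemma dotpZl (a : R) x t : dotp (a *: x) t = a * dotp x t.
Proof. by rewrite /dotp mulr_sumr; apply: eq_bigr => i _; rewrite mxE mulrA. Qed.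

Lemma dotpC x t : dotp x t = dotp t x.
Proof. by apply: eq_bigr => i _; rewrite mulrC. Qed.

Lemma dotpNl x t : dotp (- x) t = - dotp x t.
Proof. by rewrite -scaleN1r dotpZl mulN1r. Qed.

Lemma dotpBl x y t : dotp (x - y) t = dotp x t - dotp y t.
Proof. by rewrite dotpDl dotpNl. Qed.

Lemma dotp_delta (i : 'I_d) (a : R) t : dotp (a *: delta_mx 0 i) t = a * t ord0 i.
Proof.
rewrite dotpZl /dotp (bigD1 i)//= big1 ?addr0 => [|j ji]; rewrite !mxE !eqxx ?mul1r//=.
by rewrite (negbTE ji) mul0r.
Qed.

Lemma measurable_dotp t : measurable_fun setT (fun x : 'rV[R]_d => dotp x t).
Proof.
apply: measurable_sum => i; apply: measurable_funM => //.
exact: (measurable_rVcoor i).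
Qed.

End dotp_lemmas.

Section borel_fourier.
Context {R : realType} {d : nat}.
Local Notation mu := (@borel_lebesgue R d).
Implicit Types (f g : 'rV[R]_d -> R[i]) (m : 'rV[R]_d -> R) (t : 'rV[R]_d).

Definition phase t (x : 'rV[R]_d) : R := - (2 * pi * dotp x t).

Lemma measurable_phase t : measurable_fun setT (phase t).
Proof.
rewrite /phase; apply: measurableT_comp => //.
by apply: measurable_funM => //; exact: measurable_dotp.
Qed.

Definition borel_fourier f t := cintegral mu (fun x => f x * cis (phase t x)).

Lemma cintegrable_phase f t : cintegrable mu f ->
  cintegrable mu (fun x => f x * cis (phase t x)).
Proof. by move=> fi; apply: cintegrable_cis => //; exact: measurable_phase. Qed.

Lemma borel_fourierD f g t : cintegrable mu f -> cintegrable mu g ->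
  borel_fourier (fun x => f x + g x) t = borel_fourier f t + borel_fourier g t.
Proof.
move=> fi gi; rewrite /borel_fourier -cintegralD; try exact: cintegrable_phase.
by congr cintegral; apply/funext => x; rewrite mulrDl.
Qed.

Lemma borel_fourierMr f (c : R[i]) t : cintegrable mu f ->
  borel_fourier (fun x => f x * c) t = borel_fourier f t * c.
Proof.
move=> fi; rewrite /borel_fourier -cintegralMr; last exact: cintegrable_phase.
by congr cintegral; apply/funext => x; rewrite mulrAC.
Qed.

(** The integrable functions with zero Fourier transform. The bounded functions that preserve this
    class by multiplication ([mult] below) are enlarged step by step: cosines of linear forms,
    polynomials in them, bounded pointwise limits, and at last the indicators of all Borel sets. *)
Let K0 f := cintegrable mu f /\ forall t, borel_fourier f t = 0.

Let K0D f g : K0 f -> K0 g -> K0 (fun x => f x + g x).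
Proof.
move=> [fi f0] [gi g0]; split; first exact: cintegrableD.
by move=> t; rewrite borel_fourierD// f0 g0 addr0.
Qed.

Let K0Mr f c : K0 f -> K0 (fun x => f x * c).
Proof.
move=> [fi f0]; split; last by move=> t; rewrite borel_fourierMr// f0 mul0r.
exact: cintegrableMr.
Qed.

Let K0cis f s b : K0 f -> K0 (fun x => f x * cis (dotp x s + b)).
Proof.
move=> [fi f0]; split.
  apply: cintegrable_cis => //; apply: measurable_funD => //; exact: measurable_dotp.
move=> t; have pi0 : pi != 0 :> R by rewrite gt_eqF// pi_gt0.
(* Multiplication by [cis (dotp x s)] shifts the frequency by s / (2 pi), and the constant phase [b]
   comes out as a factor. *)
have := borel_fourierMr (cis b) (t - (2 * pi)^-1 *: s) fi.
rewrite f0 mul0r => h; rewrite -[RHS]h /borel_fourier; congr cintegral.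
apply/funext => x; rewrite -!mulrA; congr (_ * _).
rewrite -!cisD; congr cis; rewrite /phase -![dotp x _]dotpC dotpBl dotpZl.
rewrite mulrBr [2 * pi * (_^-1 * _)]mulrA divff ?mul1r ?mulf_neq0//; ring.
Qed.

Let mult m := [/\ measurable_fun setT m, (exists C : R, forall x, `|m x| <= C) &
  forall f, K0 f -> K0 (fun x => (m x)%:C%C * f x)].

Let mult_cst c : mult (fun=> c).
Proof.
split; [exact: measurable_cst|by exists (`|c|)|].
by move=> f /(K0Mr c%:C%C); under eq_fun do rewrite mulrC.
Qed.

Let multD m1 m2 : mult m1 -> mult m2 -> mult (fun x => m1 x + m2 x).
Proof.
move=> [h1 [C1 b1] k1] [h2 [C2 b2] k2]; split; first exact: measurable_funD.
  by exists (C1 + C2) => x; rewrite (le_trans (ler_normD _ _))// lerD.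
move=> f kf; under eq_fun do rewrite rmorphD/= mulrDl.
by apply: K0D; [exact: k1|exact: k2].
Qed.

Let multM m1 m2 : mult m1 -> mult m2 -> mult (fun x => m1 x * m2 x).
Proof.
move=> [h1 [C1 b1] k1] [h2 [C2 b2] k2]; split; first exact: measurable_funM.
  by exists (C1 * C2) => x; rewrite normrM ler_pM.
move=> f kf; under eq_fun do rewrite rmorphM/= -mulrA.
exact/k1/k2.
Qed.

Let multX m n : mult m -> mult (fun x => m x ^+ n).
Proof.
move=> mm; elim: n => [|n ih].
  by under eq_fun do rewrite expr0; exact: mult_cst.
by under eq_fun do rewrite exprS; exact: multM.
Qed.

Let mult_cos s b : mult (fun x => cos (dotp x s + b)).
Proof.
have ms : measurable_fun setT (fun x : 'rV[R]_d => dotp x s + b).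
  by apply: measurable_funD => //; exact: measurable_dotp.
split.
- by apply: (measurableT_comp _ ms); apply: continuous_measurable_fun; exact: continuous_cos.
- by exists 1 => x; exact: cos_max.
move=> f kf.
have := K0Mr (2^-1)%:C%C (K0D (K0cis (- s) (- b) kf) (K0cis s b kf)).
congr K0; apply/funext => x.
have -> : dotp x (- s) - b = - (dotp x s + b) by rewrite dotpC dotpNl dotpC opprD.
rewrite -mulrDr cisN_add -mulrA -rmorphM/= mulrC; congr (_%:C%C * _).
by rewrite mulrC mulKf.
Qed.

(** Dominated convergence with the integrable bound |f|, applied separately to the real and the
    imaginary part of the transform. *)
Let mult_lim (mn : nat -> 'rV[R]_d -> R) m :
  (forall n, mult (mn n)) -> (forall n x, `|mn n x| <= 1) ->
  (forall x, mn n x @[n --> \oo] --> m x) -> mult m.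
Proof.
move=> hmn bn cvm.
have mmn n : measurable_fun setT (mn n) by case: (hmn n).
have mm : measurable_fun setT m by apply: measurable_fun_cvg => // x _; exact: cvm.
have m1 x : `|m x| <= 1.
  have c : `|mn n x| @[n --> \oo] --> `|m x| by exact: cvg_norm.
  rewrite -(cvg_lim _ c)//.
  by apply: limr_le; [exact: cvgP c|exact: nearW].
split => //; first by exists 1.
move=> f [fi f0]; split.
  rewrite (_ : (fun _ => _) = (fun x => f x * (m x)%:C%C)).
    apply: (cintegrableM_bounded (C := 1) fi (cmeasurable_real mm)).
    by move=> x; rewrite cmod_real.
  by apply/funext => x; rewrite mulrC.
move=> t; have [eri eii] := cintegrable_phase t fi.
have lim0 (h : 'rV[R]_d -> R) : mu.-integrable setT (EFin \o h) ->
    (forall n, \int[mu]_x (mn n x * h x) = 0) -> \int[mu]_x (m x * h x) = 0.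
  move=> ih h0.
  have mh : measurable_fun setT h by apply/measurable_EFinP; exact: measurable_int ih.
  have [|||||_ C] := @cvg_Rintegral_dominated _ _ _ mu (fun n x => mn n x * h x)
     (fun x => m x * h x) (fun x => `|h x|) set0 measurable0 (measure0 mu).
  - by move=> n; exact: measurable_funM.
  - exact: measurable_funM.
  - exact: integrable_norm.
  - by move=> n x _; rewrite normrM ler_piMl.
  - by move=> x _; apply: cvgM => //; exact: cvg_cst.
  move: C; under eq_fun do rewrite h0.
  by move=> C; exact: (cvg_unique _ C (cvg_cst 0)).
have F0 n : borel_fourier (fun x => (mn n x)%:C%C * f x) t = 0.
  by case: (hmn n) => _ _ /(_ f (conj fi f0)) [].
have reE a z : complex.Re (a%:C%C * z) = a * complex.Re z :> R.
  by rewrite ReM/= mul0r subr0.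
have imE a z : complex.Im (a%:C%C * z) = a * complex.Im z :> R.
  by rewrite ImM/= mul0r addr0.
apply: eq_ReIm => /=.
  under eq_Rintegral do rewrite -mulrA reE.
  apply: lim0 => // n; have := congr1 (@complex.Re R) (F0 n) => /= h; rewrite -[RHS]h.
  by apply: eq_Rintegral => x _; rewrite -mulrA reE.
under eq_Rintegral do rewrite -mulrA imE.
apply: lim0 => // n; have := congr1 (@complex.Im R) (F0 n) => /= h; rewrite -[RHS]h.
by apply: eq_Rintegral => x _; rewrite -mulrA imE.
Qed.

(* The Borel sets [A] such that [\1_A f] has zero Fourier transform whenever [f] has
   form a sigma-algebra. *)
Let D (A : set 'rV[R]_d) := mult (\1_A).

Let D_set0 : D set0.
Proof. by rewrite /D indic0; exact: (mult_cst 0). Qed.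

Let D_setC A : D A -> D (~` A).
Proof.
move=> DA; have := multD (mult_cst 1) (multM (mult_cst (-1)) DA).
congr mult; apply/funext => x; rewrite !indicE in_setC mulN1r.
by case: (x \in A); rewrite ?subrr ?subr0.
Qed.

Let D_setI A B : D A -> D B -> D (A `&` B).
Proof. by move=> DA DB; rewrite /D indicI; exact: multM. Qed.

Let D_bigcap (F : nat -> set 'rV[R]_d) : (forall n, D (F n)) -> D (\bigcap_n F n).
Proof.
move=> DF.
pose G n := \big[setI/setT]_(i < n) F i.
have DG n : D (G n).
  rewrite /G; elim: n => [|n ih]; last by rewrite big_ord_recr/=; exact: D_setI.
  by rewrite big_ord0 -setC0; exact: D_setC.
have GE n x : G n x <-> forall i, (i < n)%N -> F i x.
  rewrite /G; elim: n => [|n ih]; first by rewrite big_ord0.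
  rewrite big_ord_recr/=; split=> [[/ih h Fn] i|h].
    by rewrite ltnS leq_eqVlt => /predU1P[->//|/h].
  by split; [apply/ih => i /ltnW /h|exact: h].
apply: (@mult_lim (fun n => \1_(G n))) => //.
  by move=> n x; rewrite indicE ger0_norm// lern1 leq_b1.
move=> x; have [xF|xF] := pselect ((\bigcap_n F n) x).
  rewrite [X in _ --> X](_ : _ = 1); last by rewrite indicE mem_set.
  apply: (@cvgn_eventually_cst _ _ _ 0) => n _; rewrite indicE mem_set//.
  by apply/GE => i _; exact: xF.
rewrite [X in _ --> X](_ : _ = 0); last by rewrite indicE memNset.
have [k Fk] : exists k, ~ F k x.
  by apply: contrapT => h; apply: xF => k _; apply: contrapT => ?; apply: h; exists k.
apply: (@cvgn_eventually_cst _ _ _ k.+1) => n kn; rewrite indicE memNset//.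
by move/GE => /(_ k kn).
Qed.

Let D_bigcup (F : nat -> set 'rV[R]_d) : (forall n, D (F n)) -> D (\bigcup_n F n).
Proof.
move=> DF; rewrite -[X in D X]setCK setC_bigcup; apply/D_setC/D_bigcap => n.
exact: D_setC.
Qed.

(** With y = sqrt u, Bernoulli's inequality bounds n y^n, and the other factor y^n tends to 0. *)
Let linear_geo_cvg (u : R) : 0 <= u < 1 -> n%:R * u ^+ n @[n --> \oo] --> 0.
Proof.
move=> /andP[u0 u1].
pose y := Num.sqrt u.
have y0 : 0 <= y by exact: sqrtr_ge0.
have y1 : y < 1 by rewrite -sqrtr1 ltr_sqrt.
have [->|yn0] := eqVneq u 0.
  by apply: (@cvgn_eventually_cst _ _ _ 1) => -[//|n] _; rewrite exprS mul0r mulr0.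
have ygt0 : 0 < y by rewrite sqrtr_gt0 lt_neqAle eq_sym yn0.
pose h := y^-1 - 1.
have h0 : 0 < h by rewrite subr_gt0 invf_gt1.
have bern n : n%:R * y ^+ n <= h^-1.
  have H : 1 + n%:R * h <= (1 + h) ^+ n.
    elim: n => [|n ih]; first by rewrite mul0r addr0 expr0.
    rewrite exprS; apply: (@le_trans _ _ ((1 + h) * (1 + n%:R * h))).
      rewrite -natr1; have : 0 <= h * (n%:R * h) by rewrite mulr_ge0 ?mulr_ge0// ltW.
      lra.
    by rewrite ler_pM2l// addr_gt0.
  have yE : y ^+ n = ((1 + h) ^+ n)^-1 by rewrite -exprVn /h addrC subrK invrK.
  have h1 : 0 < 1 + h by rewrite addr_gt0.
  rewrite yE -[leRHS]mul1r ler_pdivlMr// mulrAC ler_pdivrMr; last exact: exprn_gt0.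
  by rewrite mul1r (le_trans _ H)// lerDr.
apply: (@squeeze_cvgr _ _ _ _ (fun=> 0) (fun n => h^-1 * y ^+ n)).
- apply: nearW => n; rewrite mulr_ge0 ?exprn_ge0//=.
  have -> : u = y * y by rewrite -expr2 sqr_sqrtr.
  by rewrite exprMn mulrA ler_wpM2r ?exprn_ge0.
- exact: cvg_cst.
- rewrite -[X in _ --> X](mulr0 h^-1); apply: cvgM; first exact: cvg_cst.
  by apply: cvg_expr; rewrite ger0_norm.
Qed.

(** Polynomials that converge to a step function, as in proofs of the Stone-Weierstrass theorem. For
    u < 1/2, Bernoulli's inequality gives the lower bound 1 - n (2u)^n. For u >= 1/2 the value is at
    most exp(- n); the factor [n] in the exponent settles the borderline u = 1/2. *)
Let step_cvg (u : R) : 0 <= u <= 1 ->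
  (1 - u ^+ n) ^+ (2 ^ n * n)%N @[n --> \oo] --> ((u < 2^-1)%R%:R : R).
Proof.
move=> /andP[u0 u1].
have un n : 0 <= 1 - u ^+ n <= 1.
  by rewrite subr_ge0 exprn_ile1//= gerBl exprn_ge0.
case: ltP => h.
  have bern n k : 1 - k%:R * u ^+ n <= (1 - u ^+ n) ^+ k.
    have /andP[a0 a1] := un n.
    elim: k => [|k ih]; first by rewrite mul0r subr0 expr0.
    rewrite exprS; apply: (@le_trans _ _ ((1 - u ^+ n) * (1 - k%:R * u ^+ n))).
      rewrite -natr1; have : 0 <= u ^+ n * (k%:R * u ^+ n).
        by rewrite mulr_ge0 ?mulr_ge0// exprn_ge0.
      lra.
    by rewrite ler_wpM2l.
  apply: (@squeeze_cvgr _ _ _ _ (fun n => 1 - n%:R * (2 * u) ^+ n) (fun=> 1)).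
  - apply: nearW => n; apply/andP; split.
      apply: le_trans (bern n _); rewrite lerD2l lerN2 natrM natrX exprMn.
      by rewrite mulrCA mulrA.
    by have /andP[a0 a1] := un n; rewrite exprn_ile1.
  - rewrite -[X in _ --> X](subr0 1); apply: cvgB; first exact: cvg_cst.
    by apply: linear_geo_cvg; apply/andP; split; lra.
  - exact: cvg_cst.
apply: (@squeeze_cvgr _ _ _ _ (fun=> 0) (fun n => expR (- n%:R))).
- apply: nearW => n; have /andP[a0 a1] := un n; rewrite exprn_ge0//=.
  have E : 1 - u ^+ n <= expR (- (2^-1) ^+ n).
    apply: (@le_trans _ _ (1 - (2^-1) ^+ n)).
      by rewrite lerD2l lerN2 lerXn2r// nnegrE.
    by rewrite expR_ge1Dx.
  apply: (@le_trans _ _ (expR (- (2^-1) ^+ n) ^+ (2 ^ n * n)%N)).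
    by rewrite lerXn2r// nnegrE expR_ge0.
  rewrite -expRM_natl ler_expR mulrN lerN2 natrM natrX mulrAC -exprMn divff//.
  by rewrite expr1n mul1r.
- exact: cvg_cst.
- exact: cvgn_expR.
Qed.

Let D_cos s b : D [set x | 0 < cos (dotp x s + b)].
Proof.
(* u = (1 - cos) / 2 takes values in [0, 1], and u < 1/2 exactly where the cosine is positive. *)
pose u (x : 'rV[R]_d) : R := 2^-1 + - 2^-1 * cos (dotp x s + b).
have u01 x : 0 <= u x <= 1.
  have := cos_le1 (dotp x s + b); have := cos_geN1 (dotp x s + b); rewrite /u.
  by move=> *; apply/andP; split; lra.
have mu_ : mult u by exact/multD/multM.
apply: (@mult_lim (fun n x => (1 + -1 * u x ^+ n) ^+ (2 ^ n * n)%N)).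
- move=> n; apply: multX; apply: multD; first exact: mult_cst.
  by apply: multM; [exact: mult_cst|exact: multX].
- move=> n x; have /andP[u0 u1] := u01 x; rewrite mulN1r normrX exprn_ile1//.
  by rewrite ger0_norm ?subr_ge0 ?exprn_ile1// gerBl exprn_ge0.
- move=> x; rewrite (_ : \1__ x = (u x < 2^-1)%R%:R).
    by under eq_fun do rewrite mulN1r; exact: step_cvg.
  rewrite indicE; congr ((nat_of_bool _)%:R); apply/idP/idP; rewrite inE/= /u; lra.
Qed.

(* With [r_k = 2^k r], the sets [cos (pi (x - c) / (2 r_k)) > 0] all contain
   ]c - r, c + r[, and the [k]-th one misses [r_k <= |x - c| < 2 r_k]. *)
Let D_itv (i : 'I_d) (c r : R) : 0 < r -> D [set x | `|x ord0 i - c| < r].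
Proof.
move=> r0.
pose a k : R := pi / (2 ^+ k.+1 * r).
have a0 k : 0 < a k by rewrite divr_gt0 ?pi_gt0// mulr_gt0// exprn_gt0.
have aE k x : a k * x = pi / 2 * (x / (2 ^+ k * r)).
  rewrite /a exprS; field; rewrite gt_eqF//= expf_neq0//.
rewrite [X in D X](_ : _ = \bigcap_k
    [set x | 0 < cos (dotp x (a k *: delta_mx 0 i) + - (a k * c))]).
  by apply: D_bigcap => k; exact: D_cos.
have dE k x : dotp x (a k *: delta_mx 0 i) + - (a k * c) = a k * (x ord0 i - c).
  by rewrite dotpC dotp_delta mulrBr.
have cosE k (x : R) : cos (a k * x) = cos (pi / 2 * (`|x| / (2 ^+ k * r))).
  by rewrite -aE -cos_norm normrM gtr0_norm.
apply/seteqP; split => x/=.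
  move=> xc k _; rewrite /= dE cosE; apply: cos_gt0_pihalf.
  have pr : 0 < 2 ^+ k * r by rewrite mulr_gt0// exprn_gt0.
  rewrite (lt_le_trans (y := 0)) ?oppr_lt0 ?divr_gt0 ?pi_gt0//=; last first.
    by rewrite mulr_ge0 ?divr_ge0 ?pi_ge0// ltW.
  rewrite gtr_pMr ?divr_gt0 ?pi_gt0// ltr_pdivrMr// mul1r (lt_le_trans xc)//.
  by rewrite ler_peMl ?(ltW r0)// exprn_ege1// ler1n.
move=> H; rewrite ltNge; apply/negP => rx.
pose y := `|x ord0 i - c| / r.
have y1 : 1 <= y by rewrite ler_pdivlMr// mul1r.
have [k /andP[k1 k2]] : exists k, 2 ^+ k <= y < 2 ^+ k.+1.
  have ex : exists k, y < 2 ^+ k.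
    exists (Num.bound y); apply: (lt_le_trans (archi_boundP _)).
      by rewrite (le_trans _ y1).
    by rewrite -natrX ler_nat ltnW// ltn_expl.
  case: (ex_minnP ex) => -[|k] yk mk; first by move: yk; rewrite expr0 ltNge y1.
  exists k; rewrite yk andbT leNgt; apply/negP => /mk; by rewrite ltnn.
have := H k I; rewrite /= dE cosE; apply/negP; rewrite -leNgt.
have pk : 0 < 2 ^+ k :> R by rewrite exprn_gt0.
have -> : `|x ord0 i - c| / (2 ^+ k * r) = y / 2 ^+ k.
  by rewrite /y; field; rewrite gt_eqF//= gt_eqF.
set z := y / 2 ^+ k.
have z1 : 1 <= z by rewrite ler_pdivlMr// mul1r.
have z2 : z < 2 by rewrite ltr_pdivrMr// -exprS.
have -> : pi / 2 * z = pi - (pi - pi / 2 * z) by rewrite opprB addrC subrK.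
rewrite cosB cospi sinpi mul0r addr0 mulN1r oppr_le0.
apply: cos_ge0_pihalf; have := pi_gt0 R; nra.
Qed.

Let D_coor (i : 'I_d) (Y : set (measurableTypeR R)) : measurable Y -> D (rVcoor i @^-1` Y).
Proof.
rewrite RGenOpens.measurableE.
suff : <<s (@RGenOpens.G R) >> `<=` [set Y | D (rVcoor i @^-1` Y)] by apply.
apply: smallest_sub; first split.
- by rewrite /= preimage_set0.
- by move=> A DA; rewrite /= setTD preimage_setC; exact: D_setC.
- by move=> F DF; rewrite /= preimage_bigcup; exact: D_bigcup.
move=> _ [a [b ->]] /=.
have [ab|ba] := ltP a b; last first.
  rewrite [X in D X](_ : _ = set0)//; apply/seteqP; split => // x/=.
  by rewrite in_itv/= => /andP[ax /(lt_trans ax)]; rewrite ltNge ba.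
rewrite [X in D X](_ : _ = [set x : 'rV[R]_d | `|x ord0 i - (a + b) / 2| < (b - a) / 2]).
  by apply: D_itv; rewrite divr_gt0// subr_gt0.
apply/seteqP; split => x; rewrite /= in_itv/= /rVcoor ltr_norml => /andP[h1 h2];
  by apply/andP; split; lra.
Qed.

Let D_borel (A : set 'rV[R]_d) : measurable A -> D A.
Proof.
suff : g_sigma_preimage (@rVcoor R d) `<=` D by apply.
apply: smallest_sub; first split.
- exact: D_set0.
- by move=> B DB; rewrite setTD; exact: D_setC.
- exact: D_bigcup.
by rewrite -bigcup_seq; apply: bigcup_sub => i _ _ [Y mY <-]; rewrite setTI; exact: D_coor.
Qed.

Let phase0 x : phase (0 : 'rV[R]_d) x = 0.
Proof.
rewrite /phase (_ : dotp x 0 = 0) ?mulr0 ?oppr0//.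
by rewrite /dotp big1// => i _; rewrite mxE mulr0.
Qed.

(** The function obtained from [f] by multiplication with the indicator of a Borel set [A] has zero
    transform. Its value at the frequency 0 says that the integral of [f] over [A] is 0, and this
    for every [A] makes [f] vanish almost everywhere. *)
Theorem borel_fourier_inj f : cintegrable mu f -> (forall t, borel_fourier f t = 0) ->
  exists Z, [/\ measurable Z, mu Z = 0%E & forall x, ~ Z x -> f x = 0].
Proof.
move=> fi f0.
have int0 A : measurable A -> cintegral mu (fun x => (\1_A x)%:C%C * f x) = 0.
  move=> mA; have [_ _ /(_ f (conj fi f0))[_ /(_ 0)]] := D_borel mA.
  move=> h; rewrite -[RHS]h; congr cintegral; apply/funext => x.
  by rewrite phase0 /cis cos0 sin0 mulr1.
have ae0 (h : 'rV[R]_d -> R) : mu.-integrable setT (EFin \o h) ->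
    (forall A, measurable A -> \int[mu]_x (\1_A x * h x) = 0) ->
    exists Z, [/\ measurable Z, mu Z = 0%E & forall x, ~ Z x -> h x = 0].
  move=> hi hA.
  have [||Z [mZ Z0 Zh]] := @integral_ae_eq _ _ _ mu setT measurableT (cst 0%E) (EFin \o h) hi.
  - exact: measurable_cst.
  - move=> E _ mE; rewrite integral0.
    have iE : mu.-integrable E (EFin \o h) by apply: integrableS hi.
    rewrite -[LHS]fineK; last exact: integrable_fin_num.
    congr (_%:E); rewrite -[RHS](hA E mE) [LHS](_ : _ = \int[mu]_(x in E) h x)//.
    rewrite Rintegral_mkcond; apply: eq_Rintegral => x _.
    by rewrite /patch indicE; case: ifP; rewrite ?mul1r ?mul0r.
  - exists Z; split => // x Zx; apply: contrapT => hx; apply: Zx; apply: Zh => /= /(_ I) [].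
    exact: hx.
have reE a z : complex.Re (a%:C%C * z) = a * complex.Re z :> R.
  by rewrite ReM/= mul0r subr0.
have imE a z : complex.Im (a%:C%C * z) = a * complex.Im z :> R.
  by rewrite ImM/= mul0r addr0.
have [fr fim] := fi.
have [|Z1 [mZ1 Z10 H1]] := ae0 _ fr.
  move=> A mA; have := congr1 (@complex.Re R) (int0 A mA) => /= h; rewrite -[RHS]h.
  by apply: eq_Rintegral => x _; rewrite reE.
have [|Z2 [mZ2 Z20 H2]] := ae0 _ fim.
  move=> A mA; have := congr1 (@complex.Im R) (int0 A mA) => /= h; rewrite -[RHS]h.
  by apply: eq_Rintegral => x _; rewrite imE.
exists (Z1 `|` Z2); split; first exact: measurableU.
  by apply/eqP; rewrite measureU0//; exact/eqP.
move=> x /not_orP[n1 n2]; apply: eq_ReIm; [exact: H1|exact: H2].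
Qed.

End borel_fourier.

(** * Fourier multipliers of L^1 *)

Section fourier_multipliers.
Context {R : realType} {d : nat}.
Local Notation mu := (@borel_lebesgue R d).
Implicit Types (G H : 'rV[R]_d -> R[i]) (m : 'rV[R]_d -> R) (t y : 'rV[R]_d).
Variable lambda : R.

Definition band_limited G := cintegrable mu G /\
  forall t, ~ cube lambda t -> borel_fourier G t = 0.

(** A Fourier multiplier with an L^1 bound [C], stated as the existence of an image for each
    band-limited function instead of as an operator. Only the values of [m] on the cube matter, as
    [eq_multiplier] records. *)
Definition multiplier m (C : R) := forall G, band_limited G ->
  exists H, [/\ cintegrable mu H,
    forall t, borel_fourier H t = (m t)%:C%C * borel_fourier G t &
    (cnorm1 mu H <= C%:E * cnorm1 mu G)%E].

Lemma multiplier_band_limited m G H : band_limited G -> cintegrable mu H ->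
  (forall t, borel_fourier H t = (m t)%:C%C * borel_fourier G t) -> band_limited H.
Proof. by move=> [_ G0] Hi HE; split => // t /G0 h; rewrite HE h mulr0. Qed.

Lemma eq_multiplier m1 m2 C : (forall t, cube lambda t -> m1 t = m2 t) ->
  multiplier m1 C -> multiplier m2 C.
Proof.
move=> m12 h G bG; have [H [Hi HE HC]] := h G bG; exists H; split => // t.
have [/m12 <-|nt] := pselect (cube lambda t); first by rewrite HE.
by rewrite HE bG.2// !mulr0.
Qed.

Lemma multiplier_cst (a : R) : multiplier (fun=> a) `|a|.
Proof.
move=> G [Gi G0]; exists (fun x => a%:C%C * G x); split.
- exact: cintegrableMl.
- move=> t; rewrite [RHS]mulrC -borel_fourierMr//.
  by congr (borel_fourier _ t); apply/funext => x; rewrite mulrC.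
- have Gm := cintegrable_measurable Gi.
  rewrite (cnorm1_real_mul mu a Gm).
  by rewrite lexx.
Qed.

Lemma multiplierM m1 m2 C1 C2 : 0 <= C1 -> multiplier m1 C1 -> multiplier m2 C2 ->
  multiplier (fun t => m1 t * m2 t) (C1 * C2).
Proof.
move=> C10 h1 h2 G bG; have [H2 [H2i H2E H2C]] := h2 G bG.
have [H1 [H1i H1E H1C]] := h1 H2 (multiplier_band_limited bG H2i H2E).
exists H1; split => //.
- by move=> t; rewrite H1E H2E mulrA -rmorphM.
- by rewrite (le_trans H1C)// EFinM -muleA lee_wpmul2l.
Qed.

Lemma multiplierD m1 m2 C1 C2 : multiplier m1 C1 -> multiplier m2 C2 ->
  multiplier (fun t => m1 t + m2 t) (C1 + C2).
Proof.
move=> h1 h2 G bG; have [H2 [H2i H2E H2C]] := h2 G bG; have [H1 [H1i H1E H1C]] := h1 G bG.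
exists (fun x => H1 x + H2 x); split.
- exact: cintegrableD.
- by move=> t; rewrite borel_fourierD// H1E H2E rmorphD mulrDl.
- apply: (le_trans (cnorm1D mu (cintegrable_measurable H1i) (cintegrable_measurable H2i))).
  rewrite EFinD muleDl//; first exact: leeD.
  by rewrite ge0_fin_numE ?cnorm1_ge0// cnorm1_fin//; case: bG.
Qed.

Lemma borel_lebesgue_translate y (A : set 'rV[R]_d) : measurable A ->
  mu ((fun x => x + y)%R @^-1` A) = mu A.
Proof.
move=> mA; rewrite (borel_lebesgue_affine y (oner_neq0 R) mA) normr1 expr1n mul1e.
by congr (mu _); apply/seteqP; split => x/=; rewrite scale1r.
Qed.

Lemma measurable_translate y : measurable_fun setT (fun x : 'rV[R]_d => x + y).
Proof.
have := measurable_affine_rV 1 y; congr measurable_fun.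
by apply/funext => x; rewrite scale1r.
Qed.

Lemma ge0_integral_translate y (f : 'rV[R]_d -> \bar R) : measurable_fun setT f ->
  (forall x, 0 <= f x)%E -> (\int[mu]_x f (x + y)%R = \int[mu]_x f x)%E.
Proof.
move=> mf f0.
pose m := measure_function_pushforward__canonical__measure_function_Measure mu (measurable_translate y).
transitivity (\int[m]_x f x)%E.
  by rewrite ge0_integral_pushforward//; exact: measurable_translate.
by apply: (@eq_measure_integral _ _ _ setT mu m f) => A mA _; exact: borel_lebesgue_translate.
Qed.

Lemma integral_translate y (f : 'rV[R]_d -> \bar R) : measurable_fun setT f ->
  (\int[mu]_x f (x + y)%R = \int[mu]_x f x)%E.
Proof.
move=> mf; rewrite integralE [RHS]integralE; congr (_ - _)%E.
- rewrite -(ge0_integral_translate y (measurable_funepos mf))//.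
  by apply: eq_integral => x _; rewrite !funeposE.
- rewrite -(ge0_integral_translate y (measurable_funeneg mf))//.
  by apply: eq_integral => x _; rewrite !funenegE.
Qed.

Lemma cintegral_translate y G : cmeasurable G ->
  cintegral mu (fun x : 'rV[R]_d => G (x + y)) = cintegral mu G.
Proof.
move=> [Gr Gi]; rewrite /cintegral /Rintegral; congr (fine _ +i* fine _)%C.
  by rewrite -[RHS](integral_translate y)//; exact/measurable_EFinP.
by rewrite -[RHS](integral_translate y)//; exact/measurable_EFinP.
Qed.

Lemma cmeasurable_translate y G : cmeasurable G -> cmeasurable (fun x : 'rV[R]_d => G (x + y)).
Proof.
by move=> [Gr Gi]; split; [exact: (measurableT_comp Gr (measurable_translate y))
  |exact: (measurableT_comp Gi (measurable_translate y))].
Qed.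

Lemma cnorm1_translate y G : cmeasurable G ->
  cnorm1 mu (fun x : 'rV[R]_d => G (x + y)) = cnorm1 mu G.
Proof.
move=> Gm; rewrite /cnorm1 -[RHS](ge0_integral_translate y)//.
  by apply/measurable_EFinP; exact: cmeasurable_cmod.
by move=> x; rewrite lee_fin cmod_ge0.
Qed.

Lemma cintegrable_translate y G : cintegrable mu G ->
  cintegrable mu (fun x : 'rV[R]_d => G (x + y)).
Proof.
move=> /cintegrableP[Gm Gf]; apply/cintegrableP; split.
  exact: cmeasurable_translate.
by rewrite cnorm1_translate.
Qed.

Lemma phaseD t x y : phase t (x + y) = phase t x + phase t y :> R.
Proof. by rewrite /phase dotpDl mulrDr opprD. Qed.

Lemma phaseN t y : phase t (- y) = - phase t y :> R.
Proof. by rewrite /phase dotpNl mulrN. Qed.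

Lemma borel_fourier_translate y G t : cintegrable mu G ->
  borel_fourier (fun x : 'rV[R]_d => G (x + y)) t = borel_fourier G t * cis (- phase t y).
Proof.
move=> Gi; rewrite -borel_fourierMr//.
have Gc : cintegrable mu (fun x => G x * cis (- phase t y) * cis (phase t x)).
  by apply: cintegrable_phase; exact: cintegrableMr.
rewrite [RHS]/borel_fourier -(cintegral_translate y); last exact: cintegrable_measurable Gc.
congr cintegral; apply/funext => x.
by rewrite -mulrA -cisD phaseD addrCA addNr addr0.
Qed.

(** The function cos(2 pi y . t) is the transform of the mean of the unit masses at y and - y, so
    [H] is the mean of two translates of [G], and translations preserve the L^1 norm. *)
Lemma multiplier_cos y : multiplier (fun t => cos (2 * pi * dotp y t)) 1.
Proof.
move=> G [Gi G0].
have i1 := cintegrable_translate y Gi; have i2 := cintegrable_translate (- y) Gi.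
have i12 := cintegrableD i1 i2.
have m12 := cintegrable_measurable i12.
exists (fun x => (2^-1)%:C%C * (G (x + y) + G (x - y))); split.
- exact: cintegrableMl.
- move=> t; transitivity (borel_fourier (fun x => (G (x + y) + G (x - y)) * (2^-1)%:C%C) t).
    by congr (borel_fourier _ t); apply/funext => x; rewrite mulrC.
  rewrite borel_fourierMr// borel_fourierD// !borel_fourier_translate//.
  rewrite phaseN (opprK (phase t y)) -mulrDr cisN_add -mulrA -rmorphM/= mulrC; congr (_%:C%C * _).
  by rewrite mulrAC mulfV// mul1r /phase cosN.
- rewrite cnorm1_real_mul// mul1e ger0_norm ?invr_ge0//.
  rewrite -(@lee_pmul2l _ 2%:E)// muleA -EFinM mulfV// mul1e.
  apply: (le_trans (cnorm1D mu (cintegrable_measurable i1) (cintegrable_measurable i2))).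
  have Gm := cintegrable_measurable Gi.
  by rewrite !cnorm1_translate// mule_natl.
Qed.

End fourier_multipliers.

(** * Absolutely convergent series in L^1 *)

Section complex_L1_series.
Context {R : realType} {dd : measure_display} {T : measurableType dd}.
Variable mu : {measure set T -> \bar R}.
Local Notation Re := (@complex.Re R).
Local Notation Im := (@complex.Im R).

Lemma cmod_cvg (z : nat -> R[i]) (l : R[i]) : Re (z n) @[n --> \oo] --> Re l ->
  Im (z n) @[n --> \oo] --> Im l -> cmod (z n) @[n --> \oo] --> cmod l.
Proof.
move=> cr ci; rewrite cmodE; under eq_fun do rewrite cmodE.
apply: (@cvg_comp _ _ _ (fun n => Re (z n) ^+ 2 + Im (z n) ^+ 2) (@Num.sqrt R) _
  (nbhs (Re l ^+ 2 + Im l ^+ 2))); last exact: sqrt_continuous.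
by apply: cvgD; rewrite expr2; under eq_fun do rewrite expr2; exact: cvgM.
Qed.

Lemma cvg_sum_bounded (u : nat -> R) (a : nat -> R) (M : R) :
  (forall k, `|u k| <= a k) -> (forall n, \sum_(0 <= k < n) a k <= M) ->
  cvgn (fun n => \sum_(0 <= k < n) u k).
Proof.
move=> ua aM; apply: normed_cvg; apply: nondecreasing_is_cvgn.
- by apply/nondecreasing_seqP => n; rewrite /= seriesS lerDr.
- exists M => _ [n _ <-]; apply: le_trans (aM n).
  by rewrite /= /series/=; apply: ler_sum => k _.
Qed.

Lemma Re_sum (z : nat -> R[i]) n :
  Re (\sum_(0 <= k < n) z k) = \sum_(0 <= k < n) Re (z k).
Proof. by elim/big_ind2 : _ => // a b c e <- <-; rewrite ReD. Qed.

Lemma Im_sum (z : nat -> R[i]) n :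
  Im (\sum_(0 <= k < n) z k) = \sum_(0 <= k < n) Im (z k).
Proof. by elim/big_ind2 : _ => // a b c e <- <-; rewrite ImD. Qed.

Lemma cmod0 : cmod (0 : R[i]) = 0.
Proof. by rewrite cmodE/= expr0n/= addr0 sqrtr0. Qed.

Lemma cmod_sum (z : nat -> R[i]) n :
  cmod (\sum_(0 <= k < n) z k) <= \sum_(0 <= k < n) cmod (z k).
Proof.
elim: n => [|n IH]; first by rewrite !big_geq// cmod0.
by rewrite !big_nat_recr//= (le_trans (cmodD _ _))// lerD2r.
Qed.

Lemma cintegrable_sum (H : nat -> T -> R[i]) n : (forall k, cintegrable mu (H k)) ->
  cintegrable mu (fun x => \sum_(0 <= k < n) H k x).
Proof.
move=> Hi; elim: n => [|n IH].
  under eq_fun do rewrite big_geq//.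
  by split; exact: integrable0.
by under eq_fun do rewrite big_nat_recr//=; exact: cintegrableD.
Qed.

Lemma cintegral_sum (H : nat -> T -> R[i]) n : (forall k, cintegrable mu (H k)) ->
  cintegral mu (fun x => \sum_(0 <= k < n) H k x) = \sum_(0 <= k < n) cintegral mu (H k).
Proof.
move=> Hi; elim: n => [|n IH].
  rewrite big_geq//; under eq_fun do rewrite big_geq//.
  by rewrite /cintegral /Rintegral integral0.
rewrite big_nat_recr//= -IH -cintegralD//; last exact: cintegrable_sum.
by under eq_fun do rewrite big_nat_recr//=.
Qed.

(** The completeness argument of Riesz and Fischer: the sum [S] of the moduli is integrable by
    monotone convergence, hence finite off a null set [Z], where the series converges. [S] then
    dominates the partial sums, and the integrals against any [cis (u x)] pass to the limit. *)
Lemma cintegrable_series (H : nat -> T -> R[i]) (M : \bar R) :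
  (forall k, cintegrable mu (H k)) -> (M < +oo)%E ->
  (forall n, \sum_(0 <= k < n) cnorm1 mu (H k) <= M)%E ->
  exists f, [/\ cintegrable mu f, (cnorm1 mu f <= M)%E &
    forall u, measurable_fun setT u ->
      Re (\sum_(0 <= k < n) cintegral mu (fun x => H k x * cis (u x))) @[n --> \oo]
        --> Re (cintegral mu (fun x => f x * cis (u x))) /\
      Im (\sum_(0 <= k < n) cintegral mu (fun x => H k x * cis (u x))) @[n --> \oo]
        --> Im (cintegral mu (fun x => f x * cis (u x)))].
Proof.
move=> Hi Moo HM.
have Hm k := cintegrable_measurable (Hi k).
have mH k : measurable_fun setT (fun x => (cmod (H k x))%:E).
  by apply/measurable_EFinP; exact: cmeasurable_cmod.
pose S x : \bar R := (\sum_(0 <= k <oo) (cmod (H k x))%:E)%E.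
have H0 k x : (0 <= (cmod (H k x))%:E)%E by rewrite lee_fin cmod_ge0.
have S0 x : (0 <= S x)%E by apply: nneseries_ge0.
have mS : measurable_fun setT S by exact: ge0_emeasurable_sum.
have intS : (\int[mu]_x S x <= M)%E.
  rewrite /S integral_nneseries//; apply: lime_le.
    by apply: is_cvg_nneseries => k _ _; exact: cnorm1_ge0.
  by apply: nearW => n; exact: HM.
have iS : mu.-integrable setT S.
  apply/integrableP; split => //; under eq_integral do rewrite gee0_abs//.
  exact: le_lt_trans Moo.
have [Z [mZ Z0 SZ]] := integrable_ae measurableT iS.
have Sf x : ~ Z x -> S x \is a fin_num.
  by move=> nZ; apply: contrapT => nS; apply: nZ; apply: SZ => /= /(_ I).
pose b x := fine (S x).
have b0 x : 0 <= b x by rewrite fine_ge0.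
have ib : mu.-integrable setT (EFin \o b).
  apply: le_integrable iS => //.
    by apply/measurable_EFinP; apply: (measurableT_comp (f := fine)); first exact: fine_measurable.
  move=> x _ /=; rewrite (ger0_norm (b0 x)) gee0_abs// /b.
  by case: (S x) (S0 x) => //= *; rewrite ?leey// lexx.
have sumb x n : ~ Z x -> \sum_(0 <= k < n) cmod (H k x) <= b x.
  move=> nZ; rewrite -lee_fin /b fineK ?Sf// -sumEFin.
  by apply: nneseries_lim_ge.
pose P n x : R[i] := \sum_(0 <= k < n) H k x.
(* Cutting off [Z] makes the limits below exist at every point, so that they are measurable; the sum
   is 0 on [Z]. *)
pose chi x : R := \1_(~` Z) x.
have chi0 x : Z x -> chi x = 0 by move=> Zx; rewrite /chi indicE memNset.
have chi1 x : ~ Z x -> chi x = 1 by move=> Zx; rewrite /chi indicE mem_set.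
have Pm n : cmeasurable (P n) by exact: cintegrable_measurable (cintegrable_sum _ Hi).
pose hr x := limn (fun n => Re (P n x) * chi x).
pose hi x := limn (fun n => Im (P n x) * chi x).
have cr x : Re (P n x) * chi x @[n --> \oo] --> hr x.
  suff : cvgn (fun n => Re (P n x) * chi x) by [].
  have [Zx|nZ] := pselect (Z x).
    rewrite chi0//; under eq_fun do rewrite mulr0; exact: is_cvg_cst.
  rewrite chi1//; under eq_fun do rewrite mulr1 Re_sum.
  by apply: (@cvg_sum_bounded _ (fun k => cmod (H k x)) (b x)) => [k|n];
    [exact: Re_le_cmod|exact: sumb].
have ci x : Im (P n x) * chi x @[n --> \oo] --> hi x.
  suff : cvgn (fun n => Im (P n x) * chi x) by [].
  have [Zx|nZ] := pselect (Z x).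
    rewrite chi0//; under eq_fun do rewrite mulr0; exact: is_cvg_cst.
  rewrite chi1//; under eq_fun do rewrite mulr1 Im_sum.
  by apply: (@cvg_sum_bounded _ (fun k => cmod (H k x)) (b x)) => [k|n];
    [exact: Im_le_cmod|exact: sumb].
have mchi : measurable_fun setT chi by apply: measurable_indic; exact: measurableC.
have mhr : measurable_fun setT hr.
  apply: (@measurable_fun_cvg _ _ _ _ (fun n x => Re (P n x) * chi x)) => // n.
  by apply: measurable_funM => //; case: (Pm n).
have mhi : measurable_fun setT hi.
  apply: (@measurable_fun_cvg _ _ _ _ (fun n x => Im (P n x) * chi x)) => // n.
  by apply: measurable_funM => //; case: (Pm n).
pose f x : R[i] := (hr x +i* hi x)%C.
have Pb n x : ~ Z x -> cmod (P n x) <= b x.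
  by move=> nZ; apply: le_trans (sumb x n nZ); exact: cmod_sum.
have Pr x : ~ Z x -> Re (P n x) @[n --> \oo] --> Re (f x).
  by move=> nZ; have := cr x; rewrite chi1//; under eq_fun do rewrite mulr1.
have Pi x : ~ Z x -> Im (P n x) @[n --> \oo] --> Im (f x).
  by move=> nZ; have := ci x; rewrite chi1//; under eq_fun do rewrite mulr1.
have fm : cmeasurable f by split.
have fS x : ((cmod (f x))%:E <= S x)%E.
  have [Zx|nZ] := pselect (Z x).
    suff -> : f x = 0 by rewrite cmod0.
    rewrite /f /hr /hi chi0//; under eq_fun do rewrite mulr0.
    by rewrite lim_cst//; under eq_fun do rewrite mulr0; rewrite lim_cst.
  rewrite -[leRHS]fineK ?Sf// lee_fin.
  apply: ler_cvg_to (cmod_cvg (Pr x nZ) (Pi x nZ)) (cvg_cst (b x)) _.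
  by apply: nearW => n; exact: Pb.
have fM : (cnorm1 mu f <= M)%E.
  apply: le_trans intS; apply: ge0_le_integral => //.
  - by move=> x _; rewrite lee_fin cmod_ge0.
  - by apply/measurable_EFinP; exact: cmeasurable_cmod.
have fi : cintegrable mu f by apply/cintegrableP; split => //; exact: le_lt_trans Moo.
exists f; split => // u mu_.
have Hci k := cintegrable_cis (Hi k) mu_.
have Pci n : cintegrable mu (fun x => P n x * cis (u x)).
  by apply: cintegrable_cis => //; exact: cintegrable_sum.
have fci := cintegrable_cis fi mu_.
have E n : \sum_(0 <= k < n) cintegral mu (fun x => H k x * cis (u x)) =
    cintegral mu (fun x => P n x * cis (u x)).
  by rewrite -cintegral_sum//; congr cintegral; apply/funext => x; rewrite mulr_suml.
split; under eq_fun do rewrite E.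
- apply: (@cvg_Rintegral_dominated _ _ _ mu (fun n x => Re (P n x * cis (u x)))
    (fun x => Re (f x * cis (u x))) b Z mZ Z0 _ _ ib _ _).2.
  + by move=> n; case: (cintegrable_measurable (Pci n)).
  + by case: (cintegrable_measurable fci).
  + move=> n x nZ; apply: le_trans (Re_le_cmod _) _.
    by rewrite cmodM cmod_cis mulr1 Pb.
  + move=> x nZ; rewrite ReM; under eq_fun do rewrite ReM.
    by apply: cvgB; apply: cvgM => //; [exact: Pr|exact: cvg_cst|exact: Pi|exact: cvg_cst].
- apply: (@cvg_Rintegral_dominated _ _ _ mu (fun n x => Im (P n x * cis (u x)))
    (fun x => Im (f x * cis (u x))) b Z mZ Z0 _ _ ib _ _).2.
  + by move=> n; case: (cintegrable_measurable (Pci n)).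
  + by case: (cintegrable_measurable fci).
  + move=> n x nZ; apply: le_trans (Im_le_cmod _) _.
    by rewrite cmodM cmod_cis mulr1 Pb.
  + move=> x nZ; rewrite ImM; under eq_fun do rewrite ImM.
    by apply: cvgD; apply: cvgM => //; [exact: Pr|exact: cvg_cst|exact: Pi|exact: cvg_cst].
Qed.

End complex_L1_series.

Section multiplier_series.
Context {R : realType} {d : nat}.
Local Notation mu := (@borel_lebesgue R d).
Implicit Types (m : 'rV[R]_d -> R) (t y : 'rV[R]_d).
Variable lambda : R.
Hypothesis lambda0 : 0 < lambda.
Local Notation multiplier := (@multiplier R d lambda).

(** The images of [G] under the terms have summable norms, so they add up in L^1. The symbols need
    to converge on the cube only, because the transform of [G] vanishes elsewhere. *)
Lemma multiplier_series (m : nat -> 'rV[R]_d -> R) (C : nat -> R) m' (C' : R) :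
  (forall k, 0 <= C k) -> (forall k, multiplier (m k) (C k)) ->
  series C @ \oo --> C' ->
  (forall t, cube lambda t -> series (fun k => m k t) @ \oo --> m' t) ->
  multiplier m' C'.
Proof.
move=> C0 hm CC' mm' G bG; have [Gi G0] := bG.
have [H HP] := choice (fun k => hm k G bG).
have Hi k : cintegrable mu (H k) by case: (HP k).
have leC n : series C n <= C'.
  rewrite -(cvg_lim _ CC')//; apply: nondecreasing_cvgn_le; last exact: cvgP CC'.
  by apply/nondecreasing_seqP => k; rewrite /= seriesS lerDr.
have C'0 : 0 <= C' by have := leC 0%N; rewrite /series/= big_geq.
have Gfin : cnorm1 mu G \is a fin_num by rewrite ge0_fin_numE ?cnorm1_ge0// cnorm1_fin.
have MC : (C'%:E * cnorm1 mu G < +oo)%E by rewrite -(fineK Gfin) -EFinM ltry.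
have HM n : (\sum_(0 <= k < n) cnorm1 mu (H k) <= C'%:E * cnorm1 mu G)%E.
  apply: (@le_trans _ _ (\sum_(0 <= k < n) (C k)%:E * cnorm1 mu G)%E).
    by apply: lee_sum => k _; case: (HP k).
  rewrite -ge0_sume_distrl; last by move=> k _; rewrite lee_fin.
  rewrite sumEFin lee_wpmul2r ?cnorm1_ge0// lee_fin; exact: leC.
have [f [fi fC fF]] := cintegrable_series Hi MC HM.
exists f; split => // t.
have [cr ci] := fF (phase t) (measurable_phase t).
have E n : \sum_(0 <= k < n) cintegral mu (fun x => H k x * cis (phase t x)) =
    (series (fun k => m k t) n)%:C%C * borel_fourier G t.
  rewrite /series/= rmorph_sum mulr_suml; apply: eq_bigr => k _.
  by have [_ h _] := HP k; exact: (h t).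
have Er n : complex.Re (\sum_(0 <= k < n) cintegral mu (fun x => H k x * cis (phase t x))) =
    series (fun k => m k t) n * complex.Re (borel_fourier G t).
  by rewrite E ReM/= mul0r subr0.
have Ei n : complex.Im (\sum_(0 <= k < n) cintegral mu (fun x => H k x * cis (phase t x))) =
    series (fun k => m k t) n * complex.Im (borel_fourier G t).
  by rewrite E ImM/= mul0r addr0.
move: cr ci; rewrite (funext Er) (funext Ei) => cr ci.
have [/mm' ct|nt] := pselect (cube lambda t).
- have lr : series (fun k => m k t) n * complex.Re (borel_fourier G t) @[n --> \oo]
      --> m' t * complex.Re (borel_fourier G t) by apply: cvgM => //; exact: cvg_cst.
  have li : series (fun k => m k t) n * complex.Im (borel_fourier G t) @[n --> \oo]
      --> m' t * complex.Im (borel_fourier G t) by apply: cvgM => //; exact: cvg_cst.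
  apply: eq_ReIm.
  + by rewrite [RHS]ReM/= mul0r subr0; exact: cvg_unique cr lr.
  + by rewrite [RHS]ImM/= mul0r addr0; exact: cvg_unique ci li.
- have z : (fun n => series (fun k => m k t) n * 0) = (fun=> 0) :> (nat -> R).
    by apply/funext => n; rewrite mulr0.
  move: cr ci; rewrite G0// mulr0/= z => cr ci; apply: eq_ReIm.
  + exact: cvg_unique cr (cvg_cst 0).
  + exact: cvg_unique ci (cvg_cst 0).
Qed.

Lemma multiplier_sqr_coord (i : 'I_d) : multiplier (fun t => t ord0 i ^+ 2) (lambda ^+ 2).
Proof.
have [c [cC cE]] := square_cosine_series lambda0.
apply: (@multiplier_series (fun k t => c k * cos (k%:R * (pi / lambda) * t ord0 i))
  (fun k => `|c k|)) => //.
- move=> k; rewrite -[`|c k|]mulr1; apply: multiplierM => //.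
    exact: multiplier_cst.
  (* The translation by k / (2 lambda) along the i-th axis: then 2 pi y . t = k (pi / lambda)
     t_i. *)
  refine (eq_multiplier _ (@multiplier_cos R d lambda ((k%:R / (2 * lambda)) *: delta_mx 0 i))) => t _.
  rewrite dotp_delta; congr cos.
  have key (p : R) : 2 * p * (k%:R / (2 * lambda) * t ord0 i) =
      k%:R * (p / lambda) * t ord0 i by field; rewrite lt0r_neq0.
  exact: key.
- by move=> t /(_ i) ti; exact: cE.
Qed.

Lemma multiplier_dotp : multiplier (fun t => dotp t t) (d%:R * lambda ^+ 2).
Proof.
suff H n (nd : (n <= d)%N) : multiplier
    (fun t => \sum_(i < d | (i < n)%N) t ord0 i ^+ 2) (n%:R * lambda ^+ 2).
  refine (eq_multiplier _ (H d (leqnn d))) => t _.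
  by apply: eq_big => [i|i _]; rewrite ?ltn_ord// expr2.
elim: n nd => [|n IH] nd.
  rewrite mul0r; have := @multiplier_cst R d lambda 0; rewrite normr0.
  apply: eq_multiplier => t _.
  by rewrite big_pred0.
rewrite -natr1 mulrDl mul1r.
refine (eq_multiplier _ (multiplierD (IH (ltnW nd)) (multiplier_sqr_coord (Ordinal nd)))) => t _.
rewrite [RHS](bigD1 (Ordinal nd))//= addrC; congr (_ + _); apply: eq_bigl => j.
by rewrite -val_eqE/= ltnS ltn_neqAle andbC.
Qed.

Lemma multiplier_pseries (a : nat -> R) : (forall n, 0 <= a n) ->
  cvgn (pseries a (d%:R * lambda ^+ 2)) ->
  (forall t, cube lambda t -> cvgn (pseries a (dotp t t))) ->
  multiplier (fun t => limn (pseries a (dotp t t))) (limn (pseries a (d%:R * lambda ^+ 2))).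
Proof.
move=> a0 ca cat.
have L0 : 0 <= d%:R * lambda ^+ 2 by rewrite mulr_ge0// sqr_ge0.
apply: (@multiplier_series (fun k t => a k * dotp t t ^+ k)
  (fun k => a k * (d%:R * lambda ^+ 2) ^+ k)) => //.
- by move=> k; rewrite mulr_ge0// exprn_ge0.
- move=> k; apply: multiplierM => //.
    by have := @multiplier_cst R d lambda (a k); rewrite ger0_norm.
  elim: k => [|k IH].
    by have := @multiplier_cst R d lambda 1; rewrite normr1.
  rewrite exprS; refine (eq_multiplier _ (multiplierM L0 multiplier_dotp IH)) => t _.
  by rewrite exprS.
Qed.

Lemma dotp_cube t : cube lambda t -> 0 <= dotp t t <= d%:R * lambda ^+ 2.
Proof.
move=> tl; apply/andP; split; first by apply: sumr_ge0 => i _; rewrite -expr2 sqr_ge0.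
rewrite -[X in X%:R](card_ord d) -sum1_card natr_sum mulr_suml.
apply: ler_sum => i _; rewrite mul1r -expr2 -real_normK ?num_real//.
by rewrite lerXn2r ?nnegrE// ltW.
Qed.

End multiplier_series.

(** * The Gamma function and Gaussian integrals *)

Section gamma_recursion.
Context {R : realType}.
Local Notation leb := (@lebesgue_measure R).

Lemma integral_indic_mul {dd} {T : measurableType dd} (mu : {measure set T -> \bar R})
    (D : set T) (g : T -> R) :
  (\int[mu]_x (\1_D x * g x)%:E = \int[mu]_(x in D) (g x)%:E)%E.
Proof.
rewrite [RHS]integral_mkcond; apply: eq_integral => x _.
by rewrite patchE indicE; case: (x \in D); rewrite ?mul1r ?mul0r.
Qed.

Lemma measurable_ltr_set {dd} {T : measurableType dd} (f g : T -> R) :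
  measurable_fun setT f -> measurable_fun setT g -> measurable [set x | f x < g x].
Proof.
move=> mf mg; have := measurable_fun_ltr mf mg measurableT (Y := [set true]) I.
by rewrite setTI.
Qed.

Lemma integral_expR_tail (u : R) : (\int[leb]_(x in `]u, +oo[) (expR (- x))%:E = (expR (- u))%:E)%E.
Proof.
rewrite integral_itv_obnd_cbnd; last first.
  apply/measurable_EFinP; apply: measurableT_comp => //.
rewrite (@ge0_continuous_FTC2y _ _ (fun x => - expR (- x)) u 0).
- by rewrite sub0e EFinN oppeK.
- by move=> x _; exact: expR_ge0.
- apply: continuous_subspaceT => x.
  apply: (@continuous_comp _ _ _ (fun x => - x) expR);
    [exact: opp_continuous|exact: continuous_expR].
- rewrite -oppr0; apply: cvgN; apply: cvgr_expR.
- by move=> x _; apply: ex_derive.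
- apply: cvg_at_right_filter; apply: cvgN.
  apply: (@continuous_comp _ _ _ (fun x => - x) expR);
    [exact: opp_continuous|exact: continuous_expR].
- move=> x _; rewrite derive1E.
  have D : is_derive x 1 (fun y => - expR (- y)) (expR (- x)).
    by apply: is_derive_eq; rewrite /GRing.scale/= ?mulrN1 ?mulN1r ?opprK.
  exact: derive_val.
Qed.

(** For s > 1 the integrand is continuous up to 0, so the fundamental theorem of calculus applies on
    the closed interval, which differs from the open one by a null set. *)
Lemma integral_powR (s X : R) : 1 < s -> 0 < X ->
  (\int[leb]_(x in `]0%R, X[) (s * x `^ (s - 1))%:E = (X `^ s)%:E)%E.
Proof.
move=> s1 X0.
have s0 : 0 < s by exact: lt_trans s1.
have s10 : 0 < s - 1 by rewrite subr_gt0.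
have mf (D : set R) : measurable_fun D (fun x => (s * x `^ (s - 1))%:E).
  apply/measurable_EFinP; apply: measurable_funM => //.
  by apply: measurable_funTS; exact: measurable_powR.
rewrite integral_itv_obnd_cbnd// integral_itv_bndo_bndc//.
have cp (p x : R) : 0 < x -> {for x, continuous (@powR R ^~ p)}.
  move=> x0; apply: differentiable_continuous; apply/derivable1_diffP.
  by apply: derivable_powR; rewrite in_itv/= x0.
rewrite (@continuous_FTC2 _ _ (@powR R ^~ s) 0 X) => //.
- by rewrite powR0 ?gt_eqF// sube0.
- apply/continuous_within_itvP => //; split.
  + move=> x; rewrite in_itv/= => /andP[x0 _]; apply: cvgM; [exact: cvg_cst|exact: cp].
  + rewrite powR0 ?gt_eqF//; apply: cvgM; [exact: cvg_cst|exact: powR_cvg0].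
  + by apply: cvg_at_left_filter; apply: cvgM; [exact: cvg_cst|exact: cp].
- split.
  + move=> x; rewrite in_itv/= => /andP[x0 _].
    by apply: derivable_powR; rewrite in_itv/= x0.
  + by rewrite powR0 ?gt_eqF//; exact: powR_cvg0.
  + by apply: cvg_at_left_filter; exact: cp.
- by move=> x; rewrite in_itv/= => /andP[x0 _]; rewrite powR_derive1// in_itv/= x0.
Qed.

(* [Gamma] as an extended real: its finiteness is only obtained in [gammaE_half]. *)
Definition gammaE (s : R) : \bar R :=
  (\int[leb]_(x in `]0%R, +oo[) (x `^ (s - 1) * expR (- x))%:E)%E.

Lemma gammaE_ge0 s : (0 <= gammaE s)%E.
Proof. by apply: integral_ge0 => x _; rewrite lee_fin mulr_ge0 ?powR_ge0 ?expR_ge0. Qed.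

Lemma measurable_expRN : measurable_fun setT (fun x : R => expR (- x)).
Proof. by apply: measurableT_comp. Qed.

Lemma indicE_bool {T : Type} (p : T -> bool) (D : set T) x :
  (D x <-> p x) -> \1_D x = (p x)%:R :> R.
Proof.
rewrite indicE; case: (p x) => -[h1 h2]; first by rewrite mem_set//; exact: h2.
by rewrite memNset// => /h1.
Qed.

(** In place of an integration by parts: x^s is the integral of s u^(s - 1) over 0 < u < x. After
    the exchange of integrals, the inner integral of exp(- x) over x > u is exp(- u). As everything
    is nonnegative, no finiteness is required. *)
Lemma gammaES s : 1 < s -> gammaE (s + 1) = (s%:E * gammaE s)%E.
Proof.
move=> s1; have s0 : 0 < s by exact: lt_trans s1.
pose A := [set q : R * R | 0 < q.2] `&` [set q | q.2 < q.1].
pose f (p : R * R) : \bar R := (\1_A p * (s * p.2 `^ (s - 1) * expR (- p.1)))%:E.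
have AE (x u : R) : \1_A (x, u) = (0 < u < x)%R%:R :> R.
  by apply: (@indicE_bool _ (fun p : R * R => 0 < p.2 < p.1)); split => /= /andP.
have pE (x : R) : \1_(`]0, +oo[) x = (0 < x)%R%:R :> R.
  by apply: (@indicE_bool _ (fun x : R => 0 < x)); rewrite /= in_itv/= andbT.
have mf : measurable_fun setT f.
  apply/measurable_EFinP; apply: measurable_funM.
    by apply: measurable_indic; apply: measurableI; exact: measurable_ltr_set.
  apply: measurable_funM; last by apply: (measurableT_comp measurable_expRN).
  by apply: measurable_funM => //; apply: (measurableT_comp (measurable_powR (s - 1))).
have sp0 (u : R) : 0 <= s * u `^ (s - 1) by rewrite mulr_ge0 ?powR_ge0// ltW.
have f0 p : (0 <= f p)%E.
  by rewrite lee_fin mulr_ge0// mulr_ge0 ?expR_ge0.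
transitivity (\int[leb]_x \int[leb]_u f (x, u))%E.
  rewrite /gammaE -integral_indic_mul; apply: eq_integral => x _.
  rewrite addrK pE; have [x0|x0] := ltP 0 x; last first.
    rewrite mul0r integral0_eq// => u _; rewrite /f AE/=.
    rewrite (_ : (0 < u < x) = false) ?mul0r//.
    by apply/negP => /andP[u0 ux]; have := lt_le_trans (lt_trans u0 ux) x0; rewrite ltxx.
  rewrite mul1r EFinM -(integral_powR s1 x0) -integral_indic_mul muleC -ge0_integralZl//.
  - apply: eq_integral => u _; rewrite /f -EFinM AE/=; congr EFin.
    rewrite [LHS]mulrC [RHS]mulrA; congr (_ * _ * _).
    by apply: (@indicE_bool _ (fun u : R => 0 < u < x)); rewrite /= in_itv.
  - apply/measurable_EFinP; apply: measurable_funM => //.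
    apply: measurable_funM => //; exact: measurable_powR.
  - by move=> u _; rewrite lee_fin mulr_ge0.
rewrite fubini_tonelli// /gammaE -(integral_indic_mul leb `]0%R, +oo[) -ge0_integralZl//; last 3 first.
- apply/measurable_EFinP; apply: measurable_funM => //.
  by apply: measurable_funM; [exact: measurable_powR|exact: measurable_expRN].
- by move=> u _; rewrite lee_fin mulr_ge0// mulr_ge0 ?powR_ge0 ?expR_ge0.
- by rewrite lee_fin ltW.
apply: eq_integral => u _; rewrite pE; have [u0|u0] := ltP 0 u; last first.
  rewrite mul0r mule0 integral0_eq// => x _; rewrite /f AE/=.
  by rewrite [0 < u]ltNge u0 mul0r.
rewrite mul1r -EFinM mulrA EFinM.
rewrite -integral_expR_tail -(integral_indic_mul leb `]u, +oo[) -ge0_integralZl//.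
- apply: eq_integral => x _; rewrite /f -EFinM AE u0/=; congr EFin.
  rewrite mulrCA; congr (_ * (_ * _)).
  by apply/esym; apply: (@indicE_bool _ (fun x : R => u < x)); rewrite /= in_itv/= andbT.
- apply/measurable_EFinP; apply: measurable_funM => //; exact: measurable_expRN.
- by rewrite lee_fin.
Qed.

Lemma Gamma_fine s : Gamma s = fine (gammaE s).
Proof. by []. Qed.

End gamma_recursion.

Section gaussian.
Context {R : realType}.
Local Notation leb := (@lebesgue_measure R).
Local Notation mu d := (@borel_lebesgue R d).

Lemma ge0_integral_affine d (a : R) (v : 'rV[R]_d) (f : 'rV[R]_d -> \bar R) : a != 0 ->
  measurable_fun setT f -> (forall x, 0 <= f x)%E ->
  (\int[mu d]_x f x = (`|a| ^+ d)%:E * \int[mu d]_x f (a *: x + v)%R)%E.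
Proof.
move=> a0 mf f0; have a0' : 0 <= `|a| ^+ d by rewrite exprn_ge0.
pose m := measure_function_pushforward__canonical__measure_function_Measure (mu d) (measurable_affine_rV a v).
transitivity (\int[mscale (NngNum a0') m]_x f x)%E.
  apply: eq_measure_integral => A mA _; exact: borel_lebesgue_affine.
rewrite ge0_integral_mscale//=; congr (_ * _)%E.
by rewrite ge0_integral_pushforward//; exact: measurable_affine_rV.
Qed.

Lemma ge0_integral_translateR (v : R) (f : R -> \bar R) :
  measurable_fun setT f -> (forall x, 0 <= f x)%E ->
  (\int[leb]_x f x = \int[leb]_x f (x + v)%R)%E.
Proof.
move=> mf f0.
pose g (x : measurableTypeR R) : measurableTypeR R := x + v.
have mg : measurable_fun [set: measurableTypeR R] g by exact: measurable_funD.
pose m := measure_function_pushforward__canonical__measure_function_Measure leb mg.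
transitivity (\int[m]_x f x)%E.
  apply: eq_measure_integral => A mA _.
  have h := lebesgue_measure_affine v (oner_neq0 R) mA.
  rewrite normr1 mul1e in h; apply: (etrans h).
  by congr (leb _); apply/seteqP; split => x/=; rewrite mul1r.
by rewrite ge0_integral_pushforward.
Qed.

Lemma integral_gauss_linear (u : R) :
  (\int[leb]_x (expR (- x ^+ 2 + x * u))%:E = (Num.sqrt pi * expR (u ^+ 2 / 4))%:E)%E.
Proof.
rewrite (ge0_integral_translateR (u / 2)); last 2 first.
- by apply/measurable_EFinP; apply: measurableT_comp => //; apply: measurable_funD => //;
    [apply: measurableT_comp => //; apply: measurable_funX|apply: measurable_funM].
- by move=> x; rewrite lee_fin expR_ge0.
rewrite [in RHS]mulrC EFinM -integralT_gauss -ge0_integralZl//; last 2 first.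
- by apply/measurable_EFinP; exact: measurable_gauss_fun.
- by move=> x _; rewrite lee_fin gauss_fun_ge0.
apply: eq_integral => x _; rewrite -EFinM /gauss_fun -expRD; congr (expR _)%:E.
by field.
Qed.

Lemma dotp_rVcons d (a : R) (y : 'rV[R]_d) (t : 'rV[R]_d.+1) :
  dotp (rVcons (a, y)) t = a * t ord0 ord0 + dotp y (rVuncons t).2.
Proof.
rewrite /dotp big_ord_recl rVcons0/=; congr (_ + _).
by apply: eq_bigr => i _; rewrite rVconsS mxE.
Qed.

Lemma dotpS d (t : 'rV[R]_d.+1) :
  dotp t t = t ord0 ord0 ^+ 2 + dotp (rVuncons t).2 (rVuncons t).2.
Proof.
by rewrite /dotp big_ord_recl expr2; congr (_ + _); apply: eq_bigr => i _; rewrite mxE.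
Qed.

Lemma dotp_rVcons2 d (a : R) (y : 'rV[R]_d) :
  dotp (rVcons (a, y)) (rVcons (a, y)) = a ^+ 2 + dotp y y.
Proof. by rewrite dotp_rVcons rVcons0 rVconsK expr2. Qed.

Lemma measurable_dotpxx d : measurable_fun setT (fun x : 'rV[R]_d => dotp x x).
Proof.
by apply: measurable_sum => i; apply: measurable_funM; exact: (measurable_rVcoor i).
Qed.

Lemma measurable_unit_ball d : measurable [set x : 'rV[R]_d | dotp x x < 1].
Proof.
apply: (@measurable_ltr_set R _ 'rV[R]_d (fun x : 'rV[R]_d => dotp x x) (fun=> 1)) => //.
exact: measurable_dotpxx.
Qed.

Lemma integral_gauss_dotp d (t : 'rV[R]_d) :
  (\int[mu d]_x (expR (- dotp x x + dotp x t))%:E =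
   (Num.sqrt pi ^+ d * expR (dotp t t / 4))%:E)%E.
Proof.
have mf n (w : 'rV[R]_n) : measurable_fun setT (fun x => (expR (- dotp x x + dotp x w))%:E).
  apply/measurable_EFinP; apply: measurableT_comp => //; apply: measurable_funD.
    by apply: measurableT_comp => //; exact: measurable_dotpxx.
  exact: measurable_dotp.
elim: d t => [|d IH] t.
  rewrite /= integral_dirac//; last exact: mf.
  by rewrite diracT mul1e /dotp !big_ord0 mul0r expr0 mul1r oppr0 addr0.
rewrite ge0_integral_borel_lebesgueS; last 2 first.
- exact: mf.
- by move=> x; rewrite lee_fin expR_ge0.
transitivity (\int[leb]_x ((expR (- x ^+ 2 + x * t ord0 ord0))%:E *
    (Num.sqrt pi ^+ d * expR (dotp (rVuncons t).2 (rVuncons t).2 / 4))%:E))%E.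
  apply: eq_integral => x _; rewrite -IH -ge0_integralZl//.
  - apply: eq_integral => y _; rewrite -EFinM -expRD dotp_rVcons2 dotp_rVcons.
    by congr (expR _)%:E; rewrite opprD addrACA.
  - exact: mf.
rewrite ge0_integralZr//; last first.
- apply/measurable_EFinP; apply: measurableT_comp => //; apply: measurable_funD => //.
    by apply: measurableT_comp => //; apply: measurable_funX.
  by apply: measurable_funM.
rewrite integral_gauss_linear -EFinM dotpS [in RHS]mulrDl expRD.
by rewrite mulrACA -exprS.
Qed.

(* Write [expR (- |x|^2)] as the integral of [expR (- s)] over [s > |x|^2], exchange the
   integrals and rescale the ball of radius [sqrt s]. *)
Lemma layer_cake_gauss d (m : nat) (p : 'rV[R]_d -> R) : measurable_fun setT p ->
  (forall x, 0 <= p x) -> (forall r x, 0 < r -> p (r *: x) = r ^+ m * p x) ->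
  (\int[mu d]_x (expR (- dotp x x) * p x)%:E =
   gammaE ((m + d)%:R / 2 + 1) * \int[mu d]_x (\1_[set x | dotp x x < 1] x * p x)%:E)%E.
Proof.
move=> mp p0 ph; set I := (X in (_ = _ * X)%E).
pose A := [set q : 'rV[R]_d * R | dotp q.1 q.1 < q.2].
pose f (q : 'rV[R]_d * R) : \bar R := (\1_A q * (expR (- q.2) * p q.1))%:E.
have AE x s : \1_A (x, s) = (dotp x x < s)%R%:R :> R.
  by apply: (@indicE_bool _ _ (fun q : 'rV[R]_d * R => dotp q.1 q.1 < q.2)).
have mf : measurable_fun setT f.
  apply/measurable_EFinP; apply: measurable_funM.
    apply: measurable_indic; apply: measurable_ltr_set => //.
    by apply: (measurableT_comp (@measurable_dotpxx d)).
  by apply: measurable_funM; [apply: (measurableT_comp measurable_expRN)|apply: (measurableT_comp mp)].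
have f0 q : (0 <= f q)%E by rewrite lee_fin mulr_ge0// mulr_ge0 ?expR_ge0.
transitivity (\int[mu d]_x \int[leb]_s f (x, s))%E.
  apply: eq_integral => x _.
  rewrite EFinM -integral_expR_tail -(integral_indic_mul leb `]dotp x x, +oo[) muleC -ge0_integralZl//.
  - apply: eq_integral => s _; rewrite /f -EFinM AE/=; congr EFin.
    rewrite mulrC -mulrA; congr (_ * (_ * _)).
    by apply: (@indicE_bool _ _ (fun s : R => dotp x x < s)); rewrite /= in_itv/= andbT.
  - by apply/measurable_EFinP; apply: measurable_funM => //; exact: measurable_expRN.
  - by rewrite lee_fin.
rewrite fubini_tonelli// /gammaE -(integral_indic_mul leb `]0%R, +oo[) -ge0_integralZr//; last 3 first.
- apply/measurable_EFinP; apply: measurable_funM => //.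
  by apply: measurable_funM; [exact: measurable_powR|exact: measurable_expRN].
- by move=> u _; rewrite lee_fin mulr_ge0// mulr_ge0 ?powR_ge0 ?expR_ge0.
- by apply: integral_ge0 => x _; rewrite lee_fin mulr_ge0.
have pE (x : R) : \1_(`]0, +oo[) x = (0 < x)%R%:R :> R.
  by apply: (@indicE_bool _ _ (fun x : R => 0 < x)); rewrite /= in_itv/= andbT.
apply: eq_integral => s _; rewrite pE addrK; have [s0|s0] := ltP 0 s; last first.
  rewrite mul0r mul0e integral0_eq// => x _; rewrite /f AE/=.
  rewrite (_ : (_ < s) = false) ?mul0r//; apply/negbTE; rewrite -leNgt (le_trans s0)//.
  by apply: sumr_ge0 => i _; rewrite -expr2 sqr_ge0.
have r0 : 0 < Num.sqrt s by rewrite sqrtr_gt0.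
(* The dilation by sqrt s yields s^(d/2) from the Jacobian and s^(m/2) from the homogeneity of [p]:
   together, the power of s in the integral of [gammaE]. *)
rewrite (@ge0_integral_affine d (Num.sqrt s) 0)//; last 2 first.
- by rewrite gt_eqF.
- by apply: measurableT_comp mf _; exact: measurable_fun_pair.
rewrite mul1r /I -ge0_integralZl//; last first.
- apply: (measurableT_comp mf); apply: measurable_fun_pair => //.
  exact: measurable_affine_rV.
rewrite -ge0_integralZl//; last 3 first.
- apply/measurable_EFinP; apply: measurable_funM => //.
  by apply: measurable_indic; exact: measurable_unit_ball.
- by move=> x _; rewrite lee_fin mulr_ge0.
- by rewrite lee_fin mulr_ge0 ?powR_ge0 ?expR_ge0.
apply: eq_integral => x _; rewrite /f AE/= addr0 -!EFinM; congr EFin.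
rewrite ph// dotpZl dotpC dotpZl mulrA -expr2 sqr_sqrtr ?(ltW s0)//.
rewrite (@indicE_bool _ _ (fun x : 'rV[R]_d => dotp x x < 1))//.
rewrite -[X in _ < X]mulr1 ltr_pM2l// gtr0_norm//.
rewrite mulrC -powR12_sqrt ?ltW// -powR_mulrn ?powR_ge0// -powR_mulrn ?powR_ge0//.
rewrite -!powRrM natrD mulrDl powRD; last by rewrite (gt_eqF s0) implybT.
rewrite ![2^-1 * _]mulrC.
by set a := _ `^ _; set b := _ `^ _; ring.
Qed.

End gaussian.

(** * Uniqueness of the coefficients of a power series *)

Section power_series_uniqueness.
Context {R : realType}.

(** The odd terms cancel in the mean of the exponential series at y and - y, so the n-th partial sum
    is the mean of their partial sums of length 2n. *)
Lemma cosh_series (y : R) :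
  series (fun k => y ^+ k.*2 / k.*2`!%:R) @ \oo --> (expR y + expR (- y)) / 2.
Proof.
have c z : series (exp_coeff z) n @[n --> \oo] --> expR (z : R).
  by rewrite /expR; exact: is_cvg_series_exp_coeff.
have h : (series (exp_coeff y) n + series (exp_coeff (- y)) n) / 2 @[n --> \oo]
    --> (expR y + expR (- y)) / 2.
  by apply: cvgM; [apply: cvgD; exact: c|exact: cvg_cst].
have d2 : (n.*2)%N @[n --> \oo] --> \oo%classic.
  move=> A [N _ NA]; exists N => // n /= Nn; apply: NA => /=.
  by rewrite -addnn (leq_trans Nn)// leq_addr.
have := @cvg_comp _ _ _ double
  (fun n => (series (exp_coeff y) n + series (exp_coeff (- y)) n) / 2) _ _ _ d2 h; apply: cvg_trans.
apply: near_eq_cvg; apply: nearW => n /=.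
elim: n => [|n IH]; first by rewrite /series/= !big_geq// addr0 mul0r.
have e0 : exp_coeff (- y) n.*2 = exp_coeff y n.*2.
  by rewrite /exp_coeff/= exprNn -signr_odd odd_double expr0 mul1r.
have e1 : exp_coeff (- y) n.*2.+1 = - exp_coeff y n.*2.+1.
  by rewrite /exp_coeff/= exprNn -signr_odd/= odd_double/= expr1 mulN1r mulNr.
have e2 : y ^+ n.*2 / n.*2`!%:R = exp_coeff y n.*2 by [].
rewrite doubleS (seriesS _ n.*2.+1) (seriesS _ n.*2) (seriesS (exp_coeff (- y)) n.*2.+1).
rewrite (seriesS (exp_coeff (- y)) n.*2) (seriesS _ n) -IH e2 e0 e1.
move: (series _ _) (series _ _) (exp_coeff _ _) (exp_coeff _ _) => S1 S2 u v.
by field.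
Qed.

(** If the earlier coefficients vanish, the sum being 0 gives |c n| s^n <= s^(n + 1) C, where [C] is
    the sum of all |c k|. Dividing by s^n and letting s tend to 0 yields c n = 0. *)
Lemma pseries_eq0 (c : nat -> R) : cvgn (series (fun k => `|c k|)) ->
  (forall s, 0 < s <= 1 -> series (fun k => c k * s ^+ k) @ \oo --> 0) ->
  forall n, c n = 0.
Proof.
move=> cc h.
pose C := limn (series (fun k => `|c k|)).
have leC n : \sum_(0 <= k < n) `|c k| <= C.
  apply: (@nondecreasing_cvgn_le _ (series (fun k => `|c k|))) => //.
  by apply/nondecreasing_seqP => k; rewrite /= seriesS lerDr.
elim/ltn_ind => n IH.
have key s : 0 < s <= 1 -> `|c n| <= s * C.
  move=> /andP[s0 s1].
  have B N : (n < N)%N -> `|c n| * s ^+ n <= `|series (fun k => c k * s ^+ k) N| + s ^+ n.+1 * C.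
    move=> nN.
    have E : series (fun k => c k * s ^+ k) N = c n * s ^+ n + \sum_(n.+1 <= k < N) c k * s ^+ k.
      rewrite /series/= (big_cat_nat (leq0n n.+1) nN)//= big_nat_recr//= [X in X + _ + _]big_nat big1.
        by rewrite add0r.
      by move=> i /IH ->; rewrite mul0r.
    have T : `|\sum_(n.+1 <= k < N) c k * s ^+ k| <= s ^+ n.+1 * C.
      apply: (le_trans (ler_norm_sum _ _ _)).
      apply: (@le_trans _ _ (s ^+ n.+1 * \sum_(n.+1 <= k < N) `|c k|)).
        rewrite mulr_sumr big_nat [leRHS]big_nat; apply: ler_sum => k /andP[nk _].
        rewrite normrM normrX (gtr0_norm s0) mulrC ler_wpM2r//.
        by rewrite ler_wiXn2l// ltW.
      rewrite ler_wpM2l ?exprn_ge0 ?(ltW s0)//; apply: le_trans (leC N).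
      by rewrite [leRHS](big_cat_nat (leq0n n.+1) nN)//= lerDr sumr_ge0.
    rewrite -{1}[s ^+ n]gtr0_norm ?exprn_gt0// -normrM.
    rewrite (_ : c n * s ^+ n = series (fun k => c k * s ^+ k) N
      - \sum_(n.+1 <= k < N) c k * s ^+ k); last by rewrite E addrK.
    by rewrite (le_trans (ler_normB _ _))// lerD2l.
  have L : `|c n| * s ^+ n <= 0 + s ^+ n.+1 * C.
    have l : `|series (fun k => c k * s ^+ k) N| + s ^+ n.+1 * C @[N --> \oo]
        --> 0 + s ^+ n.+1 * C.
      apply: cvgD; last exact: cvg_cst.
      rewrite -[X in _ --> X](normr0 R); apply: cvg_norm; apply: h.
      by rewrite s0.
    apply: ler_cvg_to (cvg_cst _) l _.
    by exists n.+1 => // N /= nN; exact: B.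
  rewrite add0r exprS mulrAC in L.
  by move: L; rewrite ler_pM2r ?exprn_gt0.
apply/eqP; rewrite -normr_le0; apply/ler_addgt0Pr => e e0; rewrite add0r.
have C0 : 0 <= C by have := leC 0%N; rewrite big_geq.
have C1 : 0 < C + 1 by rewrite ltr_wpDl.
pose s := Num.min 1 (e / (C + 1)).
have s0 : 0 < s by rewrite lt_min ltr01 divr_gt0.
apply: (le_trans (key s _)); first by rewrite s0 ge_min lexx.
apply: (@le_trans _ _ (e / (C + 1) * C)).
  by rewrite ler_wpM2r// ge_min lexx orbT.
by rewrite mulrAC ler_pdivrMr// ler_wpM2l ?(ltW e0)// lerDl.
Qed.

(** Nonnegativity turns convergence at s = 1 into the absolute convergence that [pseries_eq0]
    requires of the difference. *)
Lemma pseries_inj (a b : nat -> R) (L : R -> R) :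
  (forall k, 0 <= a k) -> (forall k, 0 <= b k) ->
  (forall s, 0 < s <= 1 -> series (fun k => a k * s ^+ k) @ \oo --> L s) ->
  (forall s, 0 < s <= 1 -> series (fun k => b k * s ^+ k) @ \oo --> L s) ->
  forall n, a n = b n.
Proof.
move=> a0 b0 ha hb n; apply/eqP; rewrite -subr_eq0; apply/eqP.
apply: (@pseries_eq0 (fun k => a k - b k)) => [|s s01].
- have i1 : 0 < (1 : R) <= 1 by apply/andP; split.
  have c : series (fun k => a k * 1 ^+ k) n + series (fun k => b k * 1 ^+ k) n @[n --> \oo]
      --> L 1 + L 1 by apply: cvgD; [exact: ha|exact: hb].
  apply: nondecreasing_is_cvgn.
    by apply/nondecreasing_seqP => k; rewrite /= seriesS lerDr.
  exists (L 1 + L 1) => _ [N _ <-].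
  apply: (@le_trans _ _ (series (fun k => a k * 1 ^+ k) N + series (fun k => b k * 1 ^+ k) N)).
    rewrite /series/= -big_split/=; apply: ler_sum => k _.
    rewrite !expr1n !mulr1 (le_trans (ler_normB _ _))//.
    by rewrite !ger0_norm.
  rewrite -(cvg_lim _ c)//; apply: (@nondecreasing_cvgn_le _
    (fun n => series (fun k => a k * 1 ^+ k) n + series (fun k => b k * 1 ^+ k) n)).
    apply/nondecreasing_seqP => k; rewrite /= !seriesS addrACA lerDr.
    by rewrite !expr1n !mulr1 addr_ge0.
  exact: cvgP c.
- have : series (fun k => a k * s ^+ k) n - series (fun k => b k * s ^+ k) n @[n --> \oo]
      --> L s - L s by apply: cvgB; [exact: ha|exact: hb].
  rewrite subrr; apply: cvg_trans.
  apply: near_eq_cvg; apply: nearW => N /=.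
  by rewrite /series/= -sumrB; apply: eq_bigr => k _; rewrite mulrBl.
Qed.

Lemma expR_pseries (A u s : R) :
  series (fun k => A * u ^+ k / k`!%:R * s ^+ k) @ \oo --> A * expR (s * u).
Proof.
have : A * series (exp_coeff (s * u)) n @[n --> \oo] --> A * expR (s * u).
  apply: cvgM; first exact: cvg_cst.
  by rewrite /expR; exact: is_cvg_series_exp_coeff.
apply: cvg_trans; apply: near_eq_cvg; apply: nearW => N /=.
rewrite /series/= mulr_sumr; apply: eq_bigr => k _; rewrite /exp_coeff/= exprMn.
by ring.
Qed.

End power_series_uniqueness.

(** * Gaussian moments *)

Section gaussian_moments.
Context {R : realType}.
Local Notation mu d := (@borel_lebesgue R d).

Lemma nneseries_cvg (u : nat -> R) (L : R) : series u @ \oo --> L ->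
  (\sum_(0 <= k <oo) (u k)%:E)%E = L%:E.
Proof.
move=> c; apply/cvg_lim => //.
have : (series u n)%:E @[n --> \oo] --> L%:E by apply: cvg_EFin => //; exact: nearW.
apply: cvg_trans; apply: near_eq_cvg; apply: nearW => n.
by rewrite /series/= sumEFin.
Qed.

Lemma cvg_nneseries (u : nat -> R) (L : R) : (forall k, 0 <= u k) ->
  (\sum_(0 <= k <oo) (u k)%:E)%E = L%:E -> series u @ \oo --> L.
Proof.
move=> u0 uL.
have : (\sum_(0 <= k < n) (u k)%:E)%E @[n --> \oo] --> L%:E.
  by rewrite -uL; apply: is_cvg_nneseries => k _ _; rewrite lee_fin.
move/fine_cvg; apply: cvg_trans; apply: near_eq_cvg; apply: nearW => n /=.
by rewrite sumEFin.
Qed.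

Lemma integral_gauss_cosh d (t : 'rV[R]_d) :
  (\int[mu d]_x (expR (- dotp x x) * ((expR (dotp x t) + expR (- dotp x t)) / 2))%:E =
   (Num.sqrt pi ^+ d * expR (dotp t t / 4))%:E)%E.
Proof.
have mf (w : 'rV[R]_d) : measurable_fun setT (fun x => (expR (- dotp x x + dotp x w))%:E).
  apply/measurable_EFinP; apply: measurableT_comp => //; apply: measurable_funD.
    by apply: measurableT_comp => //; exact: measurable_dotpxx.
  exact: measurable_dotp.
transitivity (2^-1%:E * (\int[mu d]_x ((expR (- dotp x x + dotp x t))%:E +
    (expR (- dotp x x + dotp x (- t)))%:E)))%E.
  rewrite -ge0_integralZl//; last 2 first.
  - exact: emeasurable_funD.
  - by move=> x _; rewrite adde_ge0// lee_fin expR_ge0.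
  apply: eq_integral => x _; rewrite -EFinD -EFinM !expRD; congr EFin.
  by rewrite [dotp x (- t)]dotpC dotpNl [dotp t x]dotpC; ring.
rewrite ge0_integralD//.
rewrite !integral_gauss_dotp dotpNl dotpC dotpNl opprK -EFinD -EFinM; congr EFin.
by field.
Qed.

Lemma measurable_gauss_moment d (t : 'rV[R]_d) k :
  measurable_fun setT (fun x => (expR (- dotp x x) * dotp x t ^+ k)%:E).
Proof.
apply/measurable_EFinP; apply: measurable_funM.
  apply: measurableT_comp => //; apply: measurableT_comp => //; exact: measurable_dotpxx.
by apply: measurable_funX; exact: measurable_dotp.
Qed.

Lemma sqr_even_ge0 (y : R) k : 0 <= y ^+ k.*2.
Proof. by rewrite -muln2 exprM sqr_ge0. Qed.

(* Both sides are the coefficients of the power series in [s = r^2] of the integral of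
   [expR (- |x|^2) * cosh (r * (x . t))]. *)
Lemma gauss_moment d (t : 'rV[R]_d) k :
  (\int[mu d]_x (expR (- dotp x x) * dotp x t ^+ k.*2)%:E =
   (Num.sqrt pi ^+ d * k.*2`!%:R * dotp t t ^+ k / (4 ^+ k * k`!%:R))%:E)%E.
Proof.
pose M k := (\int[mu d]_x (expR (- dotp x x) * dotp x t ^+ k.*2)%:E)%E.
have M0 j : (0 <= M j)%E.
  by apply: integral_ge0 => x _; rewrite lee_fin mulr_ge0 ?expR_ge0// sqr_even_ge0.
have S s : 0 < s -> (\sum_(0 <= j <oo) ((s ^+ j / j.*2`!%:R)%:E * M j))%E =
    (Num.sqrt pi ^+ d * expR (s * (dotp t t / 4)))%:E.
  move=> s0; pose r := Num.sqrt s.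
  have := integral_gauss_cosh (r *: t).
  rewrite dotpZl dotpC dotpZl mulrA -expr2 sqr_sqrtr ?(ltW s0)// -mulrA => <-.
  transitivity (\sum_(0 <= j <oo) (\int[mu d]_x (expR (- dotp x x) *
      (dotp x (r *: t) ^+ j.*2 / j.*2`!%:R))%:E))%E.
    apply: eq_eseriesr => j _; rewrite -ge0_integralZl//; last 3 first.
    - exact: measurable_gauss_moment.
    - by move=> x _; rewrite lee_fin mulr_ge0 ?expR_ge0// sqr_even_ge0.
    - by rewrite lee_fin divr_ge0// exprn_ge0// ltW.
    apply: eq_integral => x _; rewrite -EFinM; congr EFin.
    rewrite [dotp x (_ *: _)]dotpC dotpZl [dotp t x]dotpC exprMn.
    have -> : r ^+ j.*2 = s ^+ j by rewrite -mul2n exprM sqr_sqrtr ?ltW.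
    by rewrite [dotp x t]dotpC; move: (_ ^+ _) (_ ^+ _) (_%:R^-1) => u v w; ring.
  rewrite -integral_nneseries//; last 2 first.
  - move=> j; have := measurable_gauss_moment (r *: t) j.*2.
    move=> /measurable_EFinP h; apply/measurable_EFinP.
    rewrite (_ : (fun _ => _) = (fun x => expR (- dotp x x) * dotp x (r *: t) ^+ j.*2 / j.*2`!%:R)).
      exact: measurable_funM.
    by apply/funext => x; rewrite mulrA.
  - by move=> j x _; rewrite lee_fin mulr_ge0 ?expR_ge0// divr_ge0// sqr_even_ge0.
  apply: eq_integral => x _; rewrite EFinM -(nneseries_cvg (@cosh_series R (dotp x (r *: t)))).
  rewrite -nneseriesZl ?lee_fin ?expR_ge0//.
  by move=> j _; rewrite lee_fin divr_ge0// sqr_even_ge0.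
(* The moments are not assumed finite: at s = 1 each of them, up to a positive factor, is a term of
   a nonnegative series with finite sum. *)
have Mfin j : M j \is a fin_num.
  rewrite ge0_fin_numE//.
  have h : (((1 ^+ j / j.*2`!%:R)%:E * M j) <= (Num.sqrt pi ^+ d * expR (1 * (dotp t t / 4)))%:E)%E.
    rewrite -S//; apply: le_trans (nneseries_lim_ge j.+1 _).
      rewrite big_nat_recr//= leeDr// sume_ge0// => i _.
      by rewrite mule_ge0// lee_fin divr_ge0// exprn_ge0.
    by move=> i _; rewrite mule_ge0// lee_fin divr_ge0// exprn_ge0.
  rewrite ltNge leye_eq; apply/negP => /eqP Moo; move: h; rewrite Moo gt0_muley ?leye_eq//.
rewrite -[LHS]/(M k).
have -> : M k = (fine (M k) / k.*2`!%:R * k.*2`!%:R)%:E.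
  rewrite divfK ?fineK//; by rewrite pnatr_eq0 -lt0n fact_gt0.
have := @pseries_inj R (fun j => fine (M j) / j.*2`!%:R)
  (fun j => Num.sqrt pi ^+ d * (dotp t t / 4) ^+ j / j`!%:R)
  (fun s => Num.sqrt pi ^+ d * expR (s * (dotp t t / 4))).
have dt0 : 0 <= dotp t t by apply: sumr_ge0 => i _; rewrite -expr2 sqr_ge0.
move=> -> //.
- congr EFin; rewrite expr_div_n invfM; ring.
- by move=> j; rewrite divr_ge0// fine_ge0.
- by move=> j; rewrite divr_ge0// mulr_ge0 ?exprn_ge0 ?sqrtr_ge0// divr_ge0.
- move=> s /andP[s0 _]; apply: cvg_nneseries.
    by move=> j; apply: mulr_ge0; [rewrite divr_ge0// fine_ge0|rewrite exprn_ge0// ltW].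
  rewrite -S//; apply: eq_eseriesr => j _.
  by rewrite -[M j]fineK// -EFinM; congr EFin; ring.
- by move=> s _; exact: expR_pseries.
Qed.

End gaussian_moments.

(** * The Fourier transform of a ball *)

Section ball_transform.
Context {R : realType} {d : nat}.
Hypothesis d0 : (0 < d)%N.
Local Notation mu := (@borel_lebesgue R d).
Local Notation nu := (d%:R / 2 : R).

Let V : R := Num.sqrt pi ^+ d.

Let V0 : 0 < V.
Proof. by rewrite exprn_gt0// sqrtr_gt0 pi_gt0. Qed.

(** The same Gaussian moment evaluated twice, by [gauss_moment] and by [layer_cake_gauss] with the
    function (x . t)^(2k), homogeneous of degree 2k. This determines the moments of the ball once
    Gamma is known to be finite and positive. *)
Lemma unit_ball_moment (t : 'rV[R]_d) k :
  (gammaE (k%:R + nu + 1) *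
   \int[mu]_x (\1_[set x | dotp x x < 1] x * dotp x t ^+ k.*2)%:E)%E =
  (V * k.*2`!%:R * dotp t t ^+ k / (4 ^+ k * k`!%:R))%:E.
Proof.
rewrite -gauss_moment (@layer_cake_gauss _ _ k.*2 (fun x => dotp x t ^+ k.*2)).
- rewrite (_ : (k.*2 + d)%:R / 2 = k%:R + nu)//.
  by rewrite natrD mulrDl -mul2n natrM [2 * _]mulrC mulfK.
- by apply: measurable_funX; exact: measurable_dotp.
- by move=> x; exact: sqr_even_ge0.
- by move=> r x _; rewrite dotpZl exprMn.
Qed.

(** The product of [gammaE (nu + 1)] and the measure of the unit ball is V, finite and positive. As
    0 times infinity is 0, neither factor can be 0, and an infinite first factor would make the
    product infinite. *)
Lemma gammaE_half : exists2 g : R, 0 < g & gammaE (nu + 1) = g%:E.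
Proof.
have := unit_ball_moment 0 0; rewrite add0r !expr0 !mulr1 invr1 mulr1.
set I := (\int[mu]_x _)%E => h.
have I0 : (0 <= I)%E by apply: integral_ge0 => x _; rewrite lee_fin mulr1.
move: (gammaE_ge0 (nu + 1)) h; case: (gammaE _) => [g||]//.
- rewrite lee_fin le_eqVlt => /predU1P[<-|g0 _]; last by exists g.
  by rewrite mul0e => -[] /esym V0'; move: V0; rewrite V0' ltxx.
- move=> _; move: I0; rewrite le_eqVlt => /predU1P[<-|I0].
    by rewrite mule0 => -[] /esym V0'; move: V0; rewrite V0' ltxx.
  by rewrite gt0_mulye.
Qed.

Lemma arg_gt1 k : 1 < k%:R + nu + 1 :> R.
Proof. by rewrite ltrDr ltr_wpDl// divr_gt0// ltr0n. Qed.

Lemma gammaE_Gamma k : 0 < Gamma (k%:R + nu + 1 : R) /\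
  gammaE (k%:R + nu + 1) = (Gamma (k%:R + nu + 1 : R))%:E.
Proof.
elim: k => [|k [IH1 IH2]].
  by have [g g0 gE] := gammaE_half; rewrite add0r Gamma_fine gE.
have E : k.+1%:R + nu + 1 = (k%:R + nu + 1) + 1 :> R by rewrite -natr1; ring.
rewrite Gamma_fine E gammaES ?arg_gt1// IH2 -EFinM/=; split => //.
by rewrite mulr_gt0// (lt_trans _ (arg_gt1 k)).
Qed.

Lemma GammaS k : Gamma (k.+1%:R + nu + 1 : R) = (k%:R + nu + 1) * Gamma (k%:R + nu + 1 : R).
Proof.
have E : k.+1%:R + nu + 1 = (k%:R + nu + 1) + 1 :> R by rewrite -natr1; ring.
by rewrite E Gamma_fine gammaES ?arg_gt1// (gammaE_Gamma k).2.
Qed.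

Variable alpha : R.
Hypothesis alpha0 : 0 < alpha.

Definition borel_ball : set 'rV[R]_d := [set x | dotp x x < alpha ^+ 2].

Lemma measurable_borel_ball : measurable borel_ball.
Proof.
apply: (@measurable_ltr_set R _ 'rV[R]_d (fun x => dotp x x) (fun=> alpha ^+ 2)) => //.
exact: measurable_dotpxx.
Qed.

Lemma indic_borel_ball x : \1_borel_ball x = (dotp x x < alpha ^+ 2)%R%:R :> R.
Proof. exact: (@indicE_bool _ _ (fun x => dotp x x < alpha ^+ 2)). Qed.

Definition ball_moment (t : 'rV[R]_d) k : R := alpha ^+ (d + k.*2) *
  (V * k.*2`!%:R * dotp t t ^+ k / (4 ^+ k * k`!%:R) / Gamma (k%:R + nu + 1)).

Lemma integral_ball_moment (t : 'rV[R]_d) k :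
  (\int[mu]_x (\1_borel_ball x * dotp x t ^+ k.*2)%:E)%E = (ball_moment t k)%:E.
Proof.
have [G0 GE] := gammaE_Gamma k.
have mb : measurable_fun setT (\1_borel_ball : 'rV[R]_d -> R).
  by apply: measurable_indic; exact: measurable_borel_ball.
rewrite (ge0_integral_affine 0 (lt0r_neq0 alpha0)); last 2 first.
- apply/measurable_EFinP; apply: measurable_funM => //.
  by apply: measurable_funX; exact: measurable_dotp.
- by move=> x; rewrite lee_fin mulr_ge0// sqr_even_ge0.
have := unit_ball_moment t k; rewrite GE.
set I := (\int[mu]_x _)%E => /esym h.
transitivity ((alpha ^+ d)%:E * ((alpha ^+ k.*2)%:E * I))%E.
  rewrite gtr0_norm//; congr (_ * _)%E; rewrite /I -ge0_integralZl//; last 3 first.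
  - apply/measurable_EFinP; apply: measurable_funM => //.
      by apply: measurable_indic; exact: measurable_unit_ball.
    by apply: measurable_funX; exact: measurable_dotp.
  - by move=> x _; rewrite lee_fin mulr_ge0// sqr_even_ge0.
  - by rewrite lee_fin exprn_ge0// ltW.
  apply: eq_integral => x _; rewrite -EFinM addr0 indic_borel_ball; congr EFin.
  rewrite !dotpZl dotpC dotpZl (@indicE_bool _ _ (fun x : 'rV[R]_d => dotp x x < 1))//.
  rewrite mulrA -expr2 -[X in _ < X]mulr1 ltr_pM2l ?exprn_gt0//.
  by rewrite exprMn mulrCA.
rewrite /ball_moment muleA -EFinM -exprD [RHS]EFinM.
congr (_ * _)%E; rewrite mulrC EFinM h muleA -EFinM mulVf ?mul1e// gt_eqF//.
Qed.

(** The Taylor coefficients of Psi: the coefficient (-1)^k (2 pi)^(2k) / (2k)! of the cosine times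
    [ball_moment], without its factor |t|^(2k). Here [V] is pi^(d/2). *)
Definition ball_psi k : R := (-1) ^+ k * V * pi ^+ k.*2 * alpha ^+ (d + k.*2) /
  (k`!%:R * Gamma (k%:R + nu + 1)).

Lemma ball_psi0 : 0 < ball_psi 0.
Proof.
rewrite /ball_psi !expr0 mul1r mulr1 divr_gt0// mulr_gt0//.
  by rewrite exprn_gt0.
by have [] := gammaE_Gamma 0.
Qed.

(** The recursion of a Bessel-type series, with b = nu + 1 and c = (pi alpha)^2. It expresses
    Gamma(z + 1) = z Gamma(z) at z = k + nu + 1. *)
Lemma ball_psiS k : k.+1%:R * (k%:R + (nu + 1)) * ball_psi k.+1 =
  - (pi * alpha) ^+ 2 * ball_psi k.
Proof.
rewrite /ball_psi GammaS (exprS (-1)) doubleS !addnS !(exprS pi) !(exprS alpha) factS natrM.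
have [G0 _] := gammaE_Gamma k.
have a0 : k%:R + nu + 1 != 0 :> R by rewrite gt_eqF// (lt_trans _ (arg_gt1 k)).
have f0 : k`!%:R != 0 :> R by rewrite pnatr_eq0 -lt0n fact_gt0.
have k0 : k.+1%:R != 0 :> R by rewrite pnatr_eq0.
have key (K F A G p q s v a : R) : K != 0 -> F != 0 -> A != 0 -> G != 0 ->
    K * A * (-1 * s * v * (p * (p * q)) * (alpha * (alpha * a)) / (K * F * (A * G))) =
    - (p * alpha) ^+ 2 * (s * v * q * a / (F * G)).
  by move=> K0 F0 A0 G1; field; rewrite K0 F0 A0 G1.
by rewrite addrA; apply: key => //; rewrite gt_eqF.
Qed.

Definition ball_indicator x : R[i] := (\1_borel_ball x : R)%:C%C.

Lemma ball_indicator_integrable : cintegrable mu ball_indicator.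
Proof.
apply/cintegrableP; split.
  by apply: cmeasurable_real; apply: measurable_indic; exact: measurable_borel_ball.
rewrite /cnorm1 (_ : (fun _ => _) = (fun x => (\1_borel_ball x * dotp x 0 ^+ 0.*2)%:E)).
  by rewrite integral_ball_moment ltry.
by apply/funext => x; rewrite cmod_real ger0_norm// double0 expr0 mulr1.
Qed.

Lemma ball_moment_integrable t k :
  mu.-integrable setT (fun x => (\1_borel_ball x * dotp x t ^+ k.*2)%:E).
Proof.
apply/integrableP; split.
  apply/measurable_EFinP; apply: measurable_funM.
    by apply: measurable_indic; exact: measurable_borel_ball.
  by apply: measurable_funX; exact: measurable_dotp.
under eq_integral do rewrite gee0_abs ?lee_fin ?mulr_ge0 ?sqr_even_ge0//.
by rewrite integral_ball_moment ltry.
Qed.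

Lemma Rintegral_ball_cos_partial t n :
  mu.-integrable setT (fun x => (\1_borel_ball x * series (cos_coeff' (2 * pi * dotp x t)) n)%:E)
  /\ \int[mu]_x (\1_borel_ball x * series (cos_coeff' (2 * pi * dotp x t)) n) =
  series (fun k => ball_psi k * dotp t t ^+ k) n.
Proof.
elim: n => [|n [IHi IH]].
  rewrite /series/= big_geq//; split.
    by under eq_fun do rewrite big_geq// mulr0; exact: integrable0.
  by under eq_Rintegral do rewrite big_geq// mulr0; rewrite Rintegral_cst// mul0r.
pose c : R := (-1) ^+ n * (2 * pi) ^+ n.*2 / n.*2`!%:R.
have E x : \1_borel_ball x * series (cos_coeff' (2 * pi * dotp x t)) n.+1 =
    \1_borel_ball x * series (cos_coeff' (2 * pi * dotp x t)) n +
    c * (\1_borel_ball x * dotp x t ^+ n.*2).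
  rewrite seriesSr mulrDr; congr (_ + _); rewrite /cos_coeff'/c exprMn.
  by rewrite -exprnP; move: (_ ^+ n) (dotp x t ^+ _) ((2 * pi) ^+ _) => *; ring.
have ic : mu.-integrable setT (fun x => (c * (\1_borel_ball x * dotp x t ^+ n.*2))%:E).
  by under eq_fun do rewrite EFinM; apply: integrableZl => //; exact: ball_moment_integrable.
split.
  by under eq_fun do rewrite E EFinD; exact: integrableD.
under eq_Rintegral do rewrite E.
rewrite RintegralD// IH seriesSr RintegralZl//; last exact: ball_moment_integrable.
congr (_ + _); rewrite /Rintegral integral_ball_moment/= /ball_moment /ball_psi /c.
have [G0 _] := gammaE_Gamma n.
have f0 : n`!%:R != 0 :> R by rewrite pnatr_eq0 -lt0n fact_gt0.
have f20 : n.*2`!%:R != 0 :> R by rewrite pnatr_eq0 -lt0n fact_gt0.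
have -> : (2 * pi) ^+ n.*2 = 4 ^+ n * pi ^+ n.*2 :> R.
  by rewrite exprMn -mul2n [2 ^+ _]exprM; congr (_ ^+ _ * _); ring.
have p4 : (4 : R) ^+ n != 0 by rewrite expf_neq0.
have key (F F2 G p q s v a : R) : F != 0 -> F2 != 0 -> p != 0 -> G != 0 ->
    s * (p * q) / F2 * (a * (v * F2 * (dotp t t ^+ n) / (p * F) / G)) =
    s * v * q * a / (F * G) * dotp t t ^+ n.
  by move=> F0 F20 p0 G1; field; rewrite F0 F20 p0 G1.
by apply: key => //; rewrite gt_eqF.
Qed.

Lemma reflect_integral (f : 'rV[R]_d -> R) : measurable_fun setT f ->
  \int[mu]_x f (- x) = \int[mu]_x f x.
Proof.
move=> mf; have H (g : 'rV[R]_d -> \bar R) : measurable_fun setT g -> (forall x, 0 <= g x)%E ->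
    (\int[mu]_x g (- x)%R = \int[mu]_x g x)%E.
  move=> mg g0; rewrite [RHS](@ge0_integral_affine _ d (-1) 0)// ?oppr_eq0 ?oner_neq0//.
  rewrite normrN1 expr1n mul1e; apply: eq_integral => x _.
  by rewrite addr0 scaleN1r.
have mE : measurable_fun setT (fun x => (f x)%:E) by exact/measurable_EFinP.
rewrite /Rintegral; congr fine; rewrite integralE [RHS]integralE; congr (_ - _)%E.
- rewrite -(H _ (measurable_funepos mE))//.
  by apply: eq_integral => x _; rewrite !funeposE.
- rewrite -(H _ (measurable_funeneg mE))//.
  by apply: eq_integral => x _; rewrite !funenegE.
Qed.

(** The real part integrates the Taylor series of the cosine over the ball, term by term. The
    imaginary part is the integral of an odd function, because the ball is symmetric. *)
Lemma borel_fourier_ball t :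
  series (fun k => ball_psi k * dotp t t ^+ k) @ \oo -->
    complex.Re (borel_fourier ball_indicator t) /\
  complex.Im (borel_fourier ball_indicator t) = 0.
Proof.
have [ir ii] := cintegrable_phase t ball_indicator_integrable.
have RE x : complex.Re (ball_indicator x * cis (phase t x)) =
    \1_borel_ball x * cos (2 * pi * dotp x t).
  by rewrite ReM/= mul0r subr0 /phase cosN.
have IE x : complex.Im (ball_indicator x * cis (phase t x)) =
    \1_borel_ball x * - sin (2 * pi * dotp x t).
  by rewrite ImM/= mul0r addr0 /phase sinN.
split.
(* The partial sums of the cosine are bounded by cosh(2 pi x . t), and exp(alpha^2 - |x|^2) >= 1 on
   the ball. The product is an integrable majorant whose integral has already been computed. *)
- pose b (x : 'rV[R]_d) : R := expR (alpha ^+ 2) * (expR (- dotp x x) *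
    ((expR (dotp x ((2 * pi) *: t)) + expR (- dotp x ((2 * pi) *: t))) / 2)).
  have yE x : dotp x ((2 * pi) *: t) = 2 * pi * dotp x t by rewrite dotpC dotpZl dotpC.
  have mcosh : measurable_fun setT (fun x : 'rV[R]_d =>
      (expR (dotp x ((2 * pi) *: t)) + expR (- dotp x ((2 * pi) *: t))) / 2).
    apply: measurable_funM => //; apply: measurable_funD.
      by apply: measurableT_comp => //; exact: measurable_dotp.
    by apply: measurableT_comp => //; apply: measurableT_comp => //; exact: measurable_dotp.
  have mg : measurable_fun setT (fun x : 'rV[R]_d => expR (- dotp x x)).
    by apply: measurableT_comp => //; apply: measurableT_comp => //; exact: measurable_dotpxx.
  have ib : mu.-integrable setT (EFin \o b).
    rewrite (_ : _ \o _ = fun x => ((expR (alpha ^+ 2))%:E * (expR (- dotp x x) *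
      ((expR (dotp x ((2 * pi) *: t)) + expR (- dotp x ((2 * pi) *: t))) / 2))%:E)%E)//.
    apply: integrableZl => //; apply/integrableP; split.
      by apply/measurable_EFinP; exact: measurable_funM.
    under eq_integral do rewrite gee0_abs ?lee_fin ?mulr_ge0 ?expR_ge0 ?addr_ge0 ?expR_ge0//.
    by rewrite integral_gauss_cosh ltry.
  have c := (@cvg_Rintegral_dominated _ _ _ mu
    (fun n x => \1_borel_ball x * series (cos_coeff' (2 * pi * dotp x t)) n)
    (fun x => \1_borel_ball x * cos (2 * pi * dotp x t)) b set0
    measurable0 (measure0 _) _ _ ib _ _).2.
  have -> : complex.Re (borel_fourier ball_indicator t) =
      \int[mu]_x (\1_borel_ball x * cos (2 * pi * dotp x t)).
    by apply: eq_Rintegral => x _; exact: RE.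
  have E n : \int[mu]_x (\1_borel_ball x * series (cos_coeff' (2 * pi * dotp x t)) n) =
    series (fun k => ball_psi k * dotp t t ^+ k) n.
    exact: (Rintegral_ball_cos_partial t n).2.
  rewrite (funext E) in c; apply: c.
  + move=> n; have [/measurable_int mi _] := Rintegral_ball_cos_partial t n.
    by apply/measurable_EFinP.
  + have := measurable_int _ ir; move=> /measurable_EFinP; apply: eq_measurable_fun => x _.
    exact: RE.
  + move=> n x _; rewrite normrM.
    have [xb|xb] := boolP (dotp x x < alpha ^+ 2); last first.
      rewrite indic_borel_ball (negbTE xb) normr0 mul0r /b.
      by rewrite !mulr_ge0 ?expR_ge0// addr_ge0 ?expR_ge0.
    rewrite indic_borel_ball xb normr1 mul1r /b mulrA -expRD.
    have e1 : 1 <= expR (alpha ^+ 2 - dotp x x) by rewrite -expR0 ler_expR subr_ge0 ltW.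
    have P : `|series (cos_coeff' (2 * pi * dotp x t)) n| <=
        (expR (2 * pi * dotp x t) + expR (- (2 * pi * dotp x t))) / 2.
      apply: (@le_trans _ _ (series (fun k => (2 * pi * dotp x t) ^+ k.*2 / k.*2`!%:R) n)).
        rewrite /series/=; apply: (le_trans (ler_norm_sum _ _ _)); apply: ler_sum => k _.
        rewrite /cos_coeff' !normrM normrX normrN1 expr1n mul1r.
        rewrite ger0_norm ?sqr_even_ge0// ger0_norm//.
      have cs := @cosh_series R (2 * pi * dotp x t).
      rewrite -(cvg_lim _ cs)//; apply: nondecreasing_cvgn_le; last exact: cvgP cs.
      apply/nondecreasing_seqP => k; rewrite /= seriesS lerDr.
      by rewrite divr_ge0// sqr_even_ge0.
    rewrite yE; apply: (le_trans P); rewrite ler_peMl//.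
  + move=> x _; apply: cvgM; [exact: cvg_cst|exact: cvg_cos_coeff'].
- pose f (x : 'rV[R]_d) : R := \1_borel_ball x * - sin (2 * pi * dotp x t).
  have -> : complex.Im (borel_fourier ball_indicator t) = \int[mu]_x f x.
    by apply: eq_Rintegral => x _; exact: IE.
  have mf : measurable_fun setT f.
    have := measurable_int _ ii; move=> /measurable_EFinP; apply: eq_measurable_fun => x _.
    exact: IE.
  have fi : mu.-integrable setT (EFin \o f).
    by apply: eq_integrable ii => // x _; congr EFin; exact: IE.
  have fN x : f (- x) = -1 * f x.
    rewrite mulN1r.
    rewrite /f !indic_borel_ball !dotpNl [dotp x (- x)]dotpC dotpNl opprK.
    by rewrite !(mulrN, sinN).
  have := reflect_integral mf; under eq_Rintegral do rewrite fN.
  rewrite RintegralZl// mulN1r; move/eqP; rewrite eq_sym -subr_eq0 opprK -mulr2n mulrn_eq0/=.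
  by move/eqP.
Qed.

End ball_transform.

(** * Positivity of Psi below the first Bessel zero *)

Section bessel_positivity.
Context {R : realType} {d : nat}.
Hypothesis d0 : (0 < d)%N.
Variable alpha : R.
Hypothesis alpha0 : 0 < alpha.
Local Notation nu := (d%:R / 2 : R).
Local Notation psi := (@ball_psi R d alpha).
Local Notation Psi := (fun s : R => limn (pseries psi s)).

Let nu1 : 1 <= nu + 1.
Proof. by rewrite lerDr divr_ge0. Qed.

Let c0 : 0 < (pi * alpha) ^+ 2.
Proof. by rewrite exprn_gt0// mulr_gt0// pi_gt0. Qed.

Lemma exp_bounded_ball_psi : exp_bounded psi.
Proof.
exact: exp_bounded_bessel_type nu1 c0 (ball_psi0 d0 alpha0) (ball_psiS d0 alpha).
Qed.

(** The two series are proportional term by term: half the argument is pi alpha sqrt s, whose power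
    of exponent 2k + nu supplies pi^nu = V and alpha^nu, and alpha^d = alpha^nu alpha^nu explains
    the quotient by alpha^nu. *)
Lemma besselJ_ball (s : R) : 0 < s ->
  besselJ nu (2 * pi * alpha * Num.sqrt s) =
  Num.sqrt s `^ nu / alpha `^ nu * Psi s.
Proof.
move=> s0; have r0 : 0 < Num.sqrt s by rewrite sqrtr_gt0.
have p0 : (0 : R) < pi by exact: pi_gt0.
have w0 : 0 < pi * alpha * Num.sqrt s by rewrite !mulr_gt0.
have an0 : alpha `^ nu != 0 by rewrite gt_eqF// powR_gt0.
pose C := Num.sqrt s `^ nu / alpha `^ nu.
have E : series (fun k : nat =>
    (- 1) ^+ k / (k`!%:R * Gamma (k%:R + nu + 1)) *
    (2 * pi * alpha * Num.sqrt s / 2) `^ (2 * k%:R + nu)) =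
    (fun n => C * pseries psi s n).
  apply/funext => n; rewrite /pseries /series/= mulr_sumr; apply: eq_bigr => k _.
  rewrite (_ : 2 * pi * alpha * Num.sqrt s / 2 = pi * alpha * Num.sqrt s); last first.
    have key (p : R) : 2 * p * alpha * Num.sqrt s / 2 = p * alpha * Num.sqrt s by field.
    exact: key.
  rewrite powRD; last by rewrite (gt_eqF w0) implybT.
  rewrite -natrM powR_mulrn ?(ltW w0)// mul2n.
  rewrite [(pi * alpha * Num.sqrt s) `^ _]powRM ?mulr_ge0 ?ltW// powRM ?ltW//.
  have VE : pi `^ nu = Num.sqrt pi ^+ d :> R.
    by rewrite mulrC powRrM powR12_sqrt ?ltW// powR_mulrn// sqrtr_ge0.
  have aE : alpha ^+ d = alpha `^ nu * alpha `^ nu.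
    rewrite -powRD; last by rewrite (gt_eqF alpha0) implybT.
    by rewrite -splitr powR_mulrn// ltW.
  have sE : Num.sqrt s ^+ k.*2 = s ^+ k by rewrite -mul2n exprM sqr_sqrtr ?ltW.
  rewrite VE /ball_psi /C exprD aE !exprMn sE.
  have [G0 _] := @gammaE_Gamma R d d0 k.
  have f0 : k`!%:R != 0 :> R by rewrite pnatr_eq0 -lt0n fact_gt0.
  have key (F G g V p a an sn S : R) : F != 0 -> G != 0 -> an != 0 ->
    g / (F * G) * (p * a * S * (V * an * sn)) =
    sn / an * (g * V * p * (an * an * a) / (F * G) * S).
    by move=> F0 G1 n0; field; rewrite F0 G1 n0.
  by apply: key => //; rewrite gt_eqF.
rewrite /besselJ E; apply/cvg_lim => //; apply: cvgM; first exact: cvg_cst.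
exact: exp_bounded_cvg exp_bounded_ball_psi.
Qed.

(** Psi(0) > 0, so a nonpositive value would yield a zero x of Psi in ]0, S] by the intermediate
    value theorem, hence a zero of the Bessel function at 2 pi alpha sqrt x. The infimum
    [bessel_zero nu 1] is at most this zero, against the hypothesis. *)
Lemma ball_Psi_gt0 (S : R) : 0 < S ->
  2 * pi * alpha * Num.sqrt S < bessel_zero nu 1 ->
  forall s, 0 <= s <= S -> 0 < Psi s.
Proof.
move=> S0 hS s /andP[s0 sS]; rewrite ltNge; apply/negP => Ps.
have P0 : 0 < Psi 0 by rewrite lim_pseries0 ball_psi0.
have cP : {within `[0, s], continuous Psi}.
  apply: is_derive_within_continuous => x.
  exact: exp_bounded_is_derive exp_bounded_ball_psi.
have [x] := @IVT _ Psi 0 s 0 s0 cP (ltac:(by rewrite ge_min Ps orbT le_max (ltW P0))).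
rewrite in_itv/= => /andP[x0 xs] Px.
have {}x0 : 0 < x.
  rewrite lt_neqAle x0 andbT; apply/eqP => x0'; move: Px; rewrite -x0' => Px.
  by move: P0; rewrite Px ltxx.
have : bessel_zero nu 1 <= 2 * pi * alpha * Num.sqrt x.
  rewrite /=; apply: ge_inf.
    by exists 0 => z /= [/ltW].
  split; last by rewrite besselJ_ball// Px mulr0.
  by rewrite !mulr_gt0 ?pi_gt0// sqrtr_gt0.
apply/negP; rewrite -ltNge; apply: le_lt_trans hS.
apply: ler_wpM2l; first by rewrite !mulr_ge0 ?pi_ge0// ltW.
by rewrite ler_sqrt ?(le_trans xs)// ltW.
Qed.

(** The origin of the constant of the theorem: it is the norm bound 1 / Psi(d lambda^2) of the
    inverse multiplier, rewritten with sqrt (d lambda^2) = sqrt d lambda. *)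
Lemma bessel_constant (lambda : R) : 0 < lambda ->
  (Num.sqrt d%:R * lambda) `^ nu /
     (alpha `^ nu * besselJ nu (2 * pi * Num.sqrt d%:R * alpha * lambda)) =
  (Psi (d%:R * lambda ^+ 2))^-1.
Proof.
move=> l0; pose s : R := d%:R * lambda ^+ 2.
have s0 : 0 < s by rewrite mulr_gt0 ?ltr0n// exprn_gt0.
have sE : Num.sqrt s = Num.sqrt d%:R * lambda.
  by rewrite sqrtrM// sqrtr_sqr gtr0_norm.
rewrite -sE (_ : 2 * pi * _ * _ * _ = 2 * pi * alpha * Num.sqrt s); last by rewrite sE; ring.
rewrite besselJ_ball// -/s.
have a0 : alpha `^ nu != 0 by rewrite gt_eqF// powR_gt0.
have b0 : Num.sqrt s `^ nu != 0 by rewrite gt_eqF// powR_gt0// sqrtr_gt0.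
by rewrite mulrA [alpha `^ _ * _]mulrC divfK// invfM mulrA divff// mul1r.
Qed.

End bessel_positivity.

(** * Convolution with a ball *)

Section complex_fubini.
Context {R : realType} {d1 d2 : measure_display}.
Context {T1 : measurableType d1} {T2 : measurableType d2}.
Variables (m1 : {sigma_finite_measure set T1 -> \bar R})
  (m2 : {sigma_finite_measure set T2 -> \bar R}).
Local Notation Re := (@complex.Re R).
Local Notation Im := (@complex.Im R).

(** Integrability of every section, and not only of almost every one, makes the inner real integrals
    agree everywhere with the extended ones, to which Fubini's theorem applies. *)
Lemma Rintegral_fubini (f : T1 * T2 -> R) : (m1 \x m2)%E.-integrable setT (EFin \o f) ->
  (forall x, m2.-integrable setT (fun y => (f (x, y))%:E)) ->
  (forall y, m1.-integrable setT (fun x => (f (x, y))%:E)) ->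
  m1.-integrable setT (fun x => (\int[m2]_y f (x, y))%:E) /\
  \int[m1]_x \int[m2]_y f (x, y) = \int[m2]_y \int[m1]_x f (x, y).
Proof.
move=> fi f2 f1.
have E2 x : (\int[m2]_y f (x, y))%:E = (\int[m2]_y (f (x, y))%:E)%E.
  by rewrite fineK//; exact: integrable_fin_num.
have E1 y : (\int[m1]_x f (x, y))%:E = (\int[m1]_x (f (x, y))%:E)%E.
  by rewrite fineK//; exact: integrable_fin_num.
split.
  apply: eq_integrable (integrable_fubini_F fi) => // x _.
rewrite /Rintegral; congr fine.
under eq_integral do rewrite E2; under [RHS]eq_integral do rewrite E1.
exact: (Fubini fi).
Qed.

Lemma cintegral_fubini (F : T1 * T2 -> R[i]) : cintegrable (m1 \x m2)%E F ->
  (forall x, cintegrable m2 (fun y => F (x, y))) ->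
  (forall y, cintegrable m1 (fun x => F (x, y))) ->
  cintegrable m1 (fun x => cintegral m2 (fun y => F (x, y))) /\
  cintegral m1 (fun x => cintegral m2 (fun y => F (x, y))) =
  cintegral m2 (fun y => cintegral m1 (fun x => F (x, y))).
Proof.
move=> [Fr Fi] F2 F1.
have [r1 r2] := Rintegral_fubini Fr (fun x => (F2 x).1) (fun y => (F1 y).1).
have [i1 i2] := Rintegral_fubini Fi (fun x => (F2 x).2) (fun y => (F1 y).2).
by split; [split|apply: eq_ReIm].
Qed.

End complex_fubini.

Section cmod_integral.
Context {R : realType} {dd : measure_display} {T : measurableType dd}.
Variable mu : {measure set T -> \bar R}.
Local Notation Re := (@complex.Re R).
Local Notation Im := (@complex.Im R).

(** With [w] the conjugate of the integral z, |z|^2 is the real part of the integral of f w, which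
    is at most |z| times the norm of f; then divide by |z|. *)
Lemma cmod_cintegral (f : T -> R[i]) : cintegrable mu f ->
  ((cmod (cintegral mu f))%:E <= cnorm1 mu f)%E.
Proof.
move=> fi; set z := cintegral mu f.
have [z0|z0] := eqVneq (cmod z) 0; first by rewrite z0 cnorm1_ge0.
have zp : 0 < cmod z by rewrite lt_neqAle eq_sym z0 cmod_ge0.
pose w : R[i] := (Re z +i* - Im z)%C.
have wz : cmod w = cmod z by rewrite !cmodE/= sqrrN.
have fwi := cintegrableMr w fi.
have fwE := cintegralMr w fi.
have sq : Re (cintegral mu (fun x => f x * w)) = cmod z ^+ 2.
  rewrite fwE ReM/= mulrN opprK -!expr2 cmodE sqr_sqrtr//.
  by rewrite addr_ge0// sqr_ge0.
rewrite -(@lee_pmul2l _ (cmod z)%:E)// -EFinM -expr2 -sq.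
have -> : (Re (cintegral mu (fun x => f x * w)))%:E = (\int[mu]_x (Re (f x * w))%:E)%E.
  by rewrite /= fineK//; apply: integrable_fin_num => //; exact: fwi.1.
have fm := cintegrable_measurable fi.
have mc : measurable_fun setT (fun x => (cmod (f x))%:E).
  by apply/measurable_EFinP; exact: cmeasurable_cmod.
rewrite -ge0_integralZl//; [|by move=> x _; rewrite lee_fin cmod_ge0|by rewrite lee_fin cmod_ge0].
apply: (@le_trans _ _ (\int[mu]_x `|Re (f x * w)|%:E)%E).
  have := le_abse_integral mu measurableT (measurable_int _ fwi.1).
  by apply: le_trans; exact: lee_abs.
apply: ge0_le_integral => //.
- apply/measurable_EFinP; apply: measurableT_comp => //.
  by case: (cintegrable_measurable fwi).
- by apply: measurable_funeM.
- by move=> x _; rewrite -EFinM lee_fin (le_trans (Re_le_cmod _))// cmodM wz mulrC.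
Qed.

End cmod_integral.

Section ball_convolution.
Context {R : realType} {d : nat}.
Hypothesis d0 : (0 < d)%N.
Variable alpha : R.
Hypothesis alpha0 : 0 < alpha.
Local Notation mu := (@borel_lebesgue R d).
Local Notation V := 'rV[R]_d.
Local Notation K := (@ball_indicator R d alpha).

Lemma measurable_subr_rV : measurable_fun setT (fun p : V * V => p.1 - p.2).
Proof.
apply: measurable_fun_rV => i.
rewrite (_ : _ \o _ = (fun p : V * V => rVcoor i p.1 - rVcoor i p.2)); last first.
  by apply/funext => x; rewrite /rVcoor/= !mxE.
apply: measurable_funB.
  exact: (measurableT_comp (measurable_rVcoor i) measurable_fst).
exact: (measurableT_comp (measurable_rVcoor i) measurable_snd).
Qed.

Lemma measurable_ball_indic : measurable_fun setT (\1_(borel_ball alpha) : V -> R).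
Proof. by apply: measurable_indic; exact: measurable_borel_ball. Qed.

Lemma measurable_ball_indic2 :
  measurable_fun setT (fun p : V * V => \1_(borel_ball alpha) (p.1 - p.2) : R).
Proof. exact: (measurableT_comp measurable_ball_indic measurable_subr_rV). Qed.

Definition ball_conv (H : V -> R[i]) (x : V) : R[i] :=
  cintegral mu (fun y => K (x - y) * H y).

Variable H : V -> R[i].
Hypothesis Hi : cintegrable mu H.

Let Hm := cintegrable_measurable Hi.

Lemma cmod_ball_indicator x : cmod (K x) = \1_(borel_ball alpha) x.
Proof. by rewrite cmod_real ger0_norm. Qed.

Lemma measurable_cmod_snd : measurable_fun setT (fun p : V * V => cmod (H p.2)).
Proof. exact: (measurableT_comp (cmeasurable_cmod Hm) measurable_snd). Qed.

Lemma cintegrable_ball_mul x : cintegrable mu (fun y => K (x - y) * H y).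
Proof.
under eq_fun do rewrite mulrC; apply: (@cintegrableM_bounded _ _ _ _ _ _ 1) => //.
  apply: cmeasurable_real; apply: (measurableT_comp measurable_ball_indic).
  have := measurable_affine_rV (-1) x; congr measurable_fun.
  by apply/funext => y; rewrite scaleN1r addrC.
by move=> y; rewrite cmod_ball_indicator indic_borel_ball; case: (_ < _); rewrite ?ler01.
Qed.

Lemma cintegrable_ball_conv_kernel (u : V -> R) : measurable_fun setT u ->
  cintegrable (mu \x mu)%E (fun p : V * V => K (p.1 - p.2) * H p.2 * cis (u p.1)).
Proof.
move=> mu_; apply/cintegrableP; split.
  apply: cmeasurableM; last by apply: cmeasurable_cis; exact: (measurableT_comp mu_ measurable_fst).
  apply: cmeasurableM; first by apply: cmeasurable_real; exact: measurable_ball_indic2.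
  by case: Hm => h1 h2; split; [exact: (measurableT_comp h1 measurable_snd)|
    exact: (measurableT_comp h2 measurable_snd)].
rewrite /cnorm1 fubini_tonelli2; last 2 first.
- apply/measurable_EFinP; under eq_fun do rewrite !cmodM cmod_cis mulr1 cmod_ball_indicator.
  by apply: measurable_funM; [exact: measurable_ball_indic2|exact: measurable_cmod_snd].
- by move=> p; rewrite lee_fin cmod_ge0.
(* By translation invariance the inner integral is the measure of the ball, which appears here as
   its moment of order 0. *)
rewrite (_ : (\int[mu]_y _)%E =
    (\int[mu]_y ((ball_moment alpha (0 : V) 0)%:E * (cmod (H y))%:E))%E); last first.
  apply: eq_integral => y _; rewrite /fubini_G.
  rewrite -(integral_ball_moment d0 alpha0) -ge0_integralZr//; last 3 first.
  - apply/measurable_EFinP; apply: measurable_funM; first exact: measurable_ball_indic.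
    by apply: measurable_funX; exact: measurable_dotp.
  - by move=> x _; rewrite lee_fin mulr_ge0// sqr_even_ge0.
  - by rewrite lee_fin cmod_ge0.
  rewrite -[RHS](ge0_integral_translate (- y))//.
  - apply: eq_integral => x _.
    by rewrite !cmodM cmod_cis mulr1 cmod_ball_indicator double0 expr0 mulr1 EFinM.
  - apply/measurable_EFinP; apply: measurable_funM => //.
    apply: measurable_funM; first exact: measurable_ball_indic.
    by apply: measurable_funX; exact: measurable_dotp.
  - by move=> x; rewrite -EFinM lee_fin mulr_ge0 ?cmod_ge0// mulr_ge0// sqr_even_ge0.
rewrite ge0_integralZl//; last 3 first.
- by apply/measurable_EFinP; exact: cmeasurable_cmod.
- by move=> x _; rewrite lee_fin cmod_ge0.
- rewrite -(integral_ball_moment d0 alpha0); apply: integral_ge0 => x _.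
  by rewrite lee_fin mulr_ge0// sqr_even_ge0.
have hf : cnorm1 mu H \is a fin_num by rewrite ge0_fin_numE ?cnorm1_ge0// cnorm1_fin.
by rewrite -/(cnorm1 mu H) -(fineK hf) -EFinM ltry.
Qed.

Lemma cintegrable_ball_shift (y : V) : cintegrable mu (fun x => K (x - y)).
Proof. exact: cintegrable_translate (ball_indicator_integrable d0 alpha0). Qed.

Lemma ball_conv_fourier t : cintegrable mu (ball_conv H) /\
  borel_fourier (ball_conv H) t = borel_fourier K t * borel_fourier H t.
Proof.
(* A general phase [u] serves twice: u = 0 gives the integrability of the convolution, and the
   Fourier phase gives its transform. *)
have P (u : V -> R) : measurable_fun setT u ->
    cintegrable mu (fun x => ball_conv H x * cis (u x)) /\
    cintegral mu (fun x => ball_conv H x * cis (u x)) =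
    cintegral mu (fun y => cintegral mu (fun x => K (x - y) * cis (u x)) * H y).
  move=> mu_.
  have s1 (x : V) : cintegrable mu (fun y => K (x - y) * H y * cis (u x)).
    by apply: cintegrableMr; exact: cintegrable_ball_mul.
  have s2' (y : V) : cintegrable mu (fun x => K (x - y) * cis (u x)).
    by apply: cintegrable_cis => //; exact: cintegrable_ball_shift.
  have s2E (y : V) : (fun x => K (x - y) * H y * cis (u x)) =
      (fun x => K (x - y) * cis (u x) * H y).
    by apply/funext => x; rewrite mulrAC.
  have s2 (y : V) : cintegrable mu (fun x => K (x - y) * H y * cis (u x)).
    by rewrite s2E; exact: cintegrableMr.
  have [h1 h2] : cintegrable mu (fun x => cintegral mu (fun y => K (x - y) * H y * cis (u x))) /\
      cintegral mu (fun x => cintegral mu (fun y => K (x - y) * H y * cis (u x))) =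
      cintegral mu (fun y => cintegral mu (fun x => K (x - y) * H y * cis (u x))).
    exact: (cintegral_fubini (cintegrable_ball_conv_kernel mu_) s1 s2).
  have E : (fun x => ball_conv H x * cis (u x)) =
      (fun x => cintegral mu (fun y => K (x - y) * H y * cis (u x))).
    apply/funext => x; rewrite /ball_conv; apply/esym.
    exact: (cintegralMr (cis (u x)) (cintegrable_ball_mul x)).
  rewrite E; split; first exact: h1.
  apply: (etrans h2); apply: (f_equal (cintegral mu)); apply/funext => y.
  rewrite s2E; exact: (cintegralMr (H y) (s2' y)).
split.
  have [h _] := P (fun=> 0) (measurable_cst _).
  move: h; congr cintegrable; apply/funext => x.
  by rewrite /cis cos0 sin0 mulr1.
apply: (etrans (P _ (measurable_phase t)).2).
have E (y : V) : cintegral mu (fun x => K (x - y) * cis (phase t x)) =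
    borel_fourier K t * cis (phase t y).
  rewrite -[LHS]/(borel_fourier (fun x => K (x - y)) t) borel_fourier_translate.
    by rewrite phaseN (opprK (phase t y)).
  exact: ball_indicator_integrable.
rewrite (_ : (fun y => _) = (fun y => H y * cis (phase t y) * borel_fourier K t)).
  apply: (etrans (cintegralMr (borel_fourier K t) (cintegrable_phase t Hi))).
  by rewrite mulrC.
by apply/funext => y; rewrite E mulrC [borel_fourier K t * _]mulrC mulrA.
Qed.

(** [M] is an arbitrary extended bound, so that the supremum taken with the completed measure can be
    used for it in the end. *)
Lemma ball_conv_norm (N : set V) (M : \bar R) : measurable N ->
  (forall y, mu (N `&` [set x : V | (dotp (x - y) (x - y) < alpha ^+ 2)%R]) <= M)%E ->
  (\int[mu]_x (cmod (ball_conv H x) * \1_N x)%:E <= M * cnorm1 mu H)%E.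
Proof.
move=> mN hM.
pose f (p : V * V) : \bar R := (\1_N p.1 * \1_(borel_ball alpha) (p.1 - p.2) * cmod (H p.2))%:E.
have mNi : measurable_fun setT (\1_N : V -> R) by exact: measurable_indic.
have mf : measurable_fun setT f.
  apply/measurable_EFinP; apply: measurable_funM; last exact: measurable_cmod_snd.
  apply: measurable_funM; last exact: measurable_ball_indic2.
  exact: (measurableT_comp mNi measurable_fst).
have f0 p : (0 <= f p)%E by rewrite lee_fin !mulr_ge0// cmod_ge0.
have [Ci _] := ball_conv_fourier 0.
apply: (@le_trans _ _ (\int[mu]_x \int[mu]_y f (x, y))%E).
  apply: ge0_le_integral => //.
  - by move=> x _; rewrite lee_fin mulr_ge0// cmod_ge0.
  - apply/measurable_EFinP; apply: measurable_funM => //.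
    by apply: cmeasurable_cmod; exact: (cintegrable_measurable Ci).
  - have := @measurable_fun_fubini_tonelli_F _ _ V V R mu f mf f0; apply.
  - move=> x _; have hm := cintegrable_measurable (cintegrable_ball_mul x).
    rewrite mulrC EFinM.
    have L : ((\1_N x)%:E * (cmod (ball_conv H x))%:E <=
        (\1_N x)%:E * cnorm1 mu (fun y => (K (x - y) * H y)%R))%E.
      by rewrite lee_wpmul2l ?lee_fin//; apply: cmod_cintegral; exact: cintegrable_ball_mul.
    apply: (le_trans L).
    rewrite /cnorm1 -ge0_integralZl//; last 2 first.
    + by apply/measurable_EFinP; exact: cmeasurable_cmod.
    + by move=> y _; rewrite lee_fin cmod_ge0.
    rewrite le_eqVlt; apply/orP; left; apply/eqP; apply: eq_integral => y _.
    by rewrite cmodM cmod_ball_indicator /f -EFinM mulrA.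
rewrite fubini_tonelli//.
rewrite /cnorm1 -ge0_integralZl//; last 3 first.
- by apply/measurable_EFinP; exact: cmeasurable_cmod.
- by move=> y _; rewrite lee_fin cmod_ge0.
- exact: le_trans (hM 0).
apply: ge0_le_integral => //.
- by move=> y _; apply: integral_ge0.
- have := @measurable_fun_fubini_tonelli_G _ _ V V R mu f mf f0; apply.
- apply: emeasurable_funM => //; by apply/measurable_EFinP; exact: cmeasurable_cmod.
- move=> y _; pose B := N `&` [set x : V | dotp (x - y) (x - y) < alpha ^+ 2].
  have mB : measurable B.
    apply: measurableI => //.
    have := @measurable_ltr_set R _ V (fun x => dotp (x - y) (x - y)) (fun=> alpha ^+ 2).
    apply => //; apply: (measurableT_comp (@measurable_dotpxx R d)).
    exact: measurable_translate.
  apply: (@le_trans _ _ (mu B * (cmod (H y))%:E)%E); last first.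
    by rewrite lee_wpmul2r ?lee_fin ?cmod_ge0//; exact: hM.
  rewrite -[B]setIT -(integral_indic mu measurableT mB) -ge0_integralZr//; last 2 first.
  + by apply/measurable_EFinP; exact: measurable_indic.
  + by rewrite lee_fin cmod_ge0.
  rewrite le_eqVlt; apply/orP; left; apply/eqP; apply: eq_integral => x _.
  rewrite /f/= -EFinM; congr (_ * _)%:E; rewrite /B indicI/=; congr (_ * _).
Qed.

End ball_convolution.

(** * The large sieve inequality *)

Section large_sieve.
Context {R : realType} {d : nat}.
Hypothesis d0 : (0 < d)%N.
Variables (alpha lambda : R).
Hypotheses (alpha0 : 0 < alpha) (lambda0 : 0 < lambda).
Hypothesis hzero :
  2 * pi * Num.sqrt d%:R * alpha * lambda < bessel_zero (d%:R / 2) 1.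
Local Notation mu := (@borel_lebesgue R d).
Local Notation V := 'rV[R]_d.
Local Notation Psi := (fun s : R => limn (pseries (@ball_psi R d alpha) s)).

Lemma borel_large_sieve (G : V -> R[i]) (N : set V) (M : \bar R) :
  band_limited lambda G -> measurable N ->
  (forall y, mu (N `&` [set x : V | (dotp (x - y) (x - y) < alpha ^+ 2)%R]) <= M)%E ->
  (\int[mu]_x (cmod (G x) * \1_N x)%:E <=
   ((Psi (d%:R * lambda ^+ 2))^-1)%R%:E * M * cnorm1 mu G)%E.
Proof.
move=> bG mN hM; have [Gi G0] := bG.
pose S : R := d%:R * lambda ^+ 2.
have S0 : 0 < S by rewrite mulr_gt0 ?ltr0n// exprn_gt0.
have PS s : 0 <= s <= S -> 0 < Psi s.
  apply: ball_Psi_gt0 => //.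
  rewrite /S sqrtrM// sqrtr_sqr gtr0_norm//.
  by move: hzero; congr (_ < _); ring.
have [a [a0 aS aP]] : exists a : nat -> R, [/\ forall n, 0 <= a n, cvgn (pseries a S) &
    forall s, 0 <= s <= S -> limn (pseries a s) * Psi s = 1].
  have b1 : 1 <= d%:R / 2 + 1 :> R by rewrite lerDr divr_ge0.
  have c0 : 0 < (pi * alpha) ^+ 2 by rewrite exprn_gt0// mulr_gt0// pi_gt0.
  exact: (inverse_series b1 c0 (ball_psi0 d0 alpha0) (ball_psiS d0 alpha) (ltW S0) PS).
have ca (t : V) : cube lambda t -> cvgn (pseries a (dotp t t)).
  move=> /(dotp_cube lambda0)/andP[t0 tS].
  apply: (@series_le_cvg _ _ (fun k => a k * S ^+ k)) => //.
  - by move=> k; rewrite mulr_ge0// exprn_ge0.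
  - by move=> k; rewrite mulr_ge0// exprn_ge0// ltW.
  - by move=> k; rewrite ler_wpM2l// lerXn2r// nnegrE// ltW.
have [H [Hi HE HC]] := multiplier_pseries lambda0 a0 aS ca bG.
have [Ci _] := ball_conv_fourier d0 alpha0 Hi 0.
have nCi := cintegrableMr (-1) Ci.
(* G - K * H has zero transform: on the cube the factor Psi(|t|^2) of the ball cancels the
   multiplier 1 / Psi(|t|^2), and off the cube both transforms vanish with that of [G]. *)
have FT0 t : borel_fourier (fun x => G x + ball_conv alpha H x * -1) t = 0.
  rewrite borel_fourierD// borel_fourierMr//.
  have [_ ->] := ball_conv_fourier d0 alpha0 Hi t.
  rewrite HE; have [ct|nt] := pselect (cube lambda t); last by rewrite G0// !mulr0 mul0r addr0.
  have -> : borel_fourier (ball_indicator alpha) t = (Psi (dotp t t))%:C%C.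
    have [c c0] := borel_fourier_ball d0 alpha0 t.
    by apply: eq_ReIm; [apply/esym; exact: cvg_lim c|exact: c0].
  rewrite mulrA -rmorphM/= (mulrC (Psi (dotp t t))) aP ?(dotp_cube lambda0)//.
  by rewrite mul1r mulrN1 addrN.
have [Z [mZ Z0 ZE]] := borel_fourier_inj (cintegrableD Gi nCi) FT0.
have GE x : ~ Z x -> G x = ball_conv alpha H x.
  by move=> /ZE/eqP; rewrite mulrN1 subr_eq0 => /eqP.
have mNi : measurable_fun setT (\1_N : V -> R) by exact: measurable_indic.
have mc (f : V -> R[i]) : cintegrable mu f ->
    measurable_fun setT (fun x => (cmod (f x) * \1_N x)%:E).
  move=> fi; apply/measurable_EFinP; apply: measurable_funM => //.
  by apply: cmeasurable_cmod; exact: cintegrable_measurable fi.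
have -> : (\int[mu]_x (cmod (G x) * \1_N x)%:E =
    \int[mu]_x (cmod (ball_conv alpha H x) * \1_N x)%:E)%E.
  apply: ae_eq_integral => //; [exact: mc|exact: mc|].
  exists Z; split => // x /= nGE; apply: contrapT => /GE Gx; apply: nGE => _.
  by rewrite Gx.
apply: (le_trans (ball_conv_norm d0 alpha0 Hi mN hM)).
have M0 : (0 <= M)%E by exact: le_trans (hM 0).
rewrite [X in (_ <= X * _)%E]muleC -muleA lee_wpmul2l//.
apply: (le_trans HC); rewrite lee_wpmul2r ?cnorm1_ge0// lee_fin.
have PS0 : 0 < Psi S by apply: PS; rewrite lexx ltW.
by rewrite -[leLHS](mulfK (lt0r_neq0 PS0)) aP ?mul1r// lexx ltW.
Qed.

End large_sieve.

Theorem theorem2 (R : realType) (d : nat) (hd : (1 <= d)%N)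
    (N : set (Rd R d)) (mN : measurable N) (alpha lambda : R)
    (halpha : 0 < alpha) (hlambda : 0 < lambda)
    (hzero : 2 * pi * Num.sqrt d%:R * alpha * lambda
             < bessel_zero (d%:R / 2) 1)
    (G : 'rV[R]_d -> R[i]) (hG : G \in paley_wiener1 (cube lambda)) :
  (norm1 (fun x => G x * (\1_N x : R)%:C%C)%R <=
    ((Num.sqrt d%:R * lambda) `^ (d%:R / 2) /
     (alpha `^ (d%:R / 2) *
      besselJ (d%:R / 2) (2 * pi * Num.sqrt d%:R * alpha * lambda)))%R%:E *
    ereal_sup [set lebesgue_Rd (N `&` eball x alpha) | x in [set: 'rV[R]_d]] *
    norm1 G)%E.
Proof.
move: hG; rewrite inE => -[[Gr Gi] supp0].
have mGr : measurable_fun setT (fun x : Rd R d => complex.Re (G x)).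
  by apply/measurable_EFinP; exact: measurable_int Gr.
have mGi : measurable_fun setT (fun x : Rd R d => complex.Im (G x)).
  by apply/measurable_EFinP; exact: measurable_int Gi.
(* Borel versions of the real part of [G], of its imaginary part and of [N], with a common
   exceptional null set [Z]; integrals, norms and Fourier transforms do not see the change. *)
have [gr [Zr [mgr mZr Zr0 grE]]] := caratheodory_fun_borel_version mGr.
have [gi [Zi [mgi mZi Zi0 giE]]] := caratheodory_fun_borel_version mGi.
have [B [ZN [mB mZN ZN0 BE]]] := caratheodory_borel_version mN.
pose Z := Zr `|` Zi `|` ZN.
have mZ : measurable Z by apply: measurableU => //; exact: measurableU.
have Z0 : borel_lebesgue d Z = 0%E by rewrite /Z !measureU0//; apply: measurableU.
pose g (x : 'rV[R]_d) : R[i] := (gr x +i* gi x)%C.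
have gE x : ~ Z x -> G x = g x.
  move=> nZ; apply: eq_ReIm => /=.
    by apply: grE => Zx; apply: nZ; left; left.
  by apply: giE => Zx; apply: nZ; left; right.
have NE x : ~ Z x -> N x <-> B x by move=> nZ; apply: BE => Zx; apply: nZ; right.
have g_int : cintegrable (borel_lebesgue d) g.
  split; [apply: (integrable_Rd_ae mZ Z0 _ _ Gr)|apply: (integrable_Rd_ae mZ Z0 _ _ Gi)].
  - by move=> x /gE /= ->.
  - exact/measurable_EFinP.
  - by move=> x /gE /= ->.
  - exact/measurable_EFinP.
have FTE t : fourier G t = borel_fourier g t.
  have [hr hi] := cintegrable_measurable (cintegrable_phase t g_int).
  apply: eq_ReIm => /=; congr fine; apply: (integral_Rd_ae mZ Z0).
  - by move=> x /gE ->.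
  - exact/measurable_EFinP.
  - by move=> x /gE ->.
  - exact/measurable_EFinP.
have bg : band_limited lambda g.
  (* Contraposition: a frequency where the transform does not vanish lies in the support, hence in
     the cube. *)
  split => // t nt; apply/eqP; apply: contrapT => /negP gt0; apply: nt.
  by apply: supp0; apply: subset_closure; rewrite /= FTE.
have mcg : measurable_fun setT (fun x => cmod (g x)).
  by apply: cmeasurable_cmod; exact: cintegrable_measurable g_int.
have nG : norm1 G = cnorm1 (borel_lebesgue d) g.
  apply: (integral_Rd_ae mZ Z0) => [x /gE ->//|]; exact/measurable_EFinP.
have nGN : norm1 (fun x => G x * (\1_N x : R)%:C%C)%R =
    (\int[borel_lebesgue d]_x (cmod (g x) * \1_B x)%:E)%E.
  apply: (integral_Rd_ae mZ Z0).
    move=> x nZ; rewrite cmodM cmod_real ger0_norm// (gE x nZ); congr (_ * _)%:E.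
    rewrite !indicE; congr (nat_of_bool _)%:R.
    by apply/idP/idP; rewrite !inE => /(NE x nZ).
  by apply/measurable_EFinP; apply: measurable_funM => //; exact: measurable_indic.
rewrite nG nGN bessel_constant//.
apply: borel_large_sieve => // y.
set E := [set x : 'rV[R]_d | dotp (x - y) (x - y) < alpha ^+ 2].
have EE : eball y alpha = E.
  apply/seteqP; split => x; rewrite /eball /E /=.
    by rewrite -[X in _ < X -> _]gtr0_norm// -sqrtr_sqr ltr_sqrt// exprn_gt0.
  by rewrite -[X in _ -> _ < X]gtr0_norm// -sqrtr_sqr ltr_sqrt// exprn_gt0.
have mE : measurable E.
  have := @measurable_ltr_set R _ 'rV[R]_d (fun x => dotp (x - y) (x - y)) (fun=> alpha ^+ 2).
  apply => //; apply: (measurableT_comp (@measurable_dotpxx R d)).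
  exact: measurable_translate.
apply: (@le_trans _ _ (lebesgue_Rd (N `&` eball y alpha))); last first.
  by apply: ereal_sup_ubound; exists y.
rewrite EE; have mER := measurable_Rd_borel mE; have mZR := measurable_Rd_borel mZ.
have mNE : measurable (N `&` E : set (Rd R d)) by exact: measurableI.
rewrite -lebesgue_Rd_borel; last exact: measurableI.
(* [B] and [N] agree only off [Z], so the part of [B] in the ball is enclosed in that of [N]
   enlarged by [Z], which is null for the completed measure. *)
apply: (@le_trans _ _ (lebesgue_Rd ((N `&` E) `|` Z))).
  apply: le_measure; rewrite ?inE.
  - by apply: measurable_Rd_borel; exact: measurableI.
  - exact: measurableU.
  - move=> x [Bx Ex]; have [Zx|nZ] := pselect (Z x); first by right.
    by left; split => //; apply/(NE x nZ).
rewrite measureU0//; last by rewrite -[RHS]Z0; exact: lebesgue_Rd_borel.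
Qed.
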